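(* Let $M^5(c)$ be a $5$-dimensional cosymplectic space form with structure $(\phi,\xi,\eta,g)$ and constant $\phi$-sectional curvature $c$, let $(N^2,g_N)$ be a $2$-dimensional Riemannian manifold, and let $F:M^5(c)\to N^2$ be a proper slant Riemannian submersion with slant angle $\theta$ such that $\xi$ is vertical. Then at every point of every fibre $$\|H\|^2\ \ge\ \frac{8}{9}\left(\hat\tau-\frac{c}{4}\left(1+3\cos^2\theta\right)\right),$$ where $H$ is the mean curvature vector field of the fibres and $\hat\tau$ is the scalar curvature of the fibre. Moreover, equality holds at a point $p$ of a fibre if and only if, with respect to some suitable slant orthonormal basis $$\{e_1,\ e_2=\sec\theta\,\psi e_1,\ e_3=\xi,\ e_4=\csc\theta\,\omega e_1,\ e_5=\csc\theta\,\omega e_2\}$$ at $p$, one has $$T^4_{11}=3T^4_{22},\qquad T^4_{12}=0,\qquad T^5_{11}=0,$$ where $T^\alpha_{ij}=g(\mathcal T(e_i,e_j),e_\alpha)$ for $1\le i,j\le 3$ and $\alpha=4,5$.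
   Context: An almost contact metric structure $(\phi,\xi,\eta,g)$ on an odd-dimensional manifold $M$ consists of a $(1,1)$-tensor $\phi$, a vector field $\xi$, a $1$-form $\eta$ and a Riemannian metric $g$ with $\phi^2=-I+\eta\otimes\xi$, $\phi\xi=0$, $\eta\circ\phi=0$, $\eta(\xi)=1$, $g(\phi X,\phi Y)=g(X,Y)-\eta(X)\eta(Y)$, $\eta(X)=g(X,\xi)$. It is cosymplectic if it is normal and $\eta$ and $\Phi(X,Y)=g(X,\phi Y)$ are closed; the structure equation is $\nabla\phi=0$, and then $\nabla\xi=0$ ($\nabla$ the Levi-Civita connection). The $\phi$-sectional curvature is $H(E)=g(R(E,\phi E)\phi E,E)$ for unit $E\perp\xi$; a cosymplectic space form $M(c)$ is a cosymplectic manifold with constant $\phi$-sectional curvature $c$. A Riemannian submersion $F:(M,g_M)\to(N,g_N)$ is a smooth surjective map of maximal rank such that $F_*$ preserves the lengths of horizontal vectors. Vertical means tangent to the fibres (in $\ker F_*$), horizontal means in $(\ker F_* )^\perp$; $\mathcal V,\mathcal H$ are the corresponding orthogonal projections. O'Neill's tensor is $\mathcal T(E,G)=\mathcal T_EG=\mathcal H\nabla_{\mathcal VE}\mathcal VG+\mathcal V\nabla_{\mathcal VE}\mathcal HG$. For vertical $U$ write $\phi U=\psi U+\omega U$ with $\psi U$ vertical and $\omega U$ horizontal. $F$ is slant if for every nonzero vertical vector $X$ (not a multiple of $\xi$) the angle between $\phi X$ and $\ker F_*$ is a constant $\theta$ (the slant angle) independent of the point and of $X$. It is invariant if $\theta=0$,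 anti-invariant if $\theta=\pi/2$, and proper if it is neither. Here the fibres are $3$-dimensional, $H=\frac13\sum_{j=1}^3\mathcal T_{U_j}U_j$ for a local orthonormal frame $U_1,U_2,U_3$ of $\ker F_*$, and $\hat\tau=\sum_{i<j}\hat K(U_i\wedge U_j)$, where $\hat K$ is the sectional curvature of the fibre with the induced metric. A slant orthonormal basis at $p$ is an orthonormal basis of the form displayed in the claim.
   Formalization: In the equality case, ''suitable'' slant orthonormal basis is taken to require that e_4 be parallel to H (no condition if H = 0); without this the ''if'' half is false, since the three conditions leave T^5_22 free. *)

(* Defs.v *)
(* MathComp-Analysis world.

   Smooth manifolds and tensor calculus in classical index notation.  A tensor
   field is a family of smooth component functions, one for each chart of the
   atlas, related by the usual transformation law.  Tangent vectors are row
   vectors, so linear maps act on the right: the differential of f maps v to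
   v *m 'J f x, and a (1,1)-tensor P maps v to v *m P. *)
From HB Require Import structures.
From mathcomp Require Import all_boot all_order all_algebra.
From mathcomp Require Import all_classical all_reals all_analysis.

Set Implicit Arguments.
Unset Strict Implicit.
Unset Printing Implicit Defensive.

Import Order.TTheory GRing.Theory Num.Theory.
Import numFieldNormedType.Exports.

Local Open Scope classical_set_scope.
Local Open Scope ring_scope.

(** * Smooth maps and manifolds *)

Definition partial (R : realType) (n : nat) (V : normedModType R) (i : 'I_n)
    (f : 'rV[R]_n -> V) : 'rV[R]_n -> V :=
  fun x => 'D_(delta_mx 0 i) f x.

(* C^oo on the open set U: all iterated partial derivatives are Frechet
   differentiable (hence continuous) at the points of U. *)
Definition smooth_on (R : realType) (n : nat) (V : normedModType R)
    (U : set 'rV[R]_n) (f : 'rV[R]_n -> V) : Prop :=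
  forall (s : seq 'I_n) (x : 'rV[R]_n), U x ->
    differentiable (foldr (fun i h => partial i h) f s) x.

(* bwd is relevant only on the image of dom under fwd. *)
Record chart (R : realType) (n : nat) (T : topologicalType) := Chart {
  dom : set T;
  fwd : T -> 'rV[R]_n;
  bwd : 'rV[R]_n -> T }.

Definition is_chart (R : realType) (n : nat) (T : topologicalType)
    (a : chart R n T) : Prop :=
  [/\ open (dom a), open (fwd a @` dom a),
      forall p, dom a p -> bwd a (fwd a p) = p,
      forall p, dom a p -> {for p, continuous (fwd a)} &
      forall p, dom a p -> {for fwd a p, continuous (bwd a)}].

Definition transition (R : realType) (n : nat) (T : topologicalType)
    (a b : chart R n T) : 'rV[R]_n -> 'rV[R]_n := fwd b \o bwd a.

Record manifold (R : realType) (n : nat) := Manifold {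
  carrier :> topologicalType;
  atlas : set (chart R n carrier);
  _ : hausdorff_space carrier;
  _ : @second_countable carrier;
  _ : forall a, atlas a -> is_chart a;
  _ : forall p, exists2 a, atlas a & dom a p;
  _ : forall a b, atlas a -> atlas b ->
        smooth_on (fwd a @` (dom a `&` dom b)) (transition a b) }.

Definition chart_at (R : realType) (n : nat) (M : manifold R n) (p : M)
    (a : chart R n M) : Prop := atlas a /\ dom a p.

(* Components, chart by chart, of a tensor field; only the values on
   fwd a @` dom a for charts a of the atlas are relevant. *)
Definition components (R : realType) (n : nat) (M : manifold R n) (k l : nat) :=
  chart R n M -> 'rV[R]_n -> 'M[R]_(k, l).

Definition smooth_components (R : realType) (n : nat) (M : manifold R n)
    (k l : nat) (t : components M k l) : Prop :=
  forall a, atlas a -> smooth_on (fwd a @` dom a) (t a).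

(* law D t t' relates the components t, t' of one tensor in two charts at a
   point, D being the Jacobian there of the transition from the first to the
   second. *)
Definition transforms (R : realType) (n : nat) (M : manifold R n) (k l : nat)
    (law : 'M[R]_n -> 'M[R]_(k, l) -> 'M[R]_(k, l) -> Prop)
    (t : components M k l) : Prop :=
  forall p a b, chart_at p a -> chart_at p b ->
    law ('J (transition a b) (fwd a p)) (t a (fwd a p)) (t b (fwd b p)).

(** * Riemannian geometry in a coordinate domain *)

Definition ip (R : realType) (n : nat) (G : 'M[R]_n) (u v : 'rV[R]_n) : R :=
  (u *m G *m v^T) 0 0.

Definition norm_of (R : realType) (n : nat) (G : 'M[R]_n) (u : 'rV[R]_n) : R :=
  Num.sqrt (ip G u u).

Definition orthonormal_family (R : realType) (n k : nat) (G : 'M[R]_n)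
    (u : 'I_k -> 'rV[R]_n) : Prop :=
  forall i j, ip G (u i) (u j) = (i == j)%:R.

Record metric (R : realType) (n : nat) (M : manifold R n) := Metric {
  metric_comp :> chart R n M -> 'rV[R]_n -> 'M[R]_n;
  _ : smooth_components metric_comp;
  _ : transforms (fun D G G' => G = D *m G' *m D^T) metric_comp;
  _ : forall p a, chart_at p a -> (metric_comp a (fwd a p))^T = metric_comp a (fwd a p);
  _ : forall p a, chart_at p a -> forall v, v != 0 -> 0 < ip (metric_comp a (fwd a p)) v v }.

Definition lie_bracket (R : realType) (n : nat)
    (X Y : 'rV[R]_n -> 'rV[R]_n) : 'rV[R]_n -> 'rV[R]_n :=
  fun x => 'D_(X x) Y x - 'D_(Y x) X x.

(* The vector Gamma(u, v) with g(Gamma(u, v), e_k) =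
   (u g(v, e_k) + v g(u, e_k) - e_k g(u, v)) / 2, where u, v and the basis
   vectors e_k are extended as constant fields. *)
Definition christoffel (R : realType) (n : nat) (G : 'rV[R]_n -> 'M[R]_n)
    (x u v : 'rV[R]_n) : 'rV[R]_n :=
  (\row_k (2^-1 * ('D_u (fun y => ip (G y) v (delta_mx 0 k)) x
                 + 'D_v (fun y => ip (G y) u (delta_mx 0 k)) x
                 - 'D_(delta_mx 0 k) (fun y => ip (G y) u v) x)))
  *m invmx (G x).

(* Levi-Civita covariant derivative of Y along X. *)
Definition nabla (R : realType) (n : nat) (G : 'rV[R]_n -> 'M[R]_n)
    (X Y : 'rV[R]_n -> 'rV[R]_n) : 'rV[R]_n -> 'rV[R]_n :=
  fun x => 'D_(X x) Y x + christoffel G x (X x) (Y x).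

Definition curvature (R : realType) (n : nat) (G : 'rV[R]_n -> 'M[R]_n)
    (X Y Z : 'rV[R]_n -> 'rV[R]_n) : 'rV[R]_n -> 'rV[R]_n :=
  fun x => nabla G X (nabla G Y Z) x - nabla G Y (nabla G X Z) x
           - nabla G (lie_bracket X Y) Z x.

(* Curvature is tensorial: its value on tangent vectors is computed on their
   constant extensions. *)
Definition curvature_at (R : realType) (n : nat) (G : 'rV[R]_n -> 'M[R]_n)
    (x u v w : 'rV[R]_n) : 'rV[R]_n :=
  curvature G (cst u) (cst v) (cst w) x.

Definition sectional (R : realType) (n : nat) (G : 'rV[R]_n -> 'M[R]_n)
    (x u v : 'rV[R]_n) : R :=
  ip (G x) (curvature_at G x u v v) u
  / (ip (G x) u u * ip (G x) v v - ip (G x) u v ^+ 2).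

Definition scalar_curvature (R : realType) (n : nat) (G : 'rV[R]_n -> 'M[R]_n)
    (x : 'rV[R]_n) (u : 'I_n -> 'rV[R]_n) : R :=
  \sum_(i < n) \sum_(j < n | (i < j)%N) sectional G x (u i) (u j).

(** * Almost contact metric structures *)

(* phi is the (1,1)-tensor X |-> X *m phi, xi a vector field and eta the 1-form
   X |-> X *m eta, a column of components. *)
Record acm_structure (R : realType) (n : nat) (M : manifold R n) := ACM {
  acm_metric : metric M;
  acm_phi : components M n n;
  acm_xi : components M 1 n;
  acm_eta : components M n 1;
  _ : smooth_components acm_phi;
  _ : smooth_components acm_xi;
  _ : smooth_components acm_eta;
  _ : transforms (fun D P P' => P *m D = D *m P') acm_phi;
  _ : transforms (fun D Z Z' => Z *m D = Z') acm_xi;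
  _ : transforms (fun D H H' => H = D *m H') acm_eta;
  _ : forall p a, chart_at p a ->
      let x := fwd a p in
      let g := acm_metric a x in
      let phi := acm_phi a x in
      let xi := acm_xi a x in
      let eta := acm_eta a x in
      [/\ phi *m phi = - 1%:M + eta *m xi, xi *m phi = 0, phi *m eta = 0,
          xi *m eta = 1%:M &
          forall X Y : 'rV[R]_n,
            ip g (X *m phi) (Y *m phi) = ip g X Y - (X *m eta) 0 0 * (Y *m eta) 0 0
            /\ (X *m eta) 0 0 = ip g X xi] }.

Definition nijenhuis (R : realType) (n : nat) (P : 'rV[R]_n -> 'M[R]_n)
    (X Y : 'rV[R]_n -> 'rV[R]_n) : 'rV[R]_n -> 'rV[R]_n :=
  let ap (Z : 'rV[R]_n -> 'rV[R]_n) : 'rV[R]_n -> 'rV[R]_n :=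
    fun y => Z y *m P y in
  fun x => ap (ap (lie_bracket X Y)) x + lie_bracket (ap X) (ap Y) x
           - ap (lie_bracket (ap X) Y) x - ap (lie_bracket X (ap Y)) x.

(* (d eta)(u, v) on constant fields, in the convention without the factor 1/2. *)
Definition d1form (R : realType) (n : nat) (h : 'rV[R]_n -> 'M[R]_(n, 1))
    (x u v : 'rV[R]_n) : R :=
  'D_u (fun y => (v *m h y) 0 0) x - 'D_v (fun y => (u *m h y) 0 0) x.

Definition d2form (R : realType) (n : nat)
    (Phi : 'rV[R]_n -> 'rV[R]_n -> 'rV[R]_n -> R) (x u v w : 'rV[R]_n) : R :=
  'D_u (fun y => Phi y v w) x + 'D_v (fun y => Phi y w u) x
  + 'D_w (fun y => Phi y u v) x.

Definition fundamental_form (R : realType) (n : nat) (M : manifold R n)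
    (S : acm_structure M) (a : chart R n M) (y u v : 'rV[R]_n) : R :=
  ip (acm_metric S a y) u (v *m acm_phi S a y).

(* Normality is [phi, phi] + 2 d eta (x) xi = 0 with the factor 1/2 in d eta,
   i.e. [phi, phi] + d eta (x) xi = 0 with d1form.  All three conditions are
   tensorial, hence tested on constant fields. *)
Definition normal_acm (R : realType) (n : nat) (M : manifold R n)
    (S : acm_structure M) : Prop :=
  forall p a, chart_at p a -> forall u v : 'rV[R]_n,
    nijenhuis (acm_phi S a) (cst u) (cst v) (fwd a p)
    + d1form (acm_eta S a) (fwd a p) u v *: acm_xi S a (fwd a p) = 0.

Definition cosymplectic (R : realType) (n : nat) (M : manifold R n)
    (S : acm_structure M) : Prop :=
  [/\ normal_acm S,
      forall p a, chart_at p a ->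
        forall u v, d1form (acm_eta S a) (fwd a p) u v = 0 &
      forall p a, chart_at p a ->
        forall u v w, d2form (fundamental_form S a) (fwd a p) u v w = 0].

Definition cosymplectic_space_form (R : realType) (n : nat) (M : manifold R n)
    (S : acm_structure M) (c : R) : Prop :=
  cosymplectic S /\
  forall p a, chart_at p a ->
    let x := fwd a p in
    let g := acm_metric S a in
    forall E : 'rV[R]_n, ip (g x) E E = 1 -> ip (g x) E (acm_xi S a x) = 0 ->
      let phiE := E *m acm_phi S a x in
      ip (g x) (curvature_at g x E phiE phiE) E = c.

(** * Riemannian submersions *)

Definition local_rep (R : realType) (m n : nat) (M : manifold R m)
    (N : manifold R n) (F : M -> N) (a : chart R m M) (b : chart R n N) :
    'rV[R]_m -> 'rV[R]_n := fwd b \o F \o bwd a.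

Definition smooth_map (R : realType) (m n : nat) (M : manifold R m)
    (N : manifold R n) (F : M -> N) : Prop :=
  continuous F /\
  forall a b, atlas a -> atlas b ->
    smooth_on (fwd a @` (dom a `&` F @^-1` dom b)) (local_rep F a b).

Definition dF (R : realType) (m n : nat) (M : manifold R m) (N : manifold R n)
    (F : M -> N) (a : chart R m M) (b : chart R n N) (x : 'rV[R]_m) :
    'M[R]_(m, n) := 'J (local_rep F a b) x.

(* Row spaces: the kernel of v |-> v *m J, and its G-orthogonal complement. *)
Definition vert_space (R : realType) (m n : nat) (J : 'M[R]_(m, n)) : 'M[R]_m :=
  kermx J.
Definition hor_space (R : realType) (m n : nat) (G : 'M[R]_m)
    (J : 'M[R]_(m, n)) : 'M[R]_m := kermx (G *m (vert_space J)^T).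

Definition vert_proj (R : realType) (m n : nat) (G : 'M[R]_m)
    (J : 'M[R]_(m, n)) : 'M[R]_m := proj_mx (vert_space J) (hor_space G J).
Definition hor_proj (R : realType) (m n : nat) (G : 'M[R]_m)
    (J : 'M[R]_(m, n)) : 'M[R]_m := proj_mx (hor_space G J) (vert_space J).

Definition riemannian_submersion (R : realType) (m n : nat) (M : manifold R m)
    (N : manifold R n) (g : metric M) (gN : metric N) (F : M -> N) : Prop :=
  [/\ smooth_map F, (forall q, exists p, F p = q) &
      forall p a b, chart_at p a -> chart_at (F p) b ->
        let J := dF F a b (fwd a p) in
        let G := g a (fwd a p) in
        let GN := gN b (fwd b (F p)) in
        \rank J = n /\
        forall v : 'rV[R]_m, (v <= hor_space G J)%MS ->
          norm_of GN (v *m J) = norm_of G v].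

(* O'Neill's tensor T_E E' = H nabla_{VE} VE' + V nabla_{VE} HE', for
   fields and then, by tensoriality, for vectors. *)
Definition oneillT (R : realType) (m n : nat) (G : 'rV[R]_m -> 'M[R]_m)
    (J : 'rV[R]_m -> 'M[R]_(m, n)) (E E' : 'rV[R]_m -> 'rV[R]_m) :
    'rV[R]_m -> 'rV[R]_m :=
  let V (Z : 'rV[R]_m -> 'rV[R]_m) : 'rV[R]_m -> 'rV[R]_m :=
    fun y => Z y *m vert_proj (G y) (J y) in
  let H (Z : 'rV[R]_m -> 'rV[R]_m) : 'rV[R]_m -> 'rV[R]_m :=
    fun y => Z y *m hor_proj (G y) (J y) in
  fun x => H (nabla G (V E) (V E')) x + V (nabla G (V E) (H E')) x.

Definition oneillT_at (R : realType) (m n : nat) (G : 'rV[R]_m -> 'M[R]_m)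
    (J : 'rV[R]_m -> 'M[R]_(m, n)) (x u v : 'rV[R]_m) : 'rV[R]_m :=
  oneillT G J (cst u) (cst v) x.

Definition mean_curvature (R : realType) (m n k : nat)
    (G : 'rV[R]_m -> 'M[R]_m) (J : 'rV[R]_m -> 'M[R]_(m, n)) (x : 'rV[R]_m)
    (U : 'I_k -> 'rV[R]_m) : 'rV[R]_m :=
  k%:R^-1 *: \sum_(j < k) oneillT_at G J x (U j) (U j).

(* w |-> s w on a neighbourhood of w0 is the inverse of a local coordinate
   system of the fibre of F through p: an immersion of dimension
   k = dim M - dim N with values in the fibre, s w0 = p. *)
Definition fibre_parametrization (R : realType) (m n k : nat)
    (M : manifold R m) (N : manifold R n) (F : M -> N) (p : M)
    (s : 'rV[R]_k -> M) (w0 : 'rV[R]_k) : Prop :=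
  (k + n)%N = m /\
  exists W : set 'rV[R]_k,
    [/\ open W /\ W w0, s w0 = p,
        (forall w, W w -> F (s w) = F p),
        (forall w, W w -> {for w, continuous s}) &
        forall a, atlas a ->
          smooth_on (W `&` s @^-1` dom a) (fwd a \o s) /\
          forall w, W w -> dom a (s w) -> row_free ('J (fwd a \o s) w)].

Definition induced_metric (R : realType) (m k : nat) (M : manifold R m)
    (g : metric M) (a : chart R m M) (s : 'rV[R]_k -> M) (w : 'rV[R]_k) :
    'M[R]_k :=
  let D := 'J (fwd a \o s) w in D *m g a (fwd a (s w)) *m D^T.

(** * Slant submersions *)

(* Angle between the vector w and the vertical space. *)
Definition angle_vert (R : realType) (m n : nat) (G : 'M[R]_m)
    (J : 'M[R]_(m, n)) (w : 'rV[R]_m) : R :=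
  acos (norm_of G (w *m vert_proj G J) / norm_of G w).

Definition slant (R : realType) (m n : nat) (M : manifold R m)
    (N : manifold R n) (S : acm_structure M) (F : M -> N) (theta : R) : Prop :=
  forall p a b, chart_at p a -> chart_at (F p) b ->
    let x := fwd a p in
    forall X : 'rV[R]_m,
      X != 0 -> (X <= vert_space (dF F a b x))%MS ->
      ~ (exists k : R, X = k *: acm_xi S a x) ->
      angle_vert (acm_metric S a x) (dF F a b x) (X *m acm_phi S a x) = theta.

Definition proper_slant (R : realType) (m n : nat) (M : manifold R m)
    (N : manifold R n) (S : acm_structure M) (F : M -> N) (theta : R) : Prop :=
  [/\ slant S F theta, theta <> 0 & theta <> pi / 2].

Definition xi_vertical (R : realType) (m n : nat) (M : manifold R m)
    (N : manifold R n) (S : acm_structure M) (F : M -> N) : Prop :=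
  forall p a b, chart_at p a -> chart_at (F p) b ->
    (acm_xi S a (fwd a p) <= vert_space (dF F a b (fwd a p)))%MS.

Definition psi (R : realType) (m n : nat) (M : manifold R m)
    (N : manifold R n) (S : acm_structure M) (F : M -> N)
    (a : chart R m M) (b : chart R n N) (x U : 'rV[R]_m) : 'rV[R]_m :=
  U *m acm_phi S a x *m vert_proj (acm_metric S a x) (dF F a b x).

Definition omega (R : realType) (m n : nat) (M : manifold R m)
    (N : manifold R n) (S : acm_structure M) (F : M -> N)
    (a : chart R m M) (b : chart R n N) (x U : 'rV[R]_m) : 'rV[R]_m :=
  U *m acm_phi S a x *m hor_proj (acm_metric S a x) (dF F a b x).

Definition slant_basis (R : realType) (M : manifold R 5) (N : manifold R 2)
    (S : acm_structure M) (F : M -> N) (theta : R)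
    (a : chart R 5 M) (b : chart R 2 N) (x e1 e2 e3 e4 e5 : 'rV[R]_5) : Prop :=
  [/\ orthonormal_family (acm_metric S a x) (tnth [tuple e1; e2; e3; e4; e5]),
      (e1 <= vert_space (dF F a b x))%MS,
      e2 = (cos theta)^-1 *: psi S F a b x e1,
      e3 = acm_xi S a x &
      e4 = (sin theta)^-1 *: omega S F a b x e1 /\
      e5 = (sin theta)^-1 *: omega S F a b x e2].

(* A slant basis is suitable for the equality case when e4 lies along the mean
   curvature vector H (no condition if H = 0); such a basis exists at every
   point.  For an arbitrary slant basis the conditions T^4_11 = 3 T^4_22 and
   T^4_12 = T^5_11 = 0 leave T^5_22 free and do not imply equality: on flat
   C^2 x R take F = (y, (z - m r) / sqrt (1 + m^2)), m > 0, where z + i y is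
   one complex coordinate, r > 0 the modulus of the other one and cos theta =
   1 / sqrt (1 + m^2).  With e1 tangent to the rulings of the cones
   z - m r = const, all T^alpha_ij vanish except T^5_22 = sin theta / r. *)
Definition suitable_slant_basis (R : realType) (M : manifold R 5)
    (N : manifold R 2) (S : acm_structure M) (F : M -> N) (theta : R)
    (a : chart R 5 M) (b : chart R 2 N) (x H e1 e2 e3 e4 e5 : 'rV[R]_5) : Prop :=
  slant_basis S F theta a b x e1 e2 e3 e4 e5 /\ exists k : R, H = k *: e4.

(* Main.v *)
(* Normality together with the closedness of eta and Phi makes phi and xi
   parallel, so the curvature commutes with phi, kills xi, and polarizing the
   phi-sectional curvature gives K(X, Y) = c / 4 (1 + 3 g(X, phi Y)^2) for
   orthonormal X, Y orthogonal to xi.  For a slant basis (e_i) this is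
   c / 4 (1 + 3 cos^2 theta) on e_1, e_2, and T(., xi) = 0, so the Gauss equation
   reads tau = c / 4 (1 + 3 cos^2 theta) + g(T_11, T_22) - |T_12|^2.
   Differentiating |psi V|^2 = cos^2 theta (|V|^2 - eta(V)^2) yields
   g(T(U, e_2), e_4) = g(T(U, e_1), e_5), hence T^4_12 = T^5_11 and
   T^4_22 = T^5_12.  With c_0 = c / 4 (1 + 3 cos^2 theta),
   9 |H|^2 - 8 (tau - c_0) = (T^4_11 - 3 T^4_22)^2 + (T^5_22 - 3 T^4_12)^2,
   and T^5_22 = - T^4_12 when e_4 is along H. *)
Require Import Defs.
From HB Require Import structures.
From mathcomp Require Import all_boot all_order all_algebra.
From mathcomp Require Import all_classical all_reals all_analysis.
From mathcomp Require Import ring lra.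
Import Order.TTheory GRing.Theory Num.Theory.
Import numFieldNormedType.Exports.
Local Open Scope classical_set_scope.
Local Open Scope ring_scope.

Set Implicit Arguments.
Unset Strict Implicit.
Unset Printing Implicit Defensive.

(** * Calculus of matrix-valued functions *)

(** All the analysis takes place in one pair of charts, on the open set where [F] can be read in
    both. There the connection is a matrix acting on row vectors, so that the covariant constancy of
    phi, xi and the metric becomes a linear differential equation for a matrix; the curvature
    symmetry that each of them entails is one instance of [integrability]. On vertical vectors
    O'Neill's tensor is the horizontal vector with a prescribed image under dF, which removes every
    derivative of the projections. The frames defining H and tau are arbitrary, and the second one
    lives in the parameter space of the fibre. Both quantities are traces, hence can be moved to a
    slant basis. Origin of 8/9: with x = T^4_11 and y = T^4_22, the form (x + y)^2 - l (x y - y^2)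
    has discriminant l^2 - 8 l, so l = 8 is the positive value that makes it a square; T^5_22 and
    T^4_12 give the same form. Equality alone yields T^5_22 = 3 T^4_12. Rotating e_1 in the plane of
    e_1, e_2 rotates e_4, e_5 by the same angle, so e_4 can be turned towards H. *)

Fact dd_key : unit. Proof. by []. Qed.

(* The directional derivative ['D_v f x], sealed: comparing two directional
   derivatives up to conversion would unfold the limits. *)
Definition dd (R : realType) (V W : normedModType R) (v : V) (f : V -> W) (x : V) : W :=
  locked_with dd_key (fun v f x => 'D_v f x) v f x.

Lemma differentiable_near (R : realType) (V W : normedModType R) (f g : V -> W) x :
  (\near x, f x = g x) -> differentiable f x -> differentiable g x.
Proof.
move=> fg df.
have fg0 : \forall h \near 0, f (h + x) = g (h + x).
  have := fg; rewrite {1}(near_shift 0 x).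
  by apply: filterS => h /=; rewrite subr0.
have e0 : (g - f) \o shift x = cst ((g - f) x) + \0 +o_ 0 id.
  apply/eqaddoP => e e_gt0; apply: filterS fg0 => h fgh.
  rewrite (_ : (_ - _) h = 0) ?normr0 ?mulr_ge0 ?(ltW e_gt0) //.
  by rewrite !fctE /= fgh (nbhs_singleton fg) !subrr addr0 subr0.
have de : differentiable (g - f) x.
  have z0 : continuous (\0 : V -> W) by exact: cst_continuous.
  have d0 : 'd (g - f) x = \0 :> (V -> W) by exact: diff_unique z0 e0.
  by apply/diff_locallyP; rewrite d0.
rewrite (_ : g = f + (g - f)); first exact: differentiableD.
by rewrite addrC subrK.
Qed.

Lemma differentiable_mxP (R : realType) (V : normedModType R) k l
    (f : V -> 'M[R]_(k, l)) x :
  differentiable f x <-> forall i j, differentiable (fun y => f y i j) x.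
Proof.
split=> [df i j|df].
  exact: (@differentiable_comp _ _ _ _ f (fun N : 'M[R]_(k, l) => N i j) x df (differentiable_coord _ _ _)).
rewrite (_ : f = \sum_(i < k) (\sum_(j < l) (fun y => f y i j *: delta_mx i j))); last first.
  apply/funext => y; rewrite fct_sumE [LHS]matrix_sum_delta.
  by apply: eq_bigr => i _; rewrite fct_sumE.
apply: differentiable_sum => i; apply: differentiable_sum => j.
by apply: differentiableZl.
Qed.

Section SealedDerivative.
Variables (R : realType) (V W : normedModType R).
Implicit Types (f g : V -> W) (x v : V).

Lemma ddE f x v : 'D_v f x = dd v f x.
Proof. by rewrite /dd unlock. Qed.

Lemma eq_near_dd f g x v : (\near x, f x = g x) -> dd v f x = dd v g x.
Proof. by rewrite -!ddE; exact: near_eq_derive. Qed.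

Lemma dd_cst (c : W) x v : dd v (fun=> c) x = 0.
Proof. by rewrite -ddE; exact: derive_cst. Qed.

Lemma ddD f g x v : derivable f x v -> derivable g x v ->
  dd v (fun y => f y + g y) x = dd v f x + dd v g x.
Proof. by rewrite -!ddE; exact: deriveD. Qed.

Lemma ddB f g x v : derivable f x v -> derivable g x v ->
  dd v (fun y => f y - g y) x = dd v f x - dd v g x.
Proof. by rewrite -!ddE; exact: deriveB. Qed.

Lemma ddN f x v : derivable f x v -> dd v (fun y => - f y) x = - dd v f x.
Proof. by rewrite -!ddE; exact: deriveN. Qed.

Lemma ddZ f (k : R) x v : derivable f x v ->
  dd v (fun y => k *: f y) x = k *: dd v f x.
Proof. by rewrite -!ddE; exact: deriveZ. Qed.

Lemma dd0 f x : dd 0 f x = 0.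
Proof. by rewrite -ddE derive0. Qed.

Lemma dd_dir_linear f x a u v :
  differentiable f x -> dd (a *: u + v) f x = a *: dd u f x + dd v f x.
Proof. by move=> df; rewrite -!ddE !deriveE // linearP. Qed.

End SealedDerivative.

Lemma dd_id (R : realType) (V : normedModType R) (x v : V) : dd v (fun y : V => y) x = v.
Proof. by rewrite -ddE; exact: derive_id. Qed.

Lemma dd_entry (R : realType) (V : normedModType R) k l
    (f : V -> 'M[R]_(k, l)) x v i j :
  derivable f x v -> (dd v f x) i j = dd v (fun y => f y i j) x.
Proof. by move=> df; rewrite -!ddE derive_mx // mxE. Qed.

Lemma differentiable_mulmx (R : realType) (V : normedModType R) k l m
    (f : V -> 'M[R]_(k, l)) (g : V -> 'M[R]_(l, m)) x :
  differentiable f x -> differentiable g x ->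
  differentiable (fun y => f y *m g y) x.
Proof.
move=> /differentiable_mxP df /differentiable_mxP dg.
apply/differentiable_mxP => i j.
rewrite (_ : (fun y => _) = \sum_(h < l) (fun y => f y i h * g y h j)).
  by apply: differentiable_sum => h; apply: differentiableM.
by apply/funext => y; rewrite fct_sumE mxE.
Qed.

Lemma dd_sumM (R : realType) (V : normedModType R) l
  (f g : 'I_l -> V -> R) x v : 
  (forall i, derivable (f i) x v) -> (forall i, derivable (g i) x v) ->
  dd v (fun y => \sum_i f i y * g i y) x
  = \sum_i (dd v (f i) x * g i x + f i x * dd v (g i) x).
Proof.
move=> df dg; rewrite -ddE.
rewrite (_ : (fun y => _) = \sum_(i < l) (f i * g i)); last first.
  by apply/funext => y; rewrite fct_sumE.
rewrite derive_sum => [|i]; last exact: derivableM.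
by apply: eq_bigr => i _; rewrite deriveM // -!ddE addrC mulrC [X in X + _]mulrC.
Qed.

Lemma derivable_mulmx (R : realType) (V : normedModType R) k l m
    (f : V -> 'M[R]_(k, l)) (g : V -> 'M[R]_(l, m)) x v :
  derivable f x v -> derivable g x v -> derivable (fun y => f y *m g y) x v.
Proof.
move=> /derivable_mxP df /derivable_mxP dg; apply/derivable_mxP => i j.
rewrite (_ : (fun y => _) = \sum_(h < l) ((fun y => f y i h) * (fun y => g y h j))).
  by apply: derivable_sum => h; apply: derivableM.
by apply/funext => y; rewrite fct_sumE mxE.
Qed.

Lemma dd_mulmx (R : realType) (V : normedModType R) k l m
    (f : V -> 'M[R]_(k, l)) (g : V -> 'M[R]_(l, m)) x v :
  derivable f x v -> derivable g x v ->
  dd v (fun y => f y *m g y) x = dd v f x *m g x + f x *m dd v g x.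
Proof.
move=> df dg; apply/matrixP => i j.
rewrite dd_entry; last exact: derivable_mulmx.
rewrite (_ : (fun y => _) = (fun y => \sum_h f y i h * g y h j)); last first.
  by apply/funext => y; rewrite mxE.
rewrite dd_sumM; last 2 first.
- by move=> h; move/derivable_mxP: df; apply.
- by move=> h; move/derivable_mxP: dg; apply.
rewrite !mxE -big_split; apply: eq_bigr => h _ /=.
by rewrite !dd_entry.
Qed.

Lemma derivable_mulmxl (R : realType) (V : normedModType R) k l m
    (A : 'M[R]_(k, l)) (g : V -> 'M[R]_(l, m)) x v :
  derivable g x v -> derivable (fun y => A *m g y) x v.
Proof. by move=> dg; apply: (@derivable_mulmx _ _ _ _ _ (fun=> A)) => //; exact: derivable_cst. Qed.

Lemma dd_mulmxl (R : realType) (V : normedModType R) k l m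
    (A : 'M[R]_(k, l)) (g : V -> 'M[R]_(l, m)) x v :
  derivable g x v -> dd v (fun y => A *m g y) x = A *m dd v g x.
Proof.
move=> dg; rewrite (@dd_mulmx _ _ _ _ _ (fun=> A)) ?dd_cst ?mul0mx ?add0r //.
Qed.

Lemma derivable_trmx (R : realType) (V : normedModType R) k l
    (f : V -> 'M[R]_(k, l)) x v :
  derivable f x v -> derivable (fun y => (f y)^T) x v.
Proof.
move=> /derivable_mxP df; apply/derivable_mxP => i j.
by under eq_fun do rewrite mxE; exact: df.
Qed.

Lemma dd_trmx (R : realType) (V : normedModType R) k l
    (f : V -> 'M[R]_(k, l)) x v :
  derivable f x v -> dd v (fun y => (f y)^T) x = (dd v f x)^T.
Proof.
move=> df; apply/matrixP => i j.
rewrite mxE !dd_entry //; last exact: derivable_trmx.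
by under eq_fun do rewrite mxE.
Qed.

Lemma differentiable_trmx (R : realType) (V : normedModType R) k l
    (f : V -> 'M[R]_(k, l)) x :
  differentiable f x -> differentiable (fun y => (f y)^T) x.
Proof.
move=> /differentiable_mxP df; apply/differentiable_mxP => i j.
by under eq_fun do rewrite mxE.
Qed.

Lemma differentiable_prod (R : realType) (V : normedModType R) (I : Type)
    (r : seq I) (P : pred I) (f : I -> V -> R) x :
  (forall i, differentiable (f i) x) ->
  differentiable (fun y => \prod_(i <- r | P i) f i y) x.
Proof.
move=> df; elim: r => [|i r IH].
  under eq_fun do rewrite big_nil; exact: differentiable_cst.
under eq_fun do rewrite big_cons.
by case: (P i) => //; apply: differentiableM.
Qed.

Lemma differentiable_bigsum (R : realType) (V W : normedModType R) (I : Type)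
    (r : seq I) (P : pred I) (f : I -> V -> W) x :
  (forall i, differentiable (f i) x) ->
  differentiable (fun y => \sum_(i <- r | P i) f i y) x.
Proof.
move=> df; elim: r => [|i r IH].
  under eq_fun do rewrite big_nil; exact: differentiable_cst.
under eq_fun do rewrite big_cons.
by case: (P i) => //; apply: differentiableD.
Qed.

Lemma differentiable_det (R : realType) (V : normedModType R) k
    (f : V -> 'M[R]_k) x :
  differentiable f x -> differentiable (fun y => \det (f y)) x.
Proof.
move=> /differentiable_mxP df.
apply: differentiable_bigsum => s.
apply: differentiableM; first exact: differentiable_cst.
by apply: differentiable_prod => i.
Qed.

Lemma differentiable_invmx (R : realType) (V : normedModType R) k
    (f : V -> 'M[R]_k) x :
  differentiable f x -> f x \in unitmx -> differentiable (fun y => invmx (f y)) x.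
Proof.
move=> df ux.
have dd := differentiable_det df.
have d0 : \det (f x) != 0 by rewrite -unitfE.
(* [invmx] returns its argument on singular matrices, so the adjugate formula is available only
   where the determinant is nonzero, which is a neighbourhood of [x]. *)
apply: (@differentiable_near _ _ _ (fun y => (\det (f y))^-1 *: \adj (f y))).
  have : \forall y \near x, \det (f y) != 0.
    have := differentiable_continuous dd.
    move=> /(_ [set z | z != 0]); apply.
    by apply: open_nbhs_nbhs; split; [exact: open_neq|].
  apply: filterS => y dy; rewrite /invmx; case: ifP => //.
  by rewrite unitmxE unitfE dy.
apply/differentiable_mxP => i j.
under eq_fun do rewrite !mxE.
apply: differentiableM.
  by apply: differentiableV.
apply: differentiableM; first exact: differentiable_cst.
apply: differentiable_det.
move/differentiable_mxP : df => df.
apply/differentiable_mxP => i' j'.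
by under eq_fun do rewrite !mxE.
Qed.

(** Differentiability of finite order, along arbitrary vectors instead of coordinate directions. The
    explicit order allows closure under products and composition by induction, and order 1 is enough
    wherever an inverse matrix occurs ([Gam], the projections), since these are differentiated only
    once. *)
Fixpoint ndiff (R : realType) (X V : normedModType R) (k : nat) (U : set X)
    (f : X -> V) : Prop :=
  if k is k'.+1 then
    (forall x, U x -> differentiable f x) /\ forall v, ndiff k' U (dd v f)
  else True.

Section NDiff.
Variables (R : realType) (X : normedModType R).
Implicit Types (V W : normedModType R) (U : set X).

Lemma open_near V U (f g : X -> V) x :
  open U -> (forall y, U y -> f y = g y) -> U x -> \forall y \near x, f y = g y.
Proof.
move=> oU fg Ux; apply: filterS fg _.
by apply: open_nbhs_nbhs.
Qed.

Lemma eq_open_dd V U (f g : X -> V) x v :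
  open U -> (forall y, U y -> f y = g y) -> U x -> dd v f x = dd v g x.
Proof. by move=> oU fg Ux; apply: eq_near_dd; apply: open_near Ux. Qed.

Lemma eq_open_differentiable V U (f g : X -> V) x :
  open U -> (forall y, U y -> f y = g y) -> U x ->
  differentiable f x -> differentiable g x.
Proof. by move=> oU fg Ux; apply: differentiable_near; apply: open_near Ux. Qed.

Lemma ndiff_differentiable V k U (f : X -> V) x :
  ndiff k.+1 U f -> U x -> differentiable f x.
Proof. by move=> [+ _] Ux; apply. Qed.

Lemma ndiff_derivable V k U (f : X -> V) x v :
  ndiff k.+1 U f -> U x -> derivable f x v.
Proof. by move=> fU Ux; apply/diff_derivable/ndiff_differentiable/Ux/fU. Qed.

Lemma ndiff_dd V k U (f : X -> V) v : ndiff k.+1 U f -> ndiff k U (dd v f).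
Proof. by case=> _; apply. Qed.

Lemma ndiffS V k U (f : X -> V) : ndiff k.+1 U f -> ndiff k U f.
Proof.
elim: k f => // k IH f [df Df]; split=> // v.
exact: IH.
Qed.

Lemma eq_ndiff V k U (f g : X -> V) :
  open U -> (forall y, U y -> f y = g y) -> ndiff k U f -> ndiff k U g.
Proof.
move=> oU; elim: k f g => // k IH f g fg [df Df]; split.
  by move=> x Ux; apply: (eq_open_differentiable oU fg) => //; apply: df.
by move=> v; apply: IH (Df v) => y Uy; apply: eq_open_dd fg Uy.
Qed.

Lemma sub_ndiff V k U U' (f : X -> V) :
  (U' `<=` U) -> ndiff k U f -> ndiff k U' f.
Proof.
move=> UU'; elim: k f => // k IH f [df Df]; split=> [x /UU'|v]; first exact: df.
exact: IH (Df v).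
Qed.

Lemma ndiff_cst V k U (c : V) : ndiff k U (fun=> c).
Proof.
elim: k c => // k IH c; split=> [x _|v]; first exact: differentiable_cst.
rewrite (_ : dd v _ = fun=> 0) //.
by apply/funext => x; rewrite dd_cst.
Qed.

Lemma ndiffD V k U (f g : X -> V) :
  open U -> ndiff k U f -> ndiff k U g -> ndiff k U (fun y => f y + g y).
Proof.
move=> oU; elim: k f g => // k IH f g fU gU; split=> [x Ux|v].
  by apply: differentiableD; [apply: (ndiff_differentiable fU)|apply: (ndiff_differentiable gU)].
apply: (@eq_ndiff _ _ _ (fun y => dd v f y + dd v g y)) => // [y Uy|].
  by rewrite -ddD //; [apply: (ndiff_derivable fU)|apply: (ndiff_derivable gU)].
by apply: IH; apply: ndiff_dd.
Qed.

Lemma ndiffN V k U (f : X -> V) : open U -> ndiff k U f -> ndiff k U (fun y => - f y).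
Proof.
move=> oU; elim: k f => // k IH f fU; split=> [x Ux|v].
  by apply: differentiableN; apply: (ndiff_differentiable fU).
apply: (@eq_ndiff _ _ _ (fun y => - dd v f y)) => // [y Uy|].
  by rewrite -ddN //; apply: (ndiff_derivable fU).
by apply: IH; exact: ndiff_dd.
Qed.

Lemma ndiff_sum V k U n (f : 'I_n -> X -> V) :
  open U -> (forall i, ndiff k U (f i)) -> ndiff k U (fun y => \sum_i f i y).
Proof.
move=> oU fU; elim: (index_enum _) => [|i r IH].
  by under eq_fun do rewrite big_nil; apply: ndiff_cst.
by under eq_fun do rewrite big_cons; apply: ndiffD.
Qed.

Lemma ndiff_mulmx k U l m n (f : X -> 'M[R]_(l, m)) (g : X -> 'M[R]_(m, n)) :
  open U -> ndiff k U f -> ndiff k U g -> ndiff k U (fun y => f y *m g y).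
Proof.
move=> oU; elim: k f g => // k IH f g fU gU; split=> [x Ux|v].
  by apply: differentiable_mulmx; [apply: (ndiff_differentiable fU)|apply: (ndiff_differentiable gU)].
apply: (@eq_ndiff _ _ _ (fun y => dd v f y *m g y + f y *m dd v g y)) => // [y Uy|].
  by rewrite -dd_mulmx //; [apply: (ndiff_derivable fU)|apply: (ndiff_derivable gU)].
by apply: ndiffD => //; apply: IH; (exact: ndiff_dd || exact: ndiffS).
Qed.

Lemma ndiff_trmx k U l m (f : X -> 'M[R]_(l, m)) :
  open U -> ndiff k U f -> ndiff k U (fun y => (f y)^T).
Proof.
move=> oU; elim: k f => // k IH f fU; split=> [x Ux|v].
  by apply: differentiable_trmx; apply: (ndiff_differentiable fU).
apply: (@eq_ndiff _ _ _ (fun y => (dd v f y)^T)) => // [y Uy|].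
  by rewrite -dd_trmx //; apply: (ndiff_derivable fU).
by apply: IH; exact: ndiff_dd.
Qed.

Lemma ndiff_entry k U l m (f : X -> 'M[R]_(l, m)) i j :
  open U -> ndiff k U f -> ndiff k U (fun y => f y i j).
Proof.
move=> oU; elim: k f => // k IH f fU; split=> [x Ux|v].
  by move/differentiable_mxP : (ndiff_differentiable fU Ux); apply.
apply: (@eq_ndiff _ _ _ (fun y => (dd v f y) i j)) => // [y Uy|].
  by rewrite -dd_entry //; apply: (ndiff_derivable fU).
by apply: IH; exact: ndiff_dd.
Qed.

Lemma ndiff_mx k U l m (f : X -> 'M[R]_(l, m)) :
  open U -> (forall i j, ndiff k U (fun y => f y i j)) -> ndiff k U f.
Proof.
move=> oU; elim: k f => // k IH f fU.
have df x : U x -> differentiable f x.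
  by move=> Ux; apply/differentiable_mxP => i j; apply: (ndiff_differentiable (fU i j)).
split=> // v; apply: IH => i j.
apply: eq_ndiff (ndiff_dd v (fU i j)) => // y Uy.
by rewrite -dd_entry //; apply/diff_derivable/df.
Qed.

Lemma ddM (f g : X -> R) x v : derivable f x v -> derivable g x v ->
  dd v (fun y => f y * g y) x = f x * dd v g x + g x * dd v f x.
Proof. by rewrite -!ddE; exact: deriveM. Qed.

Lemma ndiffM k U (f g : X -> R) :
  open U -> ndiff k U f -> ndiff k U g -> ndiff k U (fun y => f y * g y).
Proof.
move=> oU; elim: k f g => // k IH f g fU gU; split=> [x Ux|v].
  by apply: differentiableM; [apply: (ndiff_differentiable fU)|apply: (ndiff_differentiable gU)].
apply: (@eq_ndiff _ _ _ (fun y => f y * dd v g y + g y * dd v f y)) => // [y Uy|].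
  by rewrite -ddM //; [apply: (ndiff_derivable fU)|apply: (ndiff_derivable gU)].
by apply: ndiffD => //; apply: IH; (exact: ndiff_dd || exact: ndiffS).
Qed.

Lemma ndiffZ k U l m (c : X -> R) (f : X -> 'M[R]_(l, m)) :
  open U -> ndiff k U c -> ndiff k U f -> ndiff k U (fun y => c y *: f y).
Proof.
move=> oU cU fU; apply: ndiff_mx => // i j.
under eq_fun do rewrite mxE.
by apply: ndiffM => //; apply: ndiff_entry.
Qed.

End NDiff.

Lemma dd_sum_dir (R : realType) n (V : normedModType R) (f : 'rV[R]_n -> V) x v :
  differentiable f x -> dd v f x = \sum_i v 0 i *: dd (delta_mx 0 i) f x.
Proof.
move=> df; rewrite -ddE deriveE // [in LHS](row_sum_delta v) linear_sum.
by apply: eq_bigr => i _; rewrite linearZ -ddE deriveE.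
Qed.

Lemma smooth_partial (R : realType) n (V : normedModType R) (U : set 'rV[R]_n)
    (f : 'rV[R]_n -> V) i :
  smooth_on U f -> smooth_on U (partial i f).
Proof. by move=> fU s x Ux; have := fU (rcons s i) x Ux; rewrite foldr_rcons. Qed.

Lemma smooth_ndiff (R : realType) n l m (U : set 'rV[R]_n)
    (f : 'rV[R]_n -> 'M[R]_(l, m)) k :
  open U -> smooth_on U f -> ndiff k U f.
Proof.
move=> oU; elim: k f => // k IH f fU.
have df x : U x -> differentiable f x by exact: (fU [::]).
split=> // v; apply: (@eq_ndiff _ _ _ _ _ (fun y => \sum_i v 0 i *: partial i f y)) => //.
  move=> y Uy; rewrite dd_sum_dir; last exact: df.
  by apply: eq_bigr => i _; rewrite /partial ddE.
apply: ndiff_sum => // i; apply: ndiffZ => //; first exact: ndiff_cst.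
exact/IH/smooth_partial.
Qed.

Lemma dd_comp (R : realType) (X Y V : normedModType R) (f : Y -> V)
    (g : X -> Y) x v :
  differentiable g x -> differentiable f (g x) ->
  dd v (f \o g) x = dd (dd v g x) f (g x).
Proof.
move=> dg df; rewrite -!ddE.
rewrite deriveE; last exact: differentiable_comp.
by rewrite diff_comp //= !deriveE.
Qed.

Lemma ndiff_comp (R : realType) (X : normedModType R) n l m k (U : set X)
    (U' : set 'rV[R]_n) (f : 'rV[R]_n -> 'M[R]_(l, m)) (g : X -> 'rV[R]_n) :
  open U -> (forall x, U x -> U' (g x)) -> ndiff k U' f -> ndiff k U g ->
  ndiff k U (f \o g).
Proof.
move=> oU gU'; elim: k f g gU' => // k IH f g gU' fU gU.
have df x : U x -> differentiable f (g x).
  by move=> Ux; apply: (ndiff_differentiable fU); apply: gU'.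
have dg x : U x -> differentiable g x by move=> Ux; apply: (ndiff_differentiable gU).
split=> [x Ux|v]; first by apply: differentiable_comp; [exact: dg|exact: df].
(* By the chain rule the derivative is a combination of the composites of partial derivatives of [f]
   with the same [g], to which the induction hypothesis applies. *)
apply: (@eq_ndiff _ _ _ _ _ (fun y => \sum_i (dd v g y) 0 i *: (dd (delta_mx 0 i) f \o g) y)) => //.
  by move=> y Uy; rewrite (dd_comp v (dg y Uy) (df y Uy)) (dd_sum_dir _ (df y Uy)).
apply: ndiff_sum => // i; apply: ndiffZ => //.
  by apply: ndiff_entry => //; exact: ndiff_dd.
by apply: IH => //; [exact: ndiff_dd|exact: ndiffS].
Qed.

Lemma jacobian_row (R : realType) n m (f : 'rV[R]_n -> 'rV[R]_m) x i :
  differentiable f x -> row i ('J f x) = dd (delta_mx 0 i) f x.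
Proof. by move=> df; rewrite -ddE rowE deriveEjacobian. Qed.

Lemma ndiff_jacobian (R : realType) n m k (U : set 'rV[R]_n)
    (f : 'rV[R]_n -> 'rV[R]_m) :
  open U -> ndiff k.+1 U f -> ndiff k U (fun x => 'J f x).
Proof.
move=> oU fU; apply: ndiff_mx => // i j.
apply: (@eq_ndiff _ _ _ _ _ (fun y => (dd (delta_mx 0 i) f y) 0 j)) => //.
  by move=> y Uy; rewrite -jacobian_row ?mxE //; apply: (ndiff_differentiable fU).
by apply: ndiff_entry => //; exact: ndiff_dd.
Qed.

(** * Symmetry of second derivatives *)

Section Schwarz.
Variables (R : realType) (X : normedModType R).

Lemma is_derive_line (f : X -> R) (p v : X) (t : R) :
  differentiable f (p + t *: v) ->
  is_derive t 1 (fun s : R => f (p + s *: v)) ('D_v f (p + t *: v)).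
Proof.
move=> df.
have e : (fun h : R => h^-1 *: (((fun s : R => f (p + s *: v)) \o shift t) (h *: 1) - f (p + t *: v)))
   = (fun h : R => h^-1 *: ((f \o shift (p + t *: v)) (h *: v) - f (p + t *: v))).
  apply/funext => h /=; congr (_ *: (f _ - _)).
  by rewrite [h *: 1]mulr1 scalerDl addrCA.
have dv : derivable f (p + t *: v) v by exact: diff_derivable.
by split; rewrite /derivable /derive e.
Qed.

Lemma mvt_line (f : X -> R) (p v : X) (h : R) :
  0 < h -> (forall t, 0 <= t <= h -> differentiable f (p + t *: v)) ->
  exists2 t, 0 <= t <= h & f (p + h *: v) - f p = h * dd v f (p + t *: v).
Proof.
move=> h0 df.
have dl t : 0 <= t <= h ->
    is_derive t 1 (fun s : R => f (p + s *: v)) ('D_v f (p + t *: v)).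
  by move=> th; apply/is_derive_line/df.
have [| |t] := @MVT R (fun s => f (p + s *: v)) (fun s => 'D_v f (p + s *: v)) _ _ h0.
- by move=> t; rewrite in_itv /= => /andP[t0 th]; apply: dl; rewrite !ltW.
- apply: derivable_within_continuous => t; rewrite in_itv /= => th.
  by have [] := dl _ th.
rewrite in_itv /= scale0r addr0 subr0 => /andP[t0 th] ->.
by exists t; rewrite ?ltW // -ddE mulrC.
Qed.

(** The second difference is the increment along [u] of [g y = f (h *: v + y) - f y]; the mean value
    theorem is applied to [g] along [u], then to [dd u f] along [v]. *)
Lemma mvt_square (f : X -> R) (x u v : X) (h : R) (U : set X) :
  0 < h -> ndiff 2 U f ->
  (forall s t, 0 <= s <= h -> 0 <= t <= h -> U (x + s *: u + t *: v)) ->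
  exists s t, [/\ 0 <= s <= h, 0 <= t <= h &
    f (x + h *: u + h *: v) - f (x + h *: u) - (f (x + h *: v) - f x)
    = h * (h * dd v (dd u f) (x + s *: u + t *: v))].
Proof.
move=> h0 fU xU.
have hh : 0 <= h <= h by rewrite lexx ltW.
have h00 : 0 <= (0 : R) <= h by rewrite lexx ltW.
have d1 s : 0 <= s <= h -> differentiable f (x + s *: u).
  move=> sh; apply: (ndiff_differentiable fU).
  by have := xU s 0 sh h00; rewrite scale0r addr0.
have d2 s : 0 <= s <= h -> differentiable f (x + h *: v + s *: u).
  move=> sh; apply: (ndiff_differentiable fU).
  by rewrite addrAC; apply: xU.
pose g y := f (h *: v + y) - f y.
have dsh (F : X -> R) y : differentiable F (h *: v + y) ->
  differentiable (fun z => F (h *: v + z)) y.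
  by move=> dF; apply: (@differentiable_comp _ _ _ _ (fun z => h *: v + z) F) => //.
have [s sh es] : exists2 s, 0 <= s <= h &
    g (x + h *: u) - g x = h * dd u g (x + s *: u).
  apply: mvt_line => // s sh; apply: differentiableB; last exact: d1.
  by apply: dsh; rewrite addrA (addrC _ x); apply: d2.
have Dg : dd u g (x + s *: u) = dd u f (x + s *: u + h *: v) - dd u f (x + s *: u).
  rewrite ddB; last 2 first.
  - by apply/diff_derivable/dsh; rewrite addrA (addrC _ x); apply: d2.
  - exact/diff_derivable/d1.
  congr (_ - _).
  rewrite (@dd_comp _ _ _ _ f (fun z => h *: v + z)) //; last first.
    by rewrite addrA (addrC _ x); apply: d2.
  by rewrite ddD // dd_cst dd_id add0r addrC.
have [t th et] := @mvt_line (dd u f) (x + s *: u) v h h0 (fun t th =>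
   ndiff_differentiable (ndiff_dd u fU) (xU s t sh th)).
exists s, t; split=> //.
by rewrite -et -Dg -es /g !(addrC (h *: v)).
Qed.

(** One second difference over a small square is a value of both mixed derivatives, taken at two
    points of the square. Order 3 makes the mixed derivatives continuous, so if they differed at [x]
    both values would be within half the gap of their values at [x]. *)
Lemma schwarz (f : X -> R) (U : set X) (x u v : X) :
  open U -> ndiff 3 U f -> U x -> dd u (dd v f) x = dd v (dd u f) x.
Proof.
move=> oU fU Ux.
pose A := dd u (dd v f); pose B := dd v (dd u f).
rewrite -[LHS]/(A x) -[RHS]/(B x).
have cont w z : {for x, continuous (dd w (dd z f))}.
  apply: differentiable_continuous.
  exact: (ndiff_differentiable (ndiff_dd w (ndiff_dd z fU)) Ux).
apply/eqP; rewrite -subr_eq0 -normr_eq0; apply/negPn/negP => AB0.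
have e0 : 0 < `|A x - B x| / 2 by rewrite divr_gt0 // lt_def normr_ge0 AB0.
have nA : \forall y \near x, `|A x - A y| < `|A x - B x| / 2.
  exact: (@cvgr_dist_lt _ _ _ _ _ _ _ (cont u v) _ e0).
have nB : \forall y \near x, `|B x - B y| < `|A x - B x| / 2.
  exact: (@cvgr_dist_lt _ _ _ _ _ _ _ (cont v u) _ e0).
have nU : \forall y \near x, U y by apply: open_nbhs_nbhs.
have /nbhs_ballP[r /= r0 rP] : \forall y \near x,
    [/\ `|A x - A y| < `|A x - B x| / 2, `|B x - B y| < `|A x - B x| / 2 & U y].
  by apply: filterS3 nA nB nU => y.
(* With this side the square stays within distance r / 2 of [x]; the summand 1 keeps the denominator
   positive when [u] and [v] vanish. *)
pose h := r / (2 * (`|u| + `|v| + 1)).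
have d0 : 0 < `|u| + `|v| + 1 by rewrite ltr_wpDl // addr_ge0.
have h0 : 0 < h by rewrite divr_gt0 // mulr_gt0.
have hr s t : 0 <= s <= h -> 0 <= t <= h -> ball x r (x + s *: u + t *: v).
  move=> /andP[s0 sh] /andP[t0 th].
  rewrite -ball_normE /= opprD addrA opprD addrA subrr sub0r -opprD normrN.
  apply: (le_lt_trans (ler_normD _ _)); rewrite !normrZ !ger0_norm //.
  apply: (@le_lt_trans _ _ (h * (`|u| + `|v| + 1))).
    rewrite !mulrDr mulr1 -[leLHS]addr0.
    by rewrite !lerD // ?ler_wpM2r // ltW.
  rewrite /h invfM mulrA -mulrA mulVf ?gt_eqF // mulr1.
  by rewrite ltr_pdivrMr // ltr_pMr // ltr1n.
have hU s t : 0 <= s <= h -> 0 <= t <= h -> U (x + s *: u + t *: v).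
  by move=> sh th; have [] := rP _ (hr s t sh th).
have f2 := ndiffS fU.
have [s [t [sh th e1]]] := mvt_square h0 f2 hU.
have hU' a b : 0 <= a <= h -> 0 <= b <= h -> U (x + a *: v + b *: u).
  by move=> ah bh; rewrite addrAC; apply: hU.
have [s' [t' [sh' th' e2]]] := mvt_square h0 f2 hU'.
have e3 : A (x + t' *: u + s' *: v) = B (x + s *: u + t *: v).
  have hn0 : h != 0 by rewrite gt_eqF.
  have e4 : h * (h * A (x + s' *: v + t' *: u)) = h * (h * B (x + s *: u + t *: v)).
    rewrite -[LHS]e2 -[RHS]e1 (addrAC x (h *: v)).
    by rewrite !opprB addrACA [RHS]addrACA [- _ - _]addrC.
  by rewrite addrAC; apply: (mulfI hn0); apply: (mulfI hn0).
have [b1 _ _] := rP _ (hr _ _ th' sh'); have [_ b2 _] := rP _ (hr _ _ sh th).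
move: b1 b2; rewrite e3.
move: (A x) (B x) (B _) => p q r' b1 b2.
have := ler_distD r' p q.
rewrite [X in _ <= _ + X]distrC => /le_lt_trans /(_ (ltrD b1 b2)).
by rewrite -splitr ltxx.
Qed.

Lemma schwarz_mx k l (f : X -> 'M[R]_(k, l)) (U : set X) (x u v : X) :
  open U -> ndiff 3 U f -> U x -> dd u (dd v f) x = dd v (dd u f) x.
Proof.
move=> oU fU Ux; apply/matrixP => i j.
have E w z : (dd w (dd z f)) x i j = dd w (dd z (fun y => f y i j)) x.
  rewrite dd_entry; last exact: (ndiff_derivable (ndiff_dd z fU)).
  apply: eq_open_dd oU _ Ux => y Uy.
  by rewrite dd_entry //; exact: (ndiff_derivable fU).
have fij : ndiff 3 U (fun y => f y i j) by exact: ndiff_entry.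
have H := schwarz u v oU fij Ux.
by rewrite [LHS]E H; apply/esym; exact: E.
Qed.

End Schwarz.

(** * Levi-Civita connection and curvature *)

Lemma mxDE (R : nmodType) m n (A B : 'M[R]_(m, n)) i j : (A + B) i j = A i j + B i j.
Proof. by rewrite mxE. Qed.

Lemma mxNE (R : zmodType) m n (A : 'M[R]_(m, n)) i j : (- A) i j = - A i j.
Proof. by rewrite mxE. Qed.

Lemma mxZE (R : pzRingType) m n a (A : 'M[R]_(m, n)) i j : (a *: A) i j = a * A i j.
Proof. by rewrite mxE. Qed.

Lemma ipE (R : realType) n (G : 'M[R]_n) u v : ip G u v = (u *m G *m v^T) 0 0.
Proof. by []. Qed.

Lemma mx0E (R : nmodType) m n i j : (0 : 'M[R]_(m, n)) i j = 0.
Proof. by rewrite mxE. Qed.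

Lemma trmxD (R : nmodType) m n (A B : 'M[R]_(m, n)) : (A + B)^T = A^T + B^T.
Proof. by apply/matrixP => i j; rewrite !mxE. Qed.

Lemma trmxN (R : zmodType) m n (A : 'M[R]_(m, n)) : (- A)^T = - A^T.
Proof. by apply/matrixP => i j; rewrite !mxE. Qed.

Section InnerProduct.
Variables (R : realType) (n : nat).
Implicit Types (G : 'M[R]_n) (u v w : 'rV[R]_n).

Lemma ipDl G u v w : ip G (u + v) w = ip G u w + ip G v w.
Proof. by rewrite /ip !mulmxDl mxE. Qed.

Lemma ipDr G u v w : ip G w (u + v) = ip G w u + ip G w v.
Proof. by rewrite /ip linearD mulmxDr mxE. Qed.

Lemma ipZl G a u v : ip G (a *: u) v = a * ip G u v.
Proof. by rewrite /ip -!scalemxAl mxE. Qed.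

Lemma ipZr G a u v : ip G u (a *: v) = a * ip G u v.
Proof. by rewrite /ip linearZ -scalemxAr mxE. Qed.

Lemma ipNl G u v : ip G (- u) v = - ip G u v.
Proof. by rewrite -scaleN1r ipZl mulN1r. Qed.

Lemma ipNr G u v : ip G u (- v) = - ip G u v.
Proof. by rewrite -scaleN1r ipZr mulN1r. Qed.

Lemma ip0l G v : ip G 0 v = 0.
Proof. by rewrite -[0](scale0r 0) ipZl mul0r. Qed.

Lemma ip0r G v : ip G v 0 = 0.
Proof. by rewrite -[0 in LHS](scale0r 0) ipZr mul0r. Qed.

Lemma ip_suml G (I : finType) (F : I -> 'rV[R]_n) v :
  ip G (\sum_i F i) v = \sum_i ip G (F i) v.
Proof. by elim/big_rec2: _ => [|i y1 y2 _ <-]; rewrite ?ip0l ?ipDl. Qed.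

Lemma ip_sumr G (I : finType) (F : I -> 'rV[R]_n) v :
  ip G v (\sum_i F i) = \sum_i ip G v (F i).
Proof. by elim/big_rec2: _ => [|i y1 y2 _ <-]; rewrite ?ip0r ?ipDr. Qed.

Lemma ip_linear_mx a G G' u v : ip (a *: G + G') u v = a * ip G u v + ip G' u v.
Proof. by rewrite /ip mulmxDr mulmxDl -scalemxAr -scalemxAl mxDE mxZE. Qed.

Lemma ip_sum_mx (I : finType) (c : I -> R) (G : I -> 'M[R]_n) u v :
  ip (\sum_i c i *: G i) u v = \sum_i c i * ip (G i) u v.
Proof.
elim/big_rec2: _ => [|i y1 y2 _ <-]; first by rewrite /ip mulmx0 mul0mx mxE.
exact: ip_linear_mx.
Qed.

Lemma ip_tr G u v : ip G u v = ip G^T v u.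
Proof. by rewrite /ip -[LHS]trace_mx11 -mxtrace_tr trace_mx11 !trmx_mul trmxK mulmxA. Qed.

Lemma ipC G u v : G^T = G -> ip G u v = ip G v u.
Proof. by move=> Gs; rewrite ip_tr Gs. Qed.

Definition posdef G := forall v, v != 0 -> 0 < ip G v v.

Lemma ip_eq0 G u : posdef G -> (ip G u u == 0) = (u == 0).
Proof.
move=> Gp; apply/idP/eqP => [|->]; last by rewrite ip0l.
by apply: contraTeq => /Gp; rewrite lt_def => /andP[].
Qed.

Lemma ip_ge0 G u : posdef G -> 0 <= ip G u u.
Proof. by move=> Gp; have [->|/Gp/ltW//] := eqVneq u 0; rewrite ip0l. Qed.

Lemma ip_inj G u v : posdef G -> (forall w, ip G u w = ip G v w) -> u = v.
Proof.
move=> Gp uv; apply/eqP; rewrite -subr_eq0 -(ip_eq0 _ Gp).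
by rewrite ipDl ipNl uv subrr.
Qed.

Lemma posdef_unit G : posdef G -> G \in unitmx.
Proof.
move=> Gp; rewrite -row_free_unit -kermx_eq0; apply/eqP/row_matrixP => i.
rewrite row0; apply/eqP; rewrite -(ip_eq0 _ Gp) /ip.
by have /sub_kermxP -> := row_sub i (kermx G); rewrite mul0mx mxE.
Qed.

End InnerProduct.

Lemma dd_ip (R : realType) (X : normedModType R) n (G : X -> 'M[R]_n)
    (V W : X -> 'rV[R]_n) x u :
  derivable G x u -> derivable V x u -> derivable W x u ->
  dd u (fun y => ip (G y) (V y) (W y)) x =
    ip (dd u G x) (V x) (W x) + ip (G x) (dd u V x) (W x) + ip (G x) (V x) (dd u W x).
Proof.
move=> dG dV dW.
have dVG := derivable_mulmx dV dG; have dWt := derivable_trmx dW.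
rewrite /ip -dd_entry; last exact: derivable_mulmx.
rewrite (dd_mulmx dVG dWt) (dd_mulmx dV dG) dd_trmx //.
by rewrite mulmxDl !mxDE; lra.
Qed.

Lemma dd_ip_cst (R : realType) (X : normedModType R) n (G : X -> 'M[R]_n) x u v w :
  derivable G x u -> dd u (fun y => ip (G y) v w) x = ip (dd u G x) v w.
Proof.
move=> dG; rewrite (@dd_ip _ _ _ G (cst v) (cst w)) //; do ?exact: derivable_cst.
by rewrite !dd_cst ip0l ip0r !addr0.
Qed.

Lemma koszul_row (R : realType) n (A B D : 'M[R]_n) (C : 'I_n -> 'M[R]_n) (u v w : 'rV[R]_n) :
  D = \sum_k w 0 k *: C k ->
  2 * ((\row_k (2^-1 * (ip A v (delta_mx 0 k) + ip B u (delta_mx 0 k) - ip (C k) u v)))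
        *m w^T) 0 0 = ip A v w + ip B u w - ip D u v.
Proof.
have ew H z : ip H z w = \sum_k w 0 k * ip H z (delta_mx 0 k).
  by rewrite {1}(row_sum_delta w) ip_sumr; apply: eq_bigr => k _; rewrite ipZr.
move=> ->; rewrite mxE mulr_sumr (ew A) (ew B) ip_sum_mx -sumrN -!big_split /=.
by apply: eq_bigr => k _; rewrite !mxE; lra.
Qed.

(** The connection form evaluated on [u]: [v *m Gam G u y] is the Christoffel vector of [u] and [v],
    so a covariant derivative is [dd] plus right multiplication by this matrix. It is sealed like
    [dd]. *)
Definition Gam (R : realType) n (G : 'rV[R]_n -> 'M[R]_n) (u y : 'rV[R]_n) : 'M[R]_n :=
  locked_with dd_key (fun u y => \matrix_i christoffel G y u (delta_mx 0 i)) u y.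

(** Curvature of the connection form; the products stand in reverse order because matrices act on
    the right. [w *m Rm G u v x] is R(u, v) w. *)
Definition Rm (R : realType) n (G : 'rV[R]_n -> 'M[R]_n) (u v x : 'rV[R]_n) : 'M[R]_n :=
  dd u (Gam G v) x - dd v (Gam G u) x + Gam G v x *m Gam G u x - Gam G u x *m Gam G v x.

(** Order 3 is what commuting the second derivatives of [G] requires. *)
Record regular_metric (R : realType) n (O : set 'rV[R]_n) (G : 'rV[R]_n -> 'M[R]_n) := {
  regular_open : open O;
  regular_diff : ndiff 3 O G;
  regular_sym : forall x, O x -> (G x)^T = G x;
  regular_pos : forall x, O x -> posdef (G x) }.

Section LeviCivita.
Variables (R : realType) (n : nat) (O : set 'rV[R]_n) (G : 'rV[R]_n -> 'M[R]_n).
Hypothesis hG : regular_metric O G.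
Implicit Types (u v w x y : 'rV[R]_n).

Let oO := regular_open hG.

Let dG x : O x -> differentiable G x.
Proof. exact: ndiff_differentiable (regular_diff hG). Qed.

Let dGv x v : O x -> derivable G x v.
Proof. by move=> Ox; apply/diff_derivable/dG. Qed.

Lemma metric_sym x u v : O x -> ip (G x) u v = ip (G x) v u.
Proof. by move=> Ox; apply: ipC; apply: regular_sym Ox. Qed.

Lemma dmetric_sym x u v w : O x -> ip (dd w G x) u v = ip (dd w G x) v u.
Proof.
move=> Ox; apply: ipC; rewrite -dd_trmx; last exact: dGv.
by apply: (eq_open_dd w oO _ Ox); exact: regular_sym.
Qed.

Lemma christoffelE x u v : O x ->
  christoffel G x u v =
  (\row_k (2^-1 * (ip (dd u G x) v (delta_mx 0 k) + ip (dd v G x) u (delta_mx 0 k)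
                  - ip (dd (delta_mx 0 k) G x) u v))) *m invmx (G x).
Proof.
move=> Ox; congr (_ *m _); apply/rowP => k; rewrite [LHS]mxE [RHS]mxE.
by rewrite !ddE; congr (_ * (_ + _ - _)); apply: dd_ip_cst; exact: dGv.
Qed.

Lemma koszul x u v w : O x ->
  2 * ip (G x) (christoffel G x u v) w =
  ip (dd u G x) v w + ip (dd v G x) u w - ip (dd w G x) u v.
Proof.
move=> Ox; rewrite christoffelE // [ip (G x) _ _]ipE mulmxKV; last first.
  exact/posdef_unit/(regular_pos hG).
exact: koszul_row (dd_sum_dir w (dG Ox)).
Qed.

(** Nondegeneracy of the metric: symmetry and linearity of the Christoffel vector can then be read
    off the right-hand side of the Koszul formula, without handling [invmx]. *)
Lemma christoffel_unique x u v z : O x ->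
  (forall w, 2 * ip (G x) z w =
    ip (dd u G x) v w + ip (dd v G x) u w - ip (dd w G x) u v) ->
  z = christoffel G x u v.
Proof.
move=> Ox zP; apply: (ip_inj (regular_pos hG Ox)) => w.
have two0 : (2 : R) != 0 by rewrite pnatr_eq0.
by apply: (mulfI two0); apply: etrans (zP w) (esym (koszul u v w Ox)).
Qed.

Lemma christoffelC x u v : O x -> christoffel G x u v = christoffel G x v u.
Proof.
move=> Ox; apply: christoffel_unique => // w; rewrite koszul //.
by congr (_ - _); [rewrite addrC|apply: dmetric_sym].
Qed.

Lemma christoffel_linear x u a v w : O x ->
  christoffel G x u (a *: v + w) = a *: christoffel G x u v + christoffel G x u w.
Proof.
move=> Ox; apply/esym; apply: christoffel_unique => // z.
have := koszul u v z Ox; have := koszul u w z Ox.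
rewrite (dd_dir_linear a v w (dG Ox)).
move: (christoffel G x u v) (christoffel G x u w) => c c'.
move: (dd u G x) (dd v G x) (dd w G x) (dd z G x) => A B C D.
rewrite ip_linear_mx !ipDl !ipZl !ipDr !ipZr mulrDr mulrCA => -> ->.
ring.
Qed.

Lemma mul_Gam x u v : O x -> v *m Gam G u x = christoffel G x u v.
Proof.
move=> Ox; rewrite mulmx_sum_row [v in RHS]row_sum_delta.
have c0 : christoffel G x u 0 = 0.
  by have := christoffel_linear u (-1) 0 0 Ox; rewrite scaler0 addr0 scaleN1r addNr.
elim/big_rec2: _ => [|i y1 y2 _ ->]; first by rewrite c0.
by rewrite christoffel_linear // /Gam unlock rowK.
Qed.

Lemma GamC x u v : O x -> v *m Gam G u x = u *m Gam G v x.
Proof. by move=> Ox; rewrite (mul_Gam u v Ox) (mul_Gam v u Ox); exact: christoffelC. Qed.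

Lemma Gam_linear x a u v : O x -> Gam G (a *: u + v) x = a *: Gam G u x + Gam G v x.
Proof.
move=> Ox; apply/row_matrixP => i; rewrite !rowE mulmxDr -scalemxAr.
have C w := GamC w (delta_mx 0 i) Ox.
by rewrite (C (a *: u + v)) (C u) (C v) mulmxDl scalemxAl.
Qed.

Lemma ndiff_Gam u : ndiff 1 O (Gam G u).
Proof.
have dGw w : ndiff 1 O (dd w G) by apply/ndiff_dd/ndiffS/(regular_diff hG).
pose ipf (H : 'rV[R]_n -> 'M[R]_n) v w y := ip (H y) v w.
have ipd H v w : ndiff 1 O H -> ndiff 1 O (ipf H v w).
  move=> dH; have cd k l (A : 'M[R]_(k, l)) : ndiff 1 O (fun=> A) by exact: ndiff_cst.
  exact: (ndiff_entry 0 0 oO (ndiff_mulmx oO (ndiff_mulmx oO (cd _ _ v) dH) (cd _ _ w^T))).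
apply: ndiff_mx => // i j.
pose e k : 'rV[R]_n := delta_mx 0 k.
pose rw y : 'rV[R]_n := \row_k (2^-1 * (ipf (dd u G) (e i) (e k) y
   + ipf (dd (e i) G) u (e k) y - ipf (dd (e k) G) u (e i) y)).
apply: (@eq_ndiff _ _ _ _ _ (fun y => (rw y *m invmx (G y)) 0 j)) => // [y Oy|].
  by rewrite /Gam unlock [in RHS]mxE christoffelE.
have drw : ndiff 1 O rw.
  apply: ndiff_mx => // i0 k.
  rewrite (_ : (fun y => _) = fun y => 2^-1 * (ipf (dd u G) (e i) (e k) y
     + ipf (dd (e i) G) u (e k) y + (- 1) * ipf (dd (e k) G) u (e i) y)); last first.
    by apply/funext => y; rewrite mxE mulN1r.
  have cd (c : R) : ndiff 1 O (fun=> c) by exact: ndiff_cst.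
  apply: (ndiffM oO (cd _)); apply: (ndiffD oO); last exact: (ndiffM oO (cd _) (ipd _ _ _ _)).
  by apply: (ndiffD oO); exact: ipd.
have dinv : ndiff 1 O (fun y => invmx (G y)).
  split=> // y Oy; apply: differentiable_invmx; first exact: dG.
  exact/posdef_unit/(regular_pos hG).
exact: (ndiff_entry 0 j oO (ndiff_mulmx oO drw dinv)).
Qed.

Lemma derivable_Gam u v x : O x -> derivable (Gam G u) x v.
Proof. by move=> Ox; apply/diff_derivable/(ndiff_differentiable (ndiff_Gam u)). Qed.

(** This is nabla g = 0: in the sum of the Koszul formulas for (u, v, w) and (u, w, v) the
    derivatives along v and w cancel. *)
Lemma metric_compat x u : O x -> dd u G x = Gam G u x *m G x + G x *m (Gam G u x)^T.
Proof.
move=> Ox; apply/matrixP => i j.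
have E (A : 'M[R]_n) : A i j = ip A (delta_mx 0 i) (delta_mx 0 j).
  by rewrite ipE -rowE -(mulmx1 (row i A)) trmx_delta -mulmxA mul1mx -colE !mxE.
set v := delta_mx 0 i in E *; set w := delta_mx 0 j in E *.
rewrite mxDE !E.
have -> : ip (Gam G u x *m G x) v w = ip (G x) (christoffel G x u v) w.
  by rewrite -mul_Gam // ipE !mulmxA.
have -> : ip (G x *m (Gam G u x)^T) v w = ip (G x) (christoffel G x u w) v.
  by rewrite metric_sym // -mul_Gam // !ipE trmx_mul !mulmxA.
have := koszul u v w Ox; have := koszul u w v Ox.
have := dmetric_sym w v u Ox.
move: (christoffel G x u v) (christoffel G x u w) => c c'.
by move: (dd u G x) (dd v G x) (dd w G x) => A B C; lra.
Qed.

Lemma nablaE (X Y : 'rV[R]_n -> 'rV[R]_n) x : O x ->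
  nabla G X Y x = dd (X x) Y x + Y x *m Gam G (X x) x.
Proof. by move=> Ox; rewrite /nabla mul_Gam // ddE. Qed.

Lemma curvatureE x u v w : O x -> curvature_at G x u v w = w *m Rm G u v x.
Proof.
move=> Ox; rewrite /curvature_at /curvature.
have br : lie_bracket (cst u) (cst v) x = 0 by rewrite /lie_bracket !derive_cst subrr.
rewrite !nablaE // br dd0.
have -> : Gam G 0 x = 0.
  by have := Gam_linear (-1) 0 0 Ox; rewrite scaler0 addr0 scaleN1r addNr.
rewrite mulmx0 addr0 subr0.
have D a b : dd a (nabla G (cst b) (cst w)) x = w *m dd a (Gam G b) x.
  rewrite (@eq_open_dd _ _ _ _ _ (fun y => cst w y *m Gam G b y) _ _ oO _ Ox); last first.
    by move=> y Oy; rewrite nablaE // dd_cst add0r.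
  rewrite (dd_mulmx (derivable_cst _ _ _) (@derivable_Gam _ _ _ Ox)).
  by rewrite dd_cst mul0mx add0r.
rewrite !D !dd_cst !add0r /Rm !(mulmxDr, mulmxN) !mulmxA opprD !addrA.
by apply/matrixP => i j; rewrite !(mxDE, mxNE); lra.
Qed.

Lemma RmC x u v : Rm G u v x = - Rm G v u x.
Proof. by apply/matrixP => i j; rewrite /Rm !(mxDE, mxNE); lra. Qed.

Lemma Rm_linear x a u u' v : O x ->
  Rm G (a *: u + u') v x = a *: Rm G u v x + Rm G u' v x.
Proof.
move=> Ox; rewrite /Rm Gam_linear // dd_dir_linear; last first.
  exact: ndiff_differentiable (ndiff_Gam v) Ox.
have -> : dd v (Gam G (a *: u + u')) x = a *: dd v (Gam G u) x + dd v (Gam G u') x.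
  rewrite -ddZ; last exact: derivable_Gam.
  rewrite -ddD; last 2 first.
  - by apply: derivableZ; exact: derivable_Gam.
  - exact: derivable_Gam.
  by apply: eq_open_dd oO _ Ox => y; exact: Gam_linear.
rewrite mulmxDr mulmxDl -scalemxAr -scalemxAl.
by apply/matrixP => i j; rewrite !(mxDE, mxNE, mxZE); lra.
Qed.

Lemma dd_GamC x a b c : O x -> c *m dd a (Gam G b) x = b *m dd a (Gam G c) x.
Proof.
move=> Ox; rewrite -!dd_mulmxl; do ?exact: derivable_Gam.
by apply: eq_open_dd oO _ Ox => y Oy; exact: GamC.
Qed.

(** Absence of torsion: [GamC] cancels the quadratic terms in pairs, and its derivative [dd_GamC]
    those of first order. *)
Lemma bianchi x u v w : O x -> w *m Rm G u v x + u *m Rm G v w x + v *m Rm G w u x = 0.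
Proof.
move=> Ox.
have D a b c := dd_GamC a b c Ox.
apply/matrixP => i j.
have /= Du := congr1 (fun M : 'M[R]_(_, _) => M i j) (D u v w).
have /= Dv := congr1 (fun M : 'M[R]_(_, _) => M i j) (D v w u).
have /= Dw := congr1 (fun M : 'M[R]_(_, _) => M i j) (D w u v).
rewrite /Rm !(mulmxDr, mulmxN) !mulmxA (GamC u v Ox) (GamC u w Ox) (GamC v w Ox).
rewrite !(mxDE, mxNE) [in RHS]mxE.
by lra.
Qed.

End LeviCivita.

(* Commuting second derivatives of a solution of [dA = L A + A N]. *)
Lemma integrability (R : realType) m n l (O : set 'rV[R]_m) (A : 'rV[R]_m -> 'M[R]_(n, l))
    (L : 'rV[R]_m -> 'rV[R]_m -> 'M[R]_n) (N : 'rV[R]_m -> 'rV[R]_m -> 'M[R]_l) x u v :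
  open O -> ndiff 3 O A -> (forall w, ndiff 1 O (L w)) -> (forall w, ndiff 1 O (N w)) ->
  (forall y w, O y -> dd w A y = L w y *m A y + A y *m N w y) -> O x ->
  (dd u (L v) x - dd v (L u) x + L v x *m L u x - L u x *m L v x) *m A x
  + A x *m (dd u (N v) x - dd v (N u) x + N u x *m N v x - N v x *m N u x) = 0.
Proof.
move=> oO dA dL dN DA Ox.
have dAx w : derivable A x w by exact: (ndiff_derivable dA).
have dLx w z : derivable (L z) x w by exact: (ndiff_derivable (dL z)).
have dNx w z : derivable (N z) x w by exact: (ndiff_derivable (dN z)).
have D w z : dd w (dd z A) x = dd w (L z) x *m A x + L z x *m (L w x *m A x + A x *m N w x)
    + ((L w x *m A x + A x *m N w x) *m N z x + A x *m dd w (N z) x).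
  rewrite (eq_open_dd w oO (DA ^~ z) Ox) ddD; last 2 first.
  - exact: derivable_mulmx.
  - exact: derivable_mulmx.
  by rewrite !dd_mulmx // !DA.
have := schwarz_mx u v oO dA Ox; rewrite !D => /eqP; rewrite -subr_eq0 => /eqP E.
rewrite -[RHS]E; apply/matrixP => i j.
rewrite !(mulmxDl, mulmxDr, mulmxN, mulNmx, mulmxA).
by rewrite !(mxDE, mxNE); lra.
Qed.

(** * Cosymplectic structures are parallel *)

(* [a u v w] stands for g((nabla_u phi) v, w) and [b u v] for g(nabla_u xi, v).
   Normality contracted with xi and the closedness of Phi give
   [b (f u) (f v) = - b (f v) (f u)], so that [b = 0] by the symmetry of [b]
   (closedness of eta); then normality at (v, w, phi u) and closedness of Phi
   at (u, phi v, phi w) give [a u v w = - a u v w]. *)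
Section ParallelAlgebra.
Variables (R : realType) (V : lmodType R) (f : V -> V) (xi : V) (eta : V -> R).
Variables (a : V -> V -> V -> R) (b : V -> V -> R).
Hypotheses (aL : forall u v w w' t, a u v (- w + t *: w') = - a u v w + t * a u v w')
  (bL : forall u w w' t, b u (- w + t *: w') = - b u w + t * b u w')
  (a0 : forall v w, a 0 v w = 0)
  (ff : forall v, f (f v) = - v + eta v *: xi) (fxi : f xi = 0)
  (aS : forall u v w, a u v w = - a u w v)
  (aC : forall u v w, a u v w + a v w u + a w u v = 0)
  (aN : forall u v w, a (f u) v w - a (f v) u w - a v u (f w) + a u v (f w) = 0)
  (aP : forall u v w, a u (f v) w - a u v (f w) = b u v * eta w + eta v * b u w)
  (bC : forall u v, b u v = b v u) (bxi : forall u, b u xi = 0)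
  (axi : forall u w, a u xi w = b u (f w)).

Let bff u w : b u (f (f w)) = - b u w.
Proof. by rewrite ff bL bxi mulr0 addr0. Qed.

Let aff u v w : a u v (f (f w)) = - a u v w + eta w * a u v xi.
Proof. by rewrite ff aL. Qed.

Lemma parallel_form u v : b u v = 0.
Proof.
have bf x y : b (f x) (f y) = 0.
  have := aN x xi y; have := aC xi x (f y).
  have := aS x (f y) xi; have := bC (f x) (f y); have := bff x y.
  rewrite fxi a0 !axi; lra.
have := bf (f v) (f u); have := bff (f (f v)) u; have := bff u v.
rewrite (bC u (f (f v))); lra.
Qed.

Lemma parallel_tensor u v w : a u v w = 0.
Proof.
have axi0 x y : a x y xi = 0 by rewrite aS axi parallel_form oppr0.
have := aP u v (f w); have := aC u (f v) (f w); have := aN v w (f u).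
have := aP (f v) w u; have := aP (f w) v u; have := aS (f w) u (f v).
have := aS w u v; have := aC u v w.
rewrite !parallel_form !aff !axi0; lra.
Qed.

End ParallelAlgebra.

(** The structure in one coordinate domain. Compatibility with the metric is kept as the matrix
    equations [racm_dual] (eta is metrically dual to xi) and [racm_skew] (phi is skew), a form that
    can be differentiated directly. *)
Record regular_acm (R : realType) n (O : set 'rV[R]_n) (G P : 'rV[R]_n -> 'M[R]_n)
    (Z : 'rV[R]_n -> 'rV[R]_n) (E : 'rV[R]_n -> 'cV[R]_n) := {
  racm_metric : regular_metric O G;
  racm_phi : ndiff 3 O P;
  racm_xi : ndiff 3 O Z;
  racm_eta : ndiff 3 O E;
  racm_phiphi : forall x, O x -> P x *m P x = - 1%:M + E x *m Z x;
  racm_phixi : forall x, O x -> Z x *m P x = 0;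
  racm_unit : forall x, O x -> ip (G x) (Z x) (Z x) = 1;
  racm_dual : forall x, O x -> E x = G x *m (Z x)^T;
  racm_skew : forall x, O x -> P x *m G x = - (G x *m (P x)^T);
  racm_normal : forall x u v, O x ->
    nijenhuis P (cst u) (cst v) x + d1form E x u v *: Z x = 0;
  racm_deta : forall x u v, O x -> d1form E x u v = 0;
  racm_dPhi : forall x u v w, O x ->
    d2form (fun y u v => ip (G y) u (v *m P y)) x u v w = 0 }.

Ltac mxlin := rewrite ?(mulmxDl, mulmxDr, mulmxN, mulNmx, mulmxA);
  apply/matrixP => ? ?; rewrite !(mxDE, mxNE); lra.

Section Parallel.
Variables (R : realType) (n : nat) (O : set 'rV[R]_n) (G P : 'rV[R]_n -> 'M[R]_n).
Variables (Z : 'rV[R]_n -> 'rV[R]_n) (E : 'rV[R]_n -> 'cV[R]_n).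
Hypothesis hS : regular_acm O G P Z E.

Let hG := racm_metric hS.
Let oO : open O := regular_open hG.

Variables (x : 'rV[R]_n).
Hypothesis Ox : O x.

Let Gx := G x.
Let Px := P x.
Let Zx := Z x.
Let Ex := E x.
Let g u := Gam G u x.
(** [A u] is the endomorphism nabla_u phi and [B u] the vector nabla_u xi. *)
Let A u := dd u P x + Px *m g u - g u *m Px.
Let B u := dd u Z x + Zx *m g u.

Let dG u : derivable G x u.
Proof. exact: ndiff_derivable (regular_diff hG) Ox. Qed.
Let dP u : derivable P x u.
Proof. exact: ndiff_derivable (racm_phi hS) Ox. Qed.
Let dZ u : derivable Z x u.
Proof. exact: ndiff_derivable (racm_xi hS) Ox. Qed.
Let dE u : derivable E x u.
Proof. exact: ndiff_derivable (racm_eta hS) Ox. Qed.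
Let ddG u : dd u G x = g u *m Gx + Gx *m (g u)^T.
Proof. exact: (metric_compat hG). Qed.
Let ddP u : dd u P x = A u - Px *m g u + g u *m Px.
Proof. by rewrite /A; mxlin. Qed.
Let ddZ' u : dd u Z x = B u - Zx *m g u.
Proof. by rewrite /B; mxlin. Qed.
Let gC u v : v *m g u = u *m g v.
Proof. exact: (GamC hG). Qed.
Let skew : Px *m Gx = - (Gx *m Px^T).
Proof. exact: racm_skew hS _ Ox. Qed.

(** This and the next identities come from differentiating the algebraic relations of the structure
    along [u]: once the derivatives of [G], [P], [Z] are written through [g u], [A u] and [B u], the
    connection terms cancel. *)
Let A_skew u : A u *m Gx + Gx *m (A u)^T = 0.
Proof.
have : dd u (fun y => P y *m G y + G y *m (P y)^T) x = 0.
  rewrite (@eq_open_dd _ _ _ _ _ (fun=> 0) _ u oO _ Ox) ?dd_cst // => y Oy.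
  by rewrite (racm_skew hS Oy) addNr.
rewrite ddD; last 2 first.
- exact: derivable_mulmx.
- by apply: derivable_mulmx => //; exact: derivable_trmx.
rewrite !dd_mulmx //; last exact: derivable_trmx.
rewrite dd_trmx // ddG -/Gx -/Px /A.
move: (dd u P x) (g u) skew => D h sk.
have e1 : h *m Px *m Gx = - (h *m Gx *m Px^T) by rewrite -mulmxA sk mulmxN mulmxA.
have e2 : Px *m Gx *m h^T = - (Gx *m Px^T *m h^T) by rewrite sk mulNmx.
rewrite !(trmxD, trmxN) !trmx_mul => H; rewrite -[RHS]H.
rewrite ?(mulmxDl, mulmxDr, mulmxN, mulNmx, mulmxA) e1 e2.
by mxlin.
Qed.

Let A_phi u : A u *m Px + Px *m A u = Gx *m (B u)^T *m Zx + Ex *m B u.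
Proof.
have : dd u (fun y => P y *m P y) x = dd u (fun y => E y *m Z y) x.
  rewrite (@eq_open_dd _ _ _ _ _ (fun y => - 1%:M + E y *m Z y) _ u oO _ Ox); last first.
    by move=> y; exact: racm_phiphi hS y.
  rewrite ddD; last 2 first.
  - exact: derivable_cst.
  - exact: derivable_mulmx.
  by rewrite dd_cst add0r.
have -> : dd u (fun y => E y *m Z y) x = dd u (fun y => G y *m (Z y)^T *m Z y) x.
  by apply: eq_open_dd oO _ Ox => y Oy; rewrite (racm_dual hS Oy).
have dZt : derivable (fun y => (Z y)^T) x u by exact: derivable_trmx.
have dGZ : derivable (fun y => G y *m (Z y)^T) x u by exact: derivable_mulmx.
rewrite (dd_mulmx (@dP u) (@dP u)) (dd_mulmx dGZ (@dZ u)) (dd_mulmx (@dG u) dZt).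
rewrite (dd_trmx (@dZ u)) ddG ddZ' ddP -/Gx -/Px -/Zx.
have pp : Px *m Px = - 1%:M + Ex *m Zx by exact: racm_phiphi hS _ Ox.
have ee : Ex = Gx *m Zx^T by exact: racm_dual hS _ Ox.
move: (A u) (g u) (B u) pp => a h b pp.
have e1 : h *m Px *m Px = - h + h *m Gx *m Zx^T *m Zx.
  by rewrite -mulmxA pp ee mulmxDr mulmxN mulmx1 !mulmxA.
have e2 : Px *m Px *m h = - h + Gx *m Zx^T *m Zx *m h.
  by rewrite pp ee mulmxDl mulNmx mul1mx.
rewrite ee !(trmxD, trmxN) !trmx_mul.
rewrite ?(mulmxDl, mulmxDr, mulmxN, mulNmx, mulmxA) e1 e2 => H.
apply/matrixP => i j; have /= := congr1 (fun M : 'M[R]_n => M i j) H.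
rewrite !(mxDE, mxNE); lra.
Qed.

Let A_xi u : Zx *m A u = - (B u *m Px).
Proof.
have : dd u (fun y => Z y *m P y) x = 0.
  rewrite (@eq_open_dd _ _ _ _ _ (fun=> 0) _ u oO _ Ox) ?dd_cst // => y Oy.
  exact: racm_phixi hS _ Oy.
rewrite (dd_mulmx (@dZ u) (@dP u)) ddZ' ddP -/Px -/Zx.
have zp : Zx *m Px = 0 by exact: racm_phixi hS _ Ox.
move: (A u) (g u) (B u) => a h b.
rewrite ?(mulmxDl, mulmxDr, mulmxN, mulNmx, mulmxA) zp mul0mx => H.
apply/matrixP => i j; have /= := congr1 (fun M : 'rV[R]_n => M i j) H.
rewrite !(mxDE, mxNE, mx0E); lra.
Qed.

Let B_xi u : ip Gx (B u) Zx = 0.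
Proof.
have : dd u (fun y => ip (G y) (Z y) (Z y)) x = 0.
  by rewrite -[RHS](dd_cst (1 : R) x u); exact: eq_open_dd oO (racm_unit hS) Ox.
rewrite (dd_ip (@dG u) (@dZ u) (@dZ u)) ddG ddZ' -/Gx -/Zx.
have -> : ip (g u *m Gx + Gx *m (g u)^T) Zx Zx = ip Gx (Zx *m g u) Zx + ip Gx Zx (Zx *m g u).
  by rewrite !ipE mulmxDr mulmxDl mxDE trmx_mul !mulmxA.
rewrite (metric_sym hG Zx (Zx *m g u) Ox) (metric_sym hG Zx _ Ox) -/Gx.
move: (B u) (Zx *m g u) => b h; rewrite ipDl ipNl; lra.
Qed.

Let B_sym u v : ip Gx (B u) v = ip Gx (B v) u.
Proof.
have D w z : dd w (fun y => (z *m E y) 0 0) x = ip Gx (z *m g w) Zx + ip Gx z (B w).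
  have -> : dd w (fun y => (z *m E y) 0 0) x = dd w (fun y => ip (G y) (cst z y) (Z y)) x.
    by apply: eq_open_dd oO _ Ox => y Oy; rewrite (racm_dual hS Oy) ipE mulmxA.
  rewrite (dd_ip (@dG w) (derivable_cst _ _ _) (@dZ w)) dd_cst ip0l addr0 ddG ddZ' -/Gx -/Zx.
  move: (B w) (g w) => b h.
  by rewrite !ipE !(mulmxDr, mulmxDl, trmxD, trmxN, trmx_mul, mulmxN, mulmxA) !(mxDE, mxNE); lra.
have := racm_deta hS u v Ox; rewrite /d1form !ddE !D gC.
rewrite (metric_sym hG v _ Ox) (metric_sym hG u _ Ox) -/Gx.
by move: (B u) (B v) => b b'; lra.
Qed.

Let Phi u v := ip Gx u (v *m Px).

Let Phi_skew u v : Phi u v = - Phi v u.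
Proof.
rewrite /Phi (metric_sym hG u _ Ox) -/Gx !ipE -(mulmxA v) skew.
by rewrite mulmxN mulNmx mxNE trmx_mul !mulmxA.
Qed.

(** Closedness of the fundamental form, and below normality, may be written with covariant
    derivatives since the connection has no torsion: the Christoffel terms cancel by [gC], here
    together with the skewness of [Phi]. *)
Let A_cyclic u v w : ip Gx v (w *m A u) + ip Gx w (u *m A v) + ip Gx u (v *m A w) = 0.
Proof.
have D r s t : dd r (fun y => ip (G y) s (t *m P y)) x
    = Phi (s *m g r) t + Phi s (t *m g r) + ip Gx s (t *m A r).
  have -> : dd r (fun y => ip (G y) s (t *m P y)) x =
      dd r (fun y => ip (G y) (cst s y) (cst t y *m P y)) x by [].
  rewrite dd_ip //; last by apply: derivable_mulmx => //; exact: derivable_cst.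
  rewrite (dd_mulmx (derivable_cst _ _ _) (@dP r)) !dd_cst ip0l addr0 mul0mx add0r.
  rewrite ddG ddP -/Gx -/Px /Phi.
  move: (A r) (g r) => a h.
  rewrite !ipE !(mulmxDr, mulmxDl, trmxD, trmxN, trmx_mul, mulmxN, mulNmx, mulmxA).
  by rewrite !(mxDE, mxNE); lra.
have := racm_dPhi hS u v w Ox; rewrite /d2form !ddE !D.
rewrite (gC v u) (gC w u) (gC w v).
have := Phi_skew (v *m g u) w; have := Phi_skew (w *m g u) v.
have := Phi_skew (w *m g v) u.
by move: (A u) (A v) (A w) => a a' a''; lra.
Qed.

Let A_normal u v : v *m A (u *m Px) - u *m A (v *m Px) + u *m A v *m Px - v *m A u *m Px = 0.
Proof.
have lb (X : 'rV[R]_n -> 'rV[R]_n) w y : lie_bracket (cst w) X y = dd w X y - dd (X y) (cst w) y.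
  by rewrite /lie_bracket !ddE.
have D r s : dd r (fun y => cst s y *m P y) x = s *m dd r P x.
  by rewrite (dd_mulmx (derivable_cst _ _ _) (@dP r)) dd_cst mul0mx add0r.
have := racm_normal hS u v Ox; rewrite (racm_deta hS u v Ox) scale0r addr0.
rewrite /nijenhuis /lie_bracket !ddE !dd_cst subrr !mul0mx add0r sub0r subr0 -/Px.
rewrite !D !ddP -/Px; move=> H; rewrite -[RHS]H.
move: (A u) (A v) (A (u *m Px)) (A (v *m Px)) => a1 a2 a3 a4.
have e1 : v *m g (u *m Px) = u *m Px *m g v by rewrite gC.
have e2 : u *m g (v *m Px) = v *m Px *m g u by rewrite gC.
have e3 : v *m Px *m g (u *m Px) = u *m Px *m g (v *m Px) by rewrite gC.
rewrite !(mulmxDl, mulmxDr, mulmxN, mulNmx, mulmxA) e1 e2 e3 (gC u v).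
by mxlin.
Qed.

Let A0 : A 0 = 0.
Proof.
have g0 : g 0 = 0.
  by have := Gam_linear hG (-1) 0 0 Ox; rewrite scaler0 addr0 scaleN1r addNr.
by rewrite /A dd0 g0 mulmx0 mul0mx subr0 addr0.
Qed.

Let ipP u v : ip Gx (u *m Px) v = - ip Gx u (v *m Px).
Proof. by have := Phi_skew v u; rewrite /Phi (metric_sym hG v _ Ox) => ->. Qed.

Let fa u v w := ip Gx (v *m A u) w.
Let fb u v := ip Gx (B u) v.
Let eta (v : 'rV[R]_n) : R := (v *m Ex) 0 0.

Let etaE v : eta v = ip Gx v Zx.
Proof. by rewrite /eta /Ex (racm_dual hS Ox) ipE mulmxA. Qed.

Let aS u v w : fa u v w = - fa u w v.
Proof.
rewrite /fa (metric_sym hG _ v Ox) -/Gx !ipE trmx_mul.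
have /(congr1 (fun M => v *m M *m w^T)) := A_skew u.
rewrite mulmx0 mul0mx => /(congr1 (fun M : 'M[R]_1 => M 0 0)).
by rewrite mulmxDr mulmxDl mxDE [X in _ = X]mxE !mulmxA; lra.
Qed.

Let aL u v w w' t : fa u v (- w + t *: w') = - fa u v w + t * fa u v w'.
Proof. by rewrite /fa ipDr ipNr ipZr. Qed.

Let bL u w w' t : fb u (- w + t *: w') = - fb u w + t * fb u w'.
Proof. by rewrite /fb ipDr ipNr ipZr. Qed.

Let a0 v w : fa 0 v w = 0.
Proof. by rewrite /fa A0 mulmx0 ip0l. Qed.

Let ff v : v *m Px *m Px = - v + eta v *: Zx.
Proof.
rewrite -mulmxA [Px *m Px](racm_phiphi hS Ox) mulmxDr mulmxN mulmx1 mulmxA.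
by congr (_ + _); rewrite [v *m _]mx11_scalar mul_scalar_mx.
Qed.

Let aC u v w : fa u v w + fa v w u + fa w u v = 0.
Proof.
have := A_cyclic u w v; rewrite /fa.
rewrite (metric_sym hG w _ Ox) (metric_sym hG v _ Ox) (metric_sym hG u _ Ox) -/Gx.
by move: (A u) (A v) (A w) => b b' b''; lra.
Qed.

Let aN u v w : fa (u *m Px) v w - fa (v *m Px) u w - fa v u (w *m Px) + fa u v (w *m Px) = 0.
Proof.
have := ipP (u *m A v) w; have := ipP (v *m A u) w.
have := congr1 (fun z => ip Gx z w) (A_normal u v) => /=.
rewrite /fa !(ipDl, ipNl) ip0l.
move: (A u) (A v) (A (u *m Px)) (A (v *m Px)) => b1 b2 b3 b4.
lra.
Qed.

Let aP u v w : fa u (v *m Px) w - fa u v (w *m Px) = fb u v * eta w + eta v * fb u w.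
Proof.
have := ipP (v *m A u) w.
have := congr1 (fun M => ip Gx (v *m M) w) (A_phi u) => /=.
have -> : v *m (Gx *m (B u)^T *m Zx + Ex *m B u) = ip Gx v (B u) *: Zx + eta v *: B u.
  rewrite mulmxDr !mulmxA [v *m Gx *m _]mx11_scalar mul_scalar_mx.
  by rewrite [v *m Ex]mx11_scalar mul_scalar_mx.
rewrite (metric_sym hG v _ Ox) -/Gx /fa /fb; move: (A u) (B u) => a b.
by rewrite mulmxDr !mulmxA !(ipDl, ipZl) (metric_sym hG Zx _ Ox) -/Gx -etaE; lra.
Qed.

Let bxi u : fb u Zx = 0.
Proof. exact: B_xi. Qed.

Let axi u w : fa u Zx w = fb u (w *m Px).
Proof. by rewrite /fa /fb A_xi ipNl ipP opprK. Qed.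

Let fxi : Zx *m Px = 0.
Proof. exact: racm_phixi hS _ Ox. Qed.

Lemma nabla_xi u : dd u Z x = - (Zx *m g u).
Proof.
have B0 : B u = 0.
  apply: (ip_inj (regular_pos hG Ox)) => w; rewrite ip0l.
  exact: (@parallel_form _ _ (fun v : 'rV[R]_n => v *m Px) Zx eta fa fb bL a0 ff fxi aS aC aN B_sym bxi axi u w).
by rewrite ddZ' B0 sub0r.
Qed.

Lemma nabla_phi u : dd u P x = g u *m Px - Px *m g u.
Proof.
have A00 : A u = 0.
  apply/row_matrixP => i; rewrite row0 rowE.
  apply: (ip_inj (regular_pos hG Ox)) => w; rewrite ip0l.
  exact: (@parallel_tensor _ _ (fun v : 'rV[R]_n => v *m Px) Zx eta fa fb aL bL a0 ff fxi aS aC aN aP B_sym bxi axi).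
by rewrite ddP A00 sub0r addrC.
Qed.

End Parallel.

(** * Curvature identities implied by parallel tensors *)

Section ParallelCurvature.
Variables (R : realType) (n : nat) (O : set 'rV[R]_n) (G P : 'rV[R]_n -> 'M[R]_n).
Variables (Z : 'rV[R]_n -> 'rV[R]_n) (E : 'rV[R]_n -> 'cV[R]_n).
Hypothesis hS : regular_acm O G P Z E.
Let hG := racm_metric hS.

(** [nabla_phi] is the equation of [integrability] with left coefficient [Gam] and right coefficient
    [- Gam]; both coefficients have curvature [Rm] up to sign, and the condition is a commutator. *)
Lemma Rm_phi x u v : O x -> Rm G u v x *m P x = P x *m Rm G u v x.
Proof.
move=> Ox; have dN w : ndiff 1 O (fun y => - Gam G w y) by apply: ndiffN (regular_open hG) (ndiff_Gam hG w).
have := @integrability _ _ _ _ O P (Gam G) (fun w y => - Gam G w y) x u v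
  (regular_open hG) (racm_phi hS) (ndiff_Gam hG) dN.
have ddN w z : dd w (fun y => - Gam G z y) x = - dd w (Gam G z) x.
  by apply: ddN; exact: (derivable_Gam hG).
rewrite !ddN => H; apply/eqP; rewrite -subr_eq0; apply/eqP.
rewrite -[RHS]H //; last by move=> y w Oy; rewrite (nabla_phi hS Oy) mulmxN.
by rewrite /Rm; mxlin.
Qed.

(** The same argument for the row [Z], with left coefficient 0. *)
Lemma xi_Rm x u v : O x -> Z x *m Rm G u v x = 0.
Proof.
move=> Ox; have dN w : ndiff 1 O (fun y => - Gam G w y) by apply: ndiffN (regular_open hG) (ndiff_Gam hG w).
have := @integrability _ _ _ _ O Z (fun _ _ => 0) (fun w y => - Gam G w y) x u v
  (regular_open hG) (racm_xi hS) (fun=> ndiff_cst _ _ _) dN.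
have ddN w z : dd w (fun y => - Gam G z y) x = - dd w (Gam G z) x.
  by apply: ddN; exact: (derivable_Gam hG).
rewrite !ddN => H; apply/eqP; rewrite -oppr_eq0 -mulmxN; apply/eqP.
rewrite -[RHS]H //; last by move=> y w Oy; rewrite (nabla_xi hS Oy) mulmxN mul0mx add0r.
rewrite !dd_cst !mulmx0 !subr0 addr0 mul0mx add0r.
by rewrite /Rm; mxlin.
Qed.

End ParallelCurvature.

Section MetricCurvature.
Variables (R : realType) (n : nat) (O : set 'rV[R]_n) (G : 'rV[R]_n -> 'M[R]_n).
Hypothesis hG : regular_metric O G.

(** [integrability] applied to the metric itself: the right coefficient is the transpose of [Gam],
    whose curvature is the transpose of [Rm]. *)
Lemma Rm_skew x u v w z : O x ->
  ip (G x) (w *m Rm G u v x) z = - ip (G x) w (z *m Rm G u v x).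
Proof.
move=> Ox; have oO := regular_open hG.
have dT w' : ndiff 1 O (fun y => (Gam G w' y)^T) by apply: ndiff_trmx oO (ndiff_Gam hG w').
have := @integrability _ _ _ _ O G (Gam G) (fun w y => (Gam G w y)^T) x u v
  oO (regular_diff hG) (ndiff_Gam hG) dT (fun y w' Oy => metric_compat hG w' Oy) Ox.
rewrite !dd_trmx; do ?exact: (derivable_Gam hG).
have <- : (Rm G u v x)^T = (dd u (Gam G v) x)^T - (dd v (Gam G u) x)^T +
    (Gam G u x)^T *m (Gam G v x)^T - (Gam G v x)^T *m (Gam G u x)^T.
  by rewrite /Rm !(trmxD, trmxN, trmx_mul).
rewrite -/(Rm G u v x) => /(congr1 (fun M => (w *m M *m z^T) 0 0)).
rewrite mulmx0 mul0mx mx0E mulmxDr mulmxDl mxDE !ipE trmx_mul !mulmxA; lra.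
Qed.

End MetricCurvature.

Section AcmIdentities.
Variables (R : realType) (n : nat) (O : set 'rV[R]_n) (G P : 'rV[R]_n -> 'M[R]_n).
Variables (Z : 'rV[R]_n -> 'rV[R]_n) (E : 'rV[R]_n -> 'cV[R]_n).
Hypothesis hS : regular_acm O G P Z E.
Variable x : 'rV[R]_n.
Hypothesis Ox : O x.

Lemma acm_skew u v : ip (G x) (u *m P x) v = - ip (G x) u (v *m P x).
Proof.
rewrite !ipE -(mulmxA u) (racm_skew hS Ox) mulmxN mulNmx mxNE.
by rewrite trmx_mul !mulmxA.
Qed.

Lemma acm_phiphi v : v *m P x *m P x = - v + ip (G x) v (Z x) *: Z x.
Proof.
rewrite -mulmxA (racm_phiphi hS Ox) mulmxDr mulmxN mulmx1 mulmxA; congr (_ + _).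
by rewrite [v *m _]mx11_scalar mul_scalar_mx (racm_dual hS Ox) mulmxA.
Qed.

Lemma acm_isometry u v : ip (G x) (u *m P x) (v *m P x) =
  ip (G x) u v - ip (G x) u (Z x) * ip (G x) v (Z x).
Proof. by rewrite acm_skew acm_phiphi ipDr ipNr ipZr; ring. Qed.

End AcmIdentities.

(** * Curvature of cosymplectic space forms *)

(** [K u v w z] stands for g(R(u, v) w, z) and [perp] for orthogonality to xi. Multilinearity enters
    as additivity and compatibility with signs, which is what polarizing at x + y and x - y
    takes. *)
Section SpaceForm.
Variables (R : realType) (V : lmodType R) (g : V -> V -> R) (K : V -> V -> V -> V -> R).
Variables (f : V -> V) (perp : V -> Prop) (c : R).
Hypotheses (gDl : forall u v w, g (u + v) w = g u w + g v w)
  (gNl : forall u w, g (- u) w = - g u w) (gC : forall u v, g u v = g v u)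
  (KD1 : forall u u' v w z, K (u + u') v w z = K u v w z + K u' v w z)
  (KN1 : forall u v w z, K (- u) v w z = - K u v w z)
  (KD3 : forall u v w w' z, K u v (w + w') z = K u v w z + K u v w' z)
  (KN3 : forall u v w z, K u v (- w) z = - K u v w z)
  (K12 : forall u v w z, K u v w z = - K v u w z)
  (K34 : forall u v w z, K u v w z = - K u v z w)
  (KB : forall u v w z, K u v w z + K v w u z + K w u v z = 0)
  (Kf : forall u v w z, K u v (f w) z = - K u v w (f z))
  (fD : forall u v, f (u + v) = f u + f v) (fN : forall u, f (- u) = - f u)
  (perpD : forall u v, perp u -> perp v -> perp (u + v))
  (perpN : forall u, perp u -> perp (- u))
  (perpf : forall u, perp (f u))
  (ff : forall u, perp u -> f (f u) = - u)
  (gff : forall u v, perp u -> perp v -> g (f u) (f v) = g u v)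
  (hol : forall u, perp u -> K u (f u) (f u) u = c * g u u ^+ 2).

Let KD2 u v v' w z : K u (v + v') w z = K u v w z + K u v' w z.
Proof. by rewrite K12 KD1 (K12 u v) (K12 u v'); lra. Qed.
Let KN2 u v w z : K u (- v) w z = - K u v w z.
Proof. by rewrite K12 KN1 (K12 u v). Qed.
Let KD4 u v w z z' : K u v w (z + z') = K u v w z + K u v w z'.
Proof. by rewrite K34 KD3 (K34 u v w z) (K34 u v w z'); lra. Qed.
Let KN4 u v w z : K u v w (- z) = - K u v w z.
Proof. by rewrite K34 KN3 (K34 u v w z). Qed.

Let gDr u v w : g w (u + v) = g w u + g w v.
Proof. by rewrite !(gC w) gDl. Qed.
Let gNr u w : g w (- u) = - g w u.
Proof. by rewrite !(gC w) gNl. Qed.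

(** The octahedron argument: a combination of four Bianchi identities in which all terms but the two
    opposite ones cancel by skewness. *)
Let pair u v w z : K u v w z = K w z u v.
Proof.
have := KB u v w z; have := KB v w z u; have := KB w z u v; have := KB z u v w.
have := K34 u v z w; have := K34 w z v u; have := K34 v w z u; have := K34 z u v w.
have := K12 u w z v; have := K34 w u z v; have := K12 v z u w; have := K34 z v u w.
lra.
Qed.

Let Kff u v w z : perp v -> K (f u) (f v) w z = K u v w z.
Proof. by move=> pv; rewrite pair Kf ff // KN4 opprK pair. Qed.

(* The coefficient of t^2 in [K z (f z) (f z) z = c g(z, z)^2], z = x + t y. *)
Let polarized x y : perp x -> perp y ->
  2 * K x y y x + 6 * K x (f y) (f y) x = c * (2 * (g x x * g y y) + 4 * g x y ^+ 2).
Proof.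
move=> px py.
(* All terms of degree two in [x] and in [y] reduce to [K x y y x] and [K x (f y) (f y) x]; only
   [t1] takes the Bianchi identity, [t2] following from it by pair symmetry. *)
have t3 : K x (f y) (f x) y = K x (f y) (f y) x by rewrite Kf [RHS]K34.
have t3' : K x (f y) y (f x) = - K x (f y) (f y) x by rewrite K34 t3.
have t5 : K y (f x) (f x) y = K x (f y) (f y) x.
  by rewrite K12 K34 opprK -Kff // ff // KN1 t3' opprK.
have t6 : K y (f x) (f y) x = K x (f y) (f y) x by rewrite pair K12 t3' opprK.
have t1 : K x (f x) (f y) y = K x y y x + K x (f y) (f y) x.
  have := KB x (f x) (f y) y; rewrite Kff // (K34 x y x y).
  by rewrite (K12 (f y) x) t3; lra.
have t2 : K y (f y) (f x) x = K x y y x + K x (f y) (f y) x.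
  by rewrite -t1 pair K12 K34 opprK.
(* Adding the values at x + y and x - y removes the terms of odd degree in [y]; the values at [x]
   and [y] remove the pure terms. *)
have := hol (perpD px py); have := hol (perpD px (perpN py)).
have := hol px; have := hol py.
rewrite !fD !fN !(KD1, KD2, KD3, KD4) !(KN1, KN2, KN3, KN4).
rewrite !(gDl, gDr, gNl, gNr) (gC y x).
rewrite t1 t2 t3 t5 t6.
move: (K x y y x) (K x (f y) (f y) x) => k l.
move=> h1 h2 h3 h4.
have -> : 2 * k + 6 * l = 2^-1 * (c * (g x x + g x y + (g x y + g y y)) ^+ 2
    + c * (g x x - g x y - (g x y - g y y)) ^+ 2) - c * g x x ^+ 2 - c * g y y ^+ 2 by lra.
by field.
Qed.

(** [polarized] at (x, y) and at (x, f y) are two linear equations in the same two unknowns; three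
    times the second minus the first leaves 16 [K x y y x]. *)
Lemma space_form_sectional x y : perp x -> perp y ->
  K x y y x = c / 4 * (g x x * g y y - g x y ^+ 2 + 3 * g x (f y) ^+ 2).
Proof.
move=> px py; have := polarized px py; have := polarized px (perpf y).
rewrite ff // KN2 KN3 opprK gff //.
move: (K x y y x) (K x (f y) (f y) x) => k l h1 h2.
have : 16 * k = c * (4 * (g x x * g y y) - 4 * g x y ^+ 2 + 12 * g x (f y) ^+ 2) by lra.
lra.
Qed.

End SpaceForm.

(** * Riemannian submersions and O'Neill's tensor *)

Section Projections.
Variables (R : realType) (m n : nat) (G : 'M[R]_m) (J : 'M[R]_(m, n)).
Hypotheses (Gs : G^T = G) (Gp : posdef G).
Implicit Types u v w : 'rV[R]_m.

Lemma verticalP v : reflect (v *m J = 0) (v <= vert_space J)%MS.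
Proof. exact: sub_kermxP. Qed.

Lemma horizontalP v :
  reflect (forall w, w *m J = 0 -> ip G v w = 0) (v <= hor_space G J)%MS.
Proof.
apply: (iffP sub_kermxP) => [vh w /verticalP /submxP[D ->]|vh].
  by rewrite ipE trmx_mul !mulmxA -[v *m G *m _]mulmxA vh mul0mx mx0E.
apply/rowP => j; rewrite mulmxA [RHS]mxE.
have /vh : row j (vert_space J) *m J = 0 by apply/verticalP/row_sub.
by rewrite ipE tr_row colE mulmxA -colE mxE.
Qed.

Lemma vert_hor_direct : (vert_space J :&: hor_space G J)%MS = 0.
Proof.
apply/eqP; rewrite -submx0; apply/rV_subP => v; rewrite sub_capmx => /andP[/verticalP vJ /horizontalP vh].
by have /eqP := vh _ vJ; rewrite ip_eq0 // => /eqP ->; rewrite sub0mx.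
Qed.

Lemma vert_hor_full v : (v <= vert_space J + hor_space G J)%MS.
Proof.
apply: submx_full; rewrite /row_full mxrank_disjoint_sum ?vert_hor_direct //.
have Gf : row_full G by rewrite row_full_unit; exact: posdef_unit Gp.
rewrite [\rank (hor_space G J)]mxrank_ker (eqmxMfull _ Gf) mxrank_tr subnKC //.
exact: rank_leq_row.
Qed.

Lemma proj_split v : v *m vert_proj G J + v *m hor_proj G J = v.
Proof. by rewrite add_proj_mx ?vert_hor_direct // vert_hor_full. Qed.

Lemma vert_projJ v : v *m vert_proj G J *m J = 0.
Proof. by apply/verticalP; exact: proj_mx_sub. Qed.

Lemma hor_proj_hor v w : w *m J = 0 -> ip G (v *m hor_proj G J) w = 0.
Proof. by apply: horizontalP w; exact: proj_mx_sub. Qed.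

Lemma vert_proj_id v : v *m J = 0 -> v *m vert_proj G J = v.
Proof. by move/verticalP => vv; rewrite proj_mx_id ?vert_hor_direct. Qed.

Lemma hor_proj_vert v : v *m J = 0 -> v *m hor_proj G J = 0.
Proof. by move/verticalP => vv; rewrite proj_mx_0 // capmxC vert_hor_direct. Qed.

Lemma vert_proj_horizontal v : (forall w, w *m J = 0 -> ip G v w = 0) -> v *m vert_proj G J = 0.
Proof. by move/horizontalP => vv; rewrite proj_mx_0 // vert_hor_direct. Qed.

Lemma hor_projJ v : v *m hor_proj G J *m J = v *m J.
Proof. by rewrite -[in RHS](proj_split v) mulmxDl vert_projJ add0r. Qed.

(** The difference of the two vectors is both vertical and horizontal. Identities between horizontal
    vectors are proved by comparing images under [J]. *)
Lemma hor_inj v w : (forall z, z *m J = 0 -> ip G v z = 0) ->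
  (forall z, z *m J = 0 -> ip G w z = 0) -> v *m J = w *m J -> v = w.
Proof.
move=> vh wh vw; apply/eqP; rewrite -subr_eq0 -(ip_eq0 _ Gp).
have zJ : (v - w) *m J = 0 by rewrite mulmxBl vw subrr.
by rewrite {1}(_ : v - w = v + - w) // ipDl ipNl vh // wh // subr0.
Qed.

Hypothesis Jn : \rank J = n.

(** The horizontal lift by the Gram formula. The projections are defined through complements of row
    spaces, which says nothing about their dependence on the point; [J *m lift_mx] is a rational
    expression in [G] and [J], hence differentiable. *)
Definition lift_mx : 'M[R]_(n, m) :=
  invmx (J^T *m invmx G *m J) *m J^T *m invmx G.

Let unitG := posdef_unit Gp.

(** It is the Gram matrix of the rows of [J^T *m invmx G], which are independent because [J] has
    rank n. *)
Lemma submersion_gram_unit : J^T *m invmx G *m J \in unitmx.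
Proof.
rewrite -row_free_unit -kermx_eq0; apply/eqP/row_matrixP => i; rewrite row0.
set x := row i _.
have xk : x *m (J^T *m invmx G *m J) = 0 by apply/sub_kermxP; exact: row_sub.
have /eqP : ip G (x *m J^T *m invmx G) (x *m J^T *m invmx G) = 0.
  rewrite ipE mulmxKV // !trmx_mul trmxK trmx_inv Gs !mulmxA.
  by move: xk; rewrite !mulmxA => ->; rewrite mul0mx mx0E.
rewrite ip_eq0 // => /eqP /(congr1 (mulmx^~ G)); rewrite mulmxKV // mul0mx => xJ.
have : row_free J^T by rewrite /row_free mxrank_tr Jn.
by move/row_free_inj; apply; rewrite mul0mx.
Qed.

Lemma lift_mxJ : lift_mx *m J = 1%:M.
Proof. by rewrite /lift_mx -!mulmxA mulVmx // !mulmxA submersion_gram_unit. Qed.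

Lemma lift_mx_hor z w : w *m J = 0 -> ip G (z *m lift_mx) w = 0.
Proof.
move=> wJ; rewrite ipE /lift_mx !mulmxA mulmxKV // -!mulmxA.
by rewrite -trmx_mul wJ trmx0 !mulmx0 mx0E.
Qed.

Lemma hor_projE : hor_proj G J = J *m lift_mx.
Proof.
apply/row_matrixP => i; rewrite !rowE; apply: hor_inj.
- by move=> z; exact: hor_proj_hor.
- by move=> z; rewrite mulmxA; exact: lift_mx_hor.
- by rewrite hor_projJ mulmxA -[RHS]mulmxA lift_mxJ mulmx1.
Qed.

Lemma vert_projE : vert_proj G J = 1%:M - J *m lift_mx.
Proof.
rewrite -hor_projE; apply/row_matrixP => i; rewrite !rowE mulmxBr mulmx1.
by apply/eqP; rewrite eq_sym subr_eq proj_split.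
Qed.

Lemma hor_lift v : (forall w, w *m J = 0 -> ip G v w = 0) -> v = v *m J *m lift_mx.
Proof.
move=> vh; apply: hor_inj => //; first by move=> z; exact: lift_mx_hor.
by rewrite -mulmxA lift_mxJ mulmx1.
Qed.

End Projections.

Lemma derivable_ip (R : realType) (X : normedModType R) n (G : X -> 'M[R]_n)
    (V W : X -> 'rV[R]_n) x u :
  derivable G x u -> derivable V x u -> derivable W x u ->
  derivable (fun y => ip (G y) (V y) (W y)) x u.
Proof.
move=> dG dV dW; have dVG := derivable_mulmx dV dG; have dWt := derivable_trmx dW.
by have /derivable_mxP := derivable_mulmx dVG dWt; exact.
Qed.

Record regular_submersion (R : realType) m n (O : set 'rV[R]_m) (G : 'rV[R]_m -> 'M[R]_m)
    (L : 'rV[R]_m -> 'rV[R]_n) := {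
  rsub_metric : regular_metric O G;
  rsub_diff : ndiff 3 O L;
  rsub_rank : forall x, O x -> \rank ('J L x) = n }.

Definition cov (R : realType) m (G : 'rV[R]_m -> 'M[R]_m) (X : 'rV[R]_m -> 'rV[R]_m) (u x : 'rV[R]_m) :=
  dd u X x + X x *m Gam G u x.

Lemma dd_ip_cov (R : realType) m (O : set 'rV[R]_m) (G : 'rV[R]_m -> 'M[R]_m)
    (X Y : 'rV[R]_m -> 'rV[R]_m) u x :
  regular_metric O G -> O x -> derivable X x u -> derivable Y x u ->
  dd u (fun y => ip (G y) (X y) (Y y)) x =
    ip (G x) (cov G X u x) (Y x) + ip (G x) (X x) (cov G Y u x).
Proof.
move=> hG Ox dX dY; have dG := ndiff_derivable (v := u) (regular_diff hG) Ox.
rewrite dd_ip // (metric_compat hG u Ox) /cov.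
move: (dd u X x) (dd u Y x) (Gam G u x) => a b h.
rewrite !ipE !(mulmxDr, mulmxDl, trmxD, trmx_mul, mulmxA).
by rewrite !mxDE; lra.
Qed.

(* Sealed versions of the projections, for the same reason as [dd]. *)
Definition vproj (R : realType) m n (G : 'rV[R]_m -> 'M[R]_m) (L : 'rV[R]_m -> 'rV[R]_n)
  (y : 'rV[R]_m) : 'M[R]_m := locked_with dd_key (fun y => vert_proj (G y) ('J L y)) y.

Definition hproj (R : realType) m n (G : 'rV[R]_m -> 'M[R]_m) (L : 'rV[R]_m -> 'rV[R]_n)
  (y : 'rV[R]_m) : 'M[R]_m := locked_with dd_key (fun y => hor_proj (G y) ('J L y)) y.

Definition hlift (R : realType) m n (G : 'rV[R]_m -> 'M[R]_m) (L : 'rV[R]_m -> 'rV[R]_n)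
  (y : 'rV[R]_m) : 'M[R]_(n, m) := locked_with dd_key (fun y => lift_mx (G y) ('J L y)) y.

Lemma vprojE (R : realType) m n (G : 'rV[R]_m -> 'M[R]_m) (L : 'rV[R]_m -> 'rV[R]_n) y :
  vert_proj (G y) ('J L y) = vproj G L y.
Proof. by rewrite /vproj unlock. Qed.

Lemma hprojE (R : realType) m n (G : 'rV[R]_m -> 'M[R]_m) (L : 'rV[R]_m -> 'rV[R]_n) y :
  hor_proj (G y) ('J L y) = hproj G L y.
Proof. by rewrite /hproj unlock. Qed.

Lemma hliftE (R : realType) m n (G : 'rV[R]_m -> 'M[R]_m) (L : 'rV[R]_m -> 'rV[R]_n) y :
  lift_mx (G y) ('J L y) = hlift G L y.
Proof. by rewrite /hlift unlock. Qed.

Section Submersion.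
Variables (R : realType) (m n : nat) (O : set 'rV[R]_m) (G : 'rV[R]_m -> 'M[R]_m).
Variable L : 'rV[R]_m -> 'rV[R]_n.
Hypothesis hL : regular_submersion O G L.
Let hG := rsub_metric hL.
Let oO : open O := regular_open hG.
Local Notation J y := ('J L y).
Local Notation VP := (vproj G L).
Local Notation HP := (hproj G L).

Section AtPoint.
Variable y : 'rV[R]_m.
Hypothesis Oy : O y.
Let Gs := regular_sym hG Oy.
Let Gp := regular_pos hG Oy.
Let Jn := rsub_rank hL Oy.
Implicit Types u v w : 'rV[R]_m.

Lemma vproj_hproj v : v *m VP y + v *m HP y = v.
Proof. by rewrite -vprojE -hprojE; exact: proj_split. Qed.

Lemma vprojJ v : v *m VP y *m J y = 0.
Proof. by rewrite -vprojE; exact: vert_projJ. Qed.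

Lemma hproj_hor v w : w *m J y = 0 -> ip (G y) (v *m HP y) w = 0.
Proof. by rewrite -hprojE; exact: hor_proj_hor. Qed.

Lemma vproj_id v : v *m J y = 0 -> v *m VP y = v.
Proof. by rewrite -vprojE; exact: vert_proj_id. Qed.

Lemma hproj_vert v : v *m J y = 0 -> v *m HP y = 0.
Proof. by rewrite -hprojE; exact: hor_proj_vert. Qed.

Lemma vproj_horizontal v : (forall w, w *m J y = 0 -> ip (G y) v w = 0) -> v *m VP y = 0.
Proof. by rewrite -vprojE; exact: vert_proj_horizontal. Qed.

Lemma hprojJ v : v *m HP y *m J y = v *m J y.
Proof. by rewrite -hprojE; exact: hor_projJ. Qed.

Lemma hliftJ : hlift G L y *m J y = 1%:M.
Proof. by rewrite -hliftE; exact: lift_mxJ. Qed.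

Lemma hlift_hor z w : w *m J y = 0 -> ip (G y) (z *m hlift G L y) w = 0.
Proof. by rewrite -hliftE; exact: lift_mx_hor. Qed.

Lemma horizontal_lift v : (forall w, w *m J y = 0 -> ip (G y) v w = 0) ->
  v = v *m J y *m hlift G L y.
Proof. by rewrite -hliftE; exact: hor_lift. Qed.

End AtPoint.

Lemma ndiff_J : ndiff 2 O (fun y => J y).
Proof. by apply: ndiff_jacobian => //; exact: rsub_diff hL. Qed.

Lemma ndiff_HP : ndiff 1 O HP.
Proof.
have dJ := ndiffS ndiff_J; have dJt := ndiff_trmx oO dJ.
have dG : ndiff 1 O G by do 2 apply: ndiffS; exact: regular_diff hG.
have dinv k (A : 'rV[R]_m -> 'M[R]_k) : ndiff 1 O A ->
    (forall y, O y -> A y \in unitmx) -> ndiff 1 O (fun y => invmx (A y)).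
  move=> dA uA; split=> // y Oy; apply: differentiable_invmx; last exact: uA.
  exact: ndiff_differentiable dA Oy.
have dGi := dinv _ _ dG (fun y Oy => posdef_unit (regular_pos hG Oy)).
have dgr := ndiff_mulmx oO (ndiff_mulmx oO dJt dGi) dJ.
have dgri := dinv _ _ dgr (fun y Oy => submersion_gram_unit (regular_sym hG Oy)
   (regular_pos hG Oy) (rsub_rank hL Oy)).
apply: (@eq_ndiff _ _ _ _ _ (fun y => J y *m lift_mx (G y) (J y))) => //.
  move=> y Oy; rewrite -hprojE hor_projE //; last exact: rsub_rank hL _ Oy.
  - exact: regular_sym hG _ Oy.
  - exact: regular_pos hG _ Oy.
exact: (ndiff_mulmx oO dJ (ndiff_mulmx oO (ndiff_mulmx oO dgri dJt) dGi)).
Qed.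

Lemma ndiff_VP : ndiff 1 O VP.
Proof.
have d1 : ndiff 1 O (fun=> 1%:M : 'M[R]_m) by exact: ndiff_cst.
apply: eq_ndiff (ndiffD oO d1 (ndiffN oO ndiff_HP)) => // y Oy.
rewrite -vprojE -hprojE vert_projE ?hor_projE //; do ?exact: rsub_rank hL _ Oy.
all: do ?[exact: regular_sym hG _ Oy | exact: regular_pos hG _ Oy].
Qed.

Variable x : 'rV[R]_m.
Hypothesis Ox : O x.
Let Gs := regular_sym hG Ox.
Let Gp := regular_pos hG Ox.
Let Jn := rsub_rank hL Ox.

Let dJ u : derivable (fun y => J y) x u.
Proof. exact: ndiff_derivable ndiff_J Ox. Qed.
Let dVP u : derivable VP x u.
Proof. exact: ndiff_derivable ndiff_VP Ox. Qed.
Let dHP u : derivable HP x u.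
Proof. exact: ndiff_derivable ndiff_HP Ox. Qed.

(* The image under [J] of nabla_u v, for vertical fields extending [u] and [v]. *)
Definition Timage (u v : 'rV[R]_m) := v *m Gam G u x *m 'J L x - v *m dd u (fun y => 'J L y) x.

Lemma ddJ_sym u v : v *m dd u (fun y => J y) x = u *m dd v (fun y => J y) x.
Proof.
have E w z : w *m dd z (fun y => J y) x = dd z (dd w L) x.
  have -> : dd z (dd w L) x = dd z (fun y => w *m J y) x.
    apply: eq_open_dd oO _ Ox => y Oy.
    by rewrite -ddE deriveEjacobian //; exact: ndiff_differentiable (rsub_diff hL) Oy.
  by rewrite (dd_mulmxl _ (@dJ z)).
rewrite !E; exact: schwarz_mx oO (rsub_diff hL) Ox.
Qed.

(** [Timage] is minus the covariant Hessian of [L]. Its symmetry replaces the usual appeal to the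
    integrability of the vertical distribution. *)
Lemma Timage_sym u v : Timage u v = Timage v u.
Proof. by rewrite /Timage (GamC hG u v Ox) [X in _ - X]ddJ_sym. Qed.

Lemma Timage_linear u a v w : Timage u (a *: v + w) = a *: Timage u v + Timage u w.
Proof.
rewrite /Timage !mulmxDl -!scalemxAl; move: (v *m _ *m _) (w *m _ *m _) => b c.
by apply/matrixP => i j; rewrite !(mxDE, mxNE, mxZE); lra.
Qed.

(** Differentiating [X y *m J y = 0] trades the derivative of the field for that of [J], so only the
    value of the field at [x] remains. *)
Lemma vertical_covJ (X : 'rV[R]_m -> 'rV[R]_m) u :
  (forall y, O y -> X y *m J y = 0) -> derivable X x u ->
  cov G X u x *m J x = Timage u (X x).
Proof.
move=> XJ dX.
have : dd u (fun y => X y *m J y) x = 0.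
  by rewrite -[RHS](dd_cst (0 : 'rV[R]_n) x u); exact: eq_open_dd oO XJ Ox.
rewrite (dd_mulmx dX (@dJ u)) /cov /Timage mulmxDl.
move=> /eqP; rewrite addr_eq0 => /eqP ->; rewrite addrC.
by congr (_ - _).
Qed.

(** The definition differentiates through the projections. Since a horizontal vector is determined
    by its image under [J], [vertical_covJ] evaluates the first summand pointwise, and the second
    summand vanishes. *)
Lemma oneillT_vertical u v : u *m J x = 0 -> v *m J x = 0 ->
  oneillT_at G (fun y => J y) x u v = Timage u v *m hlift G L x.
Proof.
move=> uJ vJ; have uV : u *m VP x = u by exact: vproj_id.
have vV : v *m VP x = v by exact: vproj_id.
have vH : v *m HP x = 0 by exact: hproj_vert.
have nE (Q : 'rV[R]_m -> 'M[R]_m) :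
    nabla G (fun y => cst u y *m vert_proj (G y) (J y)) (fun y => cst v y *m Q y) x
    = cov G (fun y => v *m Q y) u x.
  by rewrite (nablaE hG _ _ Ox) [cst u x *m _](_ : _ = u) // vprojE.
have -> : oneillT_at G (fun y => J y) x u v =
    cov G (fun y => v *m vert_proj (G y) (J y)) u x *m hor_proj (G x) (J x) +
    cov G (fun y => v *m hor_proj (G y) (J y)) u x *m vert_proj (G x) (J x).
  rewrite -(nE (fun y => vert_proj (G y) (J y))) -(nE (fun y => hor_proj (G y) (J y))).
  exact: erefl.
have -> : (fun y => v *m vert_proj (G y) (J y)) = (fun y => v *m VP y).
  by apply/funext => y; rewrite vprojE.
have -> : (fun y => v *m hor_proj (G y) (J y)) = (fun y => v *m HP y).
  by apply/funext => y; rewrite hprojE.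
rewrite vprojE hprojE.
have dvV (w : 'rV[R]_m) : derivable (fun y => w *m VP y) x u by exact: derivable_mulmxl.
have dvH : derivable (fun y => v *m HP y) x u by exact: derivable_mulmxl.
(* The field [v *m HP y] vanishes at [x] and stays orthogonal to the vertical fields [w *m VP y];
   differentiating the inner product shows that its derivative is horizontal. *)
have h0 : cov G (fun y => v *m HP y) u x *m VP x = 0.
  rewrite /cov vH mul0mx addr0; apply: (vproj_horizontal Ox) => w wJ.
  have wV : w *m VP x = w by exact: vproj_id.
  have : dd u (fun y => ip (G y) (v *m HP y) (w *m VP y)) x = 0.
    rewrite -[RHS](dd_cst (0 : R) x u); apply: eq_open_dd oO _ Ox => y Oy.
    by apply: hproj_hor; exact: vprojJ.
  by rewrite (dd_ip_cov hG Ox dvH (@dvV w)) /cov vH wV ip0l addr0 mul0mx addr0.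
have XJ y : O y -> v *m VP y *m J y = 0.
  by move=> Oy; exact: vprojJ.
rewrite [X in _ + X]h0 addr0; apply: (hor_inj Gp).
- by move=> z; exact: hproj_hor.
- by move=> z; exact: hlift_hor.
rewrite (hprojJ Ox) -[RHS]mulmxA hliftJ // mulmx1.
by rewrite (vertical_covJ XJ (@dvV v)) vV.
Qed.

(** It agrees with O'Neill's tensor on vertical pairs and extends it to all pairs as a symmetric
    bilinear map, so that the linear algebra below carries no verticality conditions. *)
Definition Tvert (u v : 'rV[R]_m) := Timage u v *m hlift G L x.

Lemma Tvert_hor u v w : w *m J x = 0 -> ip (G x) (Tvert u v) w = 0.
Proof. exact: hlift_hor. Qed.

Lemma Tvert_unique u v z : (forall w, w *m J x = 0 -> ip (G x) z w = 0) ->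
  z *m J x = Timage u v -> z = Tvert u v.
Proof. by move=> zh zJ; rewrite (horizontal_lift Ox zh) zJ. Qed.

End Submersion.

(** * The slant condition differentiated along the fibres *)

Section SlantSubmersion.
Variables (R : realType) (m n : nat) (O : set 'rV[R]_m) (G P : 'rV[R]_m -> 'M[R]_m).
Variables (Z : 'rV[R]_m -> 'rV[R]_m) (E : 'rV[R]_m -> 'cV[R]_m).
Variables (L : 'rV[R]_m -> 'rV[R]_n) (k : R).
Hypotheses (hS : regular_acm O G P Z E) (hL : regular_submersion O G L).
Let hG := rsub_metric hL.
Let oO : open O := regular_open hG.
Local Notation J y := ('J L y).
Local Notation VP := (vproj G L).
Local Notation HP := (hproj G L).
Hypothesis xiJ : forall y, O y -> Z y *m J y = 0.
Hypothesis slantP : forall y v, O y -> v *m J y = 0 ->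
  ip (G y) (v *m P y *m VP y) (v *m P y *m VP y) = k * (ip (G y) v v - ip (G y) v (Z y) ^+ 2).
Variable x : 'rV[R]_m.
Hypothesis Ox : O x.
Let Gp := regular_pos hG Ox.

Let gC u v : ip (G x) u v = ip (G x) v u.
Proof. exact: (metric_sym hG u v Ox). Qed.

Let dVP u : derivable VP x u.
Proof. exact: ndiff_derivable (ndiff_VP hL) Ox. Qed.
Let dHP u : derivable HP x u.
Proof. exact: ndiff_derivable (ndiff_HP hL) Ox. Qed.
Let dP u : derivable P x u.
Proof. exact: ndiff_derivable (racm_phi hS) Ox. Qed.
Let dZ u : derivable Z x u.
Proof. exact: ndiff_derivable (racm_xi hS) Ox. Qed.

(** xi is a vertical field and it is parallel. *)
Lemma Tvert_xi u : Tvert G L x u (Z x) = 0.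
Proof.
rewrite /Tvert -(vertical_covJ hL Ox xiJ (@dZ u)) /cov (nabla_xi hS Ox) addNr.
by rewrite !mul0mx.
Qed.

Let phi_skew u v : ip (G x) (u *m P x) v = - ip (G x) u (v *m P x).
Proof. exact: acm_skew hS _ Ox _ _. Qed.

Lemma slant_polar u v : u *m J x = 0 -> v *m J x = 0 ->
  ip (G x) (u *m P x *m VP x) (v *m P x *m VP x) =
    k * (ip (G x) u v - ip (G x) u (Z x) * ip (G x) v (Z x)).
Proof.
move=> uJ vJ; have uvJ : (u + v) *m J x = 0 by rewrite mulmxDl uJ vJ addr0.
have := slantP Ox uJ; have := slantP Ox vJ; have := slantP Ox uvJ.
rewrite !mulmxDl !ipDl !ipDr (gC v u) (gC (v *m _ *m _)).
move: (u *m _ *m _) (v *m _ *m _) (ip _ u _) (ip _ v _) => a b c d h1 h2 h3.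
lra.
Qed.

(* Differentiate |psi V|^2 = k (|V|^2 - eta(V)^2) along [u], for a vertical
   field V extending [v]. *)
Lemma slant_Tvert u v : u *m J x = 0 -> v *m J x = 0 ->
  ip (G x) (Tvert G L x u (v *m P x *m VP x)) (v *m P x *m HP x) =
  ip (G x) (Tvert G L x u v) (v *m P x *m VP x *m P x *m HP x).
Proof.
move=> uJ vJ.
(* [X] extends [v] by vertical projection; [Y], [W] and [N] are phi X, psi X and omega X. *)
pose X y := v *m VP y; pose Y y := X y *m P y.
pose W y := Y y *m VP y; pose N y := Y y *m HP y.
have dX : derivable X x u by exact: derivable_mulmxl.
have dY : derivable Y x u by apply: derivable_mulmx.
have dW : derivable W x u by apply: derivable_mulmx.
have dN : derivable N x u by apply: derivable_mulmx.
have Xx : X x = v by exact: (vproj_id hL Ox).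
have Yx : Y x = v *m P x by rewrite /Y Xx.
have XJ y : O y -> X y *m J y = 0 by move=> Oy; exact: (vprojJ G L y v).
have WJ y : O y -> W y *m J y = 0 by move=> Oy; exact: (vprojJ G L y (Y y)).
have WNx : W x + N x = Y x by exact: (vproj_hproj hL Ox (Y x)).
have covY : cov G Y u x = cov G X u x *m P x.
  by rewrite /cov (dd_mulmx dX (@dP u)) (nabla_phi hS Ox) !(mulmxDl, mulmxDr, mulmxN, mulmxA);
     mxlin.
have covWN : cov G W u x + cov G N u x = cov G Y u x.
  have dYE : dd u Y x = dd u W x + dd u N x.
    rewrite -(ddD dW dN); apply: eq_open_dd oO _ Ox => y Oy.
    by rewrite -[LHS](vproj_hproj hL Oy).
  by rewrite /cov dYE -WNx; move: (W x) (N x) (dd u W x) (dd u N x) => *; mxlin.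
have N_hor w : w *m J x = 0 -> ip (G x) (N x) w = 0 by move=> wJ; exact: (hproj_hor G (Y x) wJ).
(* The vertical part [a] of nabla_u X depends on the extension; it has to cancel at the end. *)
have covX : exists2 a, a *m J x = 0 & cov G X u x = a + Tvert G L x u v.
  exists (cov G X u x *m VP x); first exact: vprojJ.
  rewrite -{1}(vproj_hproj hL Ox (cov G X u x)); congr (_ + _).
  apply: (Tvert_unique hL Ox); first by move=> w; exact: hproj_hor.
  by rewrite (hprojJ hL Ox) (vertical_covJ hL Ox XJ dX) Xx.
have [a aJ covXa] := covX.
(* [N] and [W] stay orthogonal, and the horizontal part of nabla_u W is T(u, W). *)
have NW : ip (G x) (cov G N u x) (W x) = - ip (G x) (N x) (Tvert G L x u (W x)).
  have : dd u (fun y => ip (G y) (N y) (W y)) x = 0.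
    rewrite -[RHS](dd_cst (0 : R) x u); apply: eq_open_dd oO _ Ox => y Oy.
    exact: (hproj_hor G (Y y) (WJ y Oy)).
  rewrite (dd_ip_cov hG Ox dN dW).
  have : ip (G x) (N x) (cov G W u x) = ip (G x) (N x) (Tvert G L x u (W x)).
    rewrite -{1}(vproj_hproj hL Ox (cov G W u x)) ipDr N_hor ?vprojJ // add0r.
    congr (ip _ _ _); apply: (Tvert_unique hL Ox); first by move=> w; exact: hproj_hor.
    by rewrite (hprojJ hL Ox) (vertical_covJ hL Ox WJ dW).
  by move: (cov G W u x) (cov G N u x) => b b' ->; lra.
have WW : ip (G x) (cov G W u x) (W x)
     = k * (ip (G x) a v - ip (G x) a (Z x) * ip (G x) v (Z x)).
  have : dd u (fun y => ip (G y) (W y) (W y)) x =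
      dd u (fun y => k * (ip (G y) (X y) (X y) - ip (G y) (X y) (Z y) * ip (G y) (X y) (Z y))) x.
    by apply: eq_open_dd oO _ Ox => y Oy; rewrite -expr2; exact: (slantP Oy (XJ y Oy)).
  have dG : derivable G x u by exact: ndiff_derivable (regular_diff hG) Ox.
  have dXX : derivable (fun y => ip (G y) (X y) (X y)) x u by apply: (@derivable_ip _ _ _ G X X).
  have dXZ : derivable (fun y => ip (G y) (X y) (Z y)) x u by apply: (@derivable_ip _ _ _ G X Z); last exact: dZ.
  have dXZ2 : derivable (fun y => ip (G y) (X y) (Z y) * ip (G y) (X y) (Z y)) x u.
    exact: derivableM.
  have dq := derivableB dXX dXZ2.
  rewrite (ddM (derivable_cst k x u) dq) dd_cst mulr0 addr0 (ddB dXX dXZ2) (ddM dXZ dXZ).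
  rewrite (dd_ip_cov hG Ox dW dW) (dd_ip_cov hG Ox dX dX) (dd_ip_cov hG Ox dX (@dZ u)).
  have covZ : cov G Z u x = 0 by rewrite /cov (nabla_xi hS Ox) addNr.
  have T1 : ip (G x) (Tvert G L x u v) v = 0 by exact: (Tvert_hor hL Ox).
  have T2 : ip (G x) (Tvert G L x u v) (Z x) = 0 by apply: (Tvert_hor hL Ox); exact: xiJ.
  rewrite (gC (W x)) covZ covXa; move: (cov G W u x) => cW.
  rewrite Xx ip0r addr0 (gC v (a + _)) !ipDl T1 T2 !addr0.
  rewrite /cst => h.
  lra.
have TW : ip (G x) (Tvert G L x u v *m P x) (W x) = - ip (G x) (Tvert G L x u v) (v *m P x *m VP x *m P x *m HP x).
  have Wx : W x = v *m P x *m VP x by rewrite /W Yx.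
  rewrite phi_skew Wx -{1}(vproj_hproj hL Ox (v *m P x *m VP x *m P x)) ipDr.
  by rewrite (Tvert_hor hL Ox) ?add0r //; exact: vprojJ.
have aW : ip (G x) (a *m P x) (W x) = k * (ip (G x) a v - ip (G x) a (Z x) * ip (G x) v (Z x)).
  have Wx : W x = v *m P x *m VP x by rewrite /W Yx.
  rewrite -(slant_polar aJ vJ) -Wx -{1}(vproj_hproj hL Ox (a *m P x)) ipDl.
  by rewrite hproj_hor ?addr0 // WJ.
have Wx : W x = v *m P x *m VP x by rewrite /W Yx.
have Nx : N x = v *m P x *m HP x by rewrite /N Yx.
(* The product g(nabla_u phi X, W) is computed from phi X = W + N and from phi being parallel; the
   terms in [a] agree by the polarized slant identity, and the T-terms remain. *)
have := congr1 (fun z => ip (G x) z (W x)) covWN.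
rewrite /= covY covXa; move: (cov G W u x) (cov G N u x) WW NW => cW cN WW NW.
rewrite mulmxDl !ipDl WW NW TW aW Nx Wx (gC (v *m P x *m HP x)).
by move=> /addrI /oppr_inj.
Qed.

End SlantSubmersion.

(** * Gauss equation of the fibres *)

(** [S] is the Jacobian of the immersion and [Da], [Db] its derivatives; [Ba], [Bb] are second
    fundamental forms with derivatives [Y], [X], and [Ca], [Cb] and [ga], [gb] the ambient and
    induced connections. The third hypothesis is the symmetry of second derivatives of [S], the next
    two are differentiated normality, which trades [X] and [Y] for products of second fundamental
    forms. *)
Lemma gauss_algebra (R : realType) k m (S Da Db Ba Bb X Y : 'M[R]_(k, m))
    (G Q Ca Cb : 'M[R]_m) (r ga gb : 'M[R]_k) :
  Da = ga *m S + Ba - S *m Ca -> Db = gb *m S + Bb - S *m Cb ->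
  Da *m Cb - Db *m Ca + S *m Q = r *m S + gb *m Da - ga *m Db + X - Y ->
  X *m G *m S^T + Bb *m (Ca *m G + G *m Ca^T) *m S^T + Bb *m G *m Da^T = 0 ->
  Y *m G *m S^T + Ba *m (Cb *m G + G *m Cb^T) *m S^T + Ba *m G *m Db^T = 0 ->
  Ba *m G *m S^T = 0 -> Bb *m G *m S^T = 0 ->
  S *m (Q + Cb *m Ca - Ca *m Cb) *m G *m S^T =
    (r + gb *m ga - ga *m gb) *m (S *m G *m S^T) - Bb *m G *m Ba^T + Ba *m G *m Bb^T.
Proof.
move=> DaE DbE H3 H4 H5 H6 H7.
have SQ : S *m Q = r *m S + gb *m Da - ga *m Db + X - Y - Da *m Cb + Db *m Ca.
  by rewrite -H3; mxlin.
have XE : X *m G *m S^T = - (Bb *m Ca *m G *m S^T) - Bb *m G *m Ba^T.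
  apply/eqP; rewrite -subr_eq0; apply/eqP; rewrite -[RHS]H4 DaE.
  rewrite !(trmxD, trmxN, trmx_mul, mulmxDl, mulmxDr, mulmxN, mulNmx, mulmxA).
  by rewrite H7 mul0mx add0r; mxlin.
have YE : Y *m G *m S^T = - (Ba *m Cb *m G *m S^T) - Ba *m G *m Bb^T.
  apply/eqP; rewrite -subr_eq0; apply/eqP; rewrite -[RHS]H5 DbE.
  rewrite !(trmxD, trmxN, trmx_mul, mulmxDl, mulmxDr, mulmxN, mulNmx, mulmxA).
  by rewrite H6 mul0mx add0r; mxlin.
have gB : gb *m Ba *m G *m S^T = 0 by rewrite -!mulmxA (mulmxA Ba) H6 mulmx0.
have gB' : ga *m Bb *m G *m S^T = 0 by rewrite -!mulmxA (mulmxA Bb) H7 mulmx0.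
rewrite !(mulmxDr, mulmxN) SQ DaE DbE !(mulmxDl, mulmxDr, mulmxN, mulNmx, mulmxA).
rewrite XE YE gB gB'.
by apply/matrixP => i j; rewrite !(mxDE, mxNE, mx0E); lra.
Qed.

Lemma gauss_contract (R : realType) k m (r hw : 'M[R]_k) (s Bu Bv : 'M[R]_(k, m))
    (Q g : 'M[R]_m) (u v : 'rV[R]_k) :
  s *m Q *m g *m s^T = r *m hw - Bv *m g *m Bu^T + Bu *m g *m Bv^T ->
  ip hw (v *m r) u =
    ip g (v *m s *m Q) (u *m s) + ip g (v *m Bv) (u *m Bu) - ip g (v *m Bu) (u *m Bv).
Proof.
move=> /(congr1 (fun M => (v *m M *m u^T) 0 0)).
rewrite !ipE !trmx_mul !(mulmxDl, mulmxDr, mulmxN, mulNmx) !(mxDE, mxNE) !mulmxA.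
by move=> ->; rewrite addrAC subrK addrK.
Qed.

(** Order 4 for [f] gives order 3 for its Jacobian [S], whose second derivatives have to commute in
    the Gauss equation. *)
Section Immersion.
Variables (R : realType) (k m n : nat) (O : set 'rV[R]_m) (W : set 'rV[R]_k).
Variables (G : 'rV[R]_m -> 'M[R]_m) (L : 'rV[R]_m -> 'rV[R]_n) (f : 'rV[R]_k -> 'rV[R]_m).
Hypotheses (hL : regular_submersion O G L) (oW : open W) (df : ndiff 4 W f).
Hypotheses (fO : forall w, W w -> O (f w)) (fS : forall w, W w -> row_free ('J f w)).
Hypotheses (kn : (k + n)%N = m) (fibre : forall w w', W w -> W w' -> L (f w) = L (f w')).
Let hG := rsub_metric hL.
Let oO : open O := regular_open hG.
Let S (w : 'rV[R]_k) : 'M[R]_(k, m) := 'J f w.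
Let h (w : 'rV[R]_k) : 'M[R]_k := S w *m G (f w) *m (S w)^T.

Let ddf w u : W w -> dd u f w = u *m S w.
Proof. by move=> Ww; rewrite -ddE deriveEjacobian //; exact: ndiff_differentiable df Ww. Qed.

Let dS : ndiff 3 W S.
Proof. exact: ndiff_jacobian oW df. Qed.

Let f_diff w : W w -> differentiable f w.
Proof. exact: ndiff_differentiable df. Qed.

Lemma dd_along l p (A : 'rV[R]_m -> 'M[R]_(l, p)) w u :
  W w -> differentiable A (f w) -> dd u (A \o f) w = dd (u *m S w) A (f w).
Proof. by move=> Ww dA; rewrite dd_comp ?ddf //; exact: f_diff. Qed.

Lemma ndiff_along l p q (A : 'rV[R]_m -> 'M[R]_(l, p)) :
  (q <= 3)%N -> ndiff q O A -> ndiff q W (A \o f).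
Proof.
move=> q3 dA; apply: (ndiff_comp oW fO) => //.
have : ndiff 3 W f by exact: ndiffS.
by case: q q3 {dA} => [|[|[|[|//]]]] _ d //; do ?[exact: d | apply: ndiffS].
Qed.

Lemma regular_induced : regular_metric W h.
Proof.
have dGf : ndiff 3 W (G \o f) by apply: ndiff_along => //; exact: regular_diff hG.
split=> // [|w Ww|w Ww v v0].
- exact: (ndiff_mulmx oW (ndiff_mulmx oW dS dGf) (ndiff_trmx oW dS)).
- by rewrite !trmx_mul trmxK (regular_sym hG (fO Ww)) mulmxA.
- have -> : ip (h w) v v = ip (G (f w)) (v *m S w) (v *m S w).
    by rewrite !ipE trmx_mul !mulmxA.
  apply: (regular_pos hG (fO Ww)); apply: contra_neq v0 => vS.
  by apply: (row_free_inj (fS Ww)); rewrite vS mul0mx.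
Qed.

Let hh := regular_induced.

Section AtPoint.
Variable w : 'rV[R]_k.
Hypothesis Ww : W w.

Let dSd u : derivable S w u.
Proof. exact: ndiff_derivable dS Ww. Qed.

Lemma ddS_sym u v : v *m dd u S w = u *m dd v S w.
Proof.
have E a b : b *m dd a S w = dd a (dd b f) w.
  rewrite -(dd_mulmxl _ (@dSd a)); apply: eq_open_dd oW _ Ww => y Wy.
  by rewrite ddf.
by rewrite !E; exact: schwarz_mx oW (ndiffS df) Ww.
Qed.

Lemma immersionJ (u : 'rV[R]_k) : u *m S w *m 'J L (f w) = 0.
Proof.
have dLf : differentiable L (f w).
  exact: ndiff_differentiable (rsub_diff hL) (fO Ww).
rewrite -[LHS]deriveEjacobian // ddE -dd_along // -[RHS](dd_cst (L (f w)) w u).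
by apply: eq_open_dd oW _ Ww => y Wy; exact: fibre.
Qed.

End AtPoint.

(* [v *m sff u w] is the second fundamental form of the immersion [f] at [(u, v)]. *)
Definition sff (u w : 'rV[R]_k) : 'M[R]_(k, m) :=
  dd u S w + S w *m Gam G (u *m S w) (f w) - Gam h u w *m S w.

Let dd_metric u w : W w -> dd u h w =
  (dd u S w + S w *m Gam G (u *m S w) (f w)) *m G (f w) *m (S w)^T
  + S w *m G (f w) *m (dd u S w + S w *m Gam G (u *m S w) (f w))^T.
Proof.
move=> Ww; have dSu : derivable S w u by exact: ndiff_derivable dS Ww.
have dGf : differentiable G (f w).
  exact: ndiff_differentiable (regular_diff hG) (fO Ww).
have dGfu : derivable (G \o f) w u.
  by apply: diff_derivable; apply: differentiable_comp => //; exact: f_diff.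
have dSG : derivable (fun y => S y *m (G \o f) y) w u by exact: derivable_mulmx.
have dSt : derivable (fun y => (S y)^T) w u by exact: derivable_trmx.
rewrite [LHS](dd_mulmx dSG dSt) (dd_mulmx dSu dGfu) (dd_trmx dSu) dd_along //.
rewrite (metric_compat hG _ (fO Ww)) /=.
move: (Gam _ _ _) (dd u S w) => g D.
by rewrite !(trmxD, trmx_mul, mulmxDl, mulmxDr, mulmxA); mxlin.
Qed.

(** The induced connection is the tangential part of the ambient one: the derivative of [h] is [C]
    plus its transpose with [C] symmetric in its two directions, so the Koszul formula of [h]
    returns [C]. *)
Lemma sff_normal u w : W w -> sff u w *m G (f w) *m (S w)^T = 0.
Proof.
move=> Ww; pose C a := (dd a S w + S w *m Gam G (a *m S w) (f w)) *m G (f w) *m (S w)^T.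
have Csym a b : b *m C a = a *m C b.
  rewrite /C !mulmxA !mulmxDr !mulmxA (ddS_sym Ww a b).
  by rewrite (GamC hG _ _ (fO Ww)).
have dh a : dd a h w = C a + (C a)^T.
  by rewrite dd_metric // {2}/C !trmx_mul trmxK (regular_sym hG (fO Ww)) mulmxA.
have Chr a b c : ip (h w) (b *m Gam h a w) c = ip (C a) b c.
  have := koszul hh a b c Ww; rewrite -(mul_Gam hh a b Ww) !dh.
  have ipT a' b' c' : ip (C a' + (C a')^T) b' c' = ip (C a') b' c' + ip (C a') c' b'.
    by rewrite (ip_tr (C a') c') !ipE mulmxDr mulmxDl mxDE.
  have ipC' a' b' c' : ip (C a') b' c' = ip (C b') a' c' by rewrite !ipE Csym.
  rewrite !ipT (ipC' b a c) (ipC' b c a) (ipC' c a b) (ipC' c b a).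
  by move=> H; lra.
have CE : C u = Gam h u w *m h w.
  apply/row_matrixP => i; rewrite !rowE; apply/rowP => j.
  have := Chr u (delta_mx 0 i) (delta_mx 0 j).
  have e (r : 'rV[R]_k) : (r *m (delta_mx 0 j : 'rV[R]_k)^T) 0 0 = r 0 j.
    by rewrite trmx_delta -colE mxE.
  by rewrite !ipE !e -mulmxA.
by rewrite /sff !mulmxBl -[X in X - _ = _]/(C u) CE /h !mulmxA subrr.
Qed.

(** Both sides are horizontal, because by the dimension count the tangent space of the immersion is
    the whole vertical space; they have the same image under [J], by differentiating
    [S w *m 'J L (f w) = 0]. *)
Lemma sff_Tvert u v w : W w -> v *m sff u w = Tvert G L (f w) (u *m S w) (v *m S w).
Proof.
move=> Ww; have Ox := fO Ww.
have dSu : derivable S w u by exact: ndiff_derivable dS Ww.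
have dJ : differentiable (fun y => 'J L y) (f w).
  exact: ndiff_differentiable (ndiff_J hL) Ox.
have SJ0 : S w *m 'J L (f w) = 0.
  by apply/row_matrixP => i; rewrite row0 !rowE mulmxA immersionJ.
apply: (Tvert_unique hL Ox) => [z zJ|].
  have : (z <= S w)%MS.
    have zK : (z <= kermx ('J L (f w)))%MS by exact/sub_kermxP.
    have SK : (S w <= kermx ('J L (f w)))%MS by exact/sub_kermxP.
    apply: (submx_trans zK); rewrite -(geq_leqif (mxrank_leqif_sup SK)).
    by rewrite mxrank_ker (rsub_rank hL Ox) (eqP (fS Ww)) leq_subLR addnC kn.
  move=> /submxP[d ->]; rewrite ipE trmx_mul !mulmxA -(mulmxA _ (sff u w)) -(mulmxA _ _ (S w)^T).
  by rewrite sff_normal // mulmx0 mul0mx mx0E.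
have D : dd u S w *m 'J L (f w) = - (S w *m dd (u *m S w) (fun y => 'J L y) (f w)).
  have dJf : derivable ((fun y => 'J L y) \o f) w u.
    by apply: diff_derivable; apply: differentiable_comp => //; exact: f_diff.
  have := dd_mulmx dSu dJf; rewrite dd_along //= => E.
  apply/eqP; rewrite -addr_eq0; apply/eqP; rewrite -[LHS]E.
  rewrite -[RHS](dd_cst (0 : 'M[R]_(k, n)) w u); apply: eq_open_dd oW _ Ww => y Wy.
  by apply/row_matrixP => i; rewrite row0 !rowE mulmxA immersionJ.
rewrite /Timage /sff mulmxDr mulmxN mulmxDr !mulmxDl mulNmx -!(mulmxA v) D -!(mulmxA _ (S w)) SJ0.
by rewrite !mulmx0 subr0 mulmxN addrC !mulmxA.
Qed.

(** The direction fed to [Gam] varies with the point too. The symmetry [GamC] moves it to the left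
    of a matrix with fixed direction, where the product rule applies. *)
Lemma dd_Gam_along u (X : 'rV[R]_k -> 'rV[R]_m) w :
  W w -> ndiff 1 W X ->
  derivable (fun y => Gam G (X y) (f y)) w u /\
  dd u (fun y => Gam G (X y) (f y)) w =
    Gam G (dd u X w) (f w) + dd (u *m S w) (Gam G (X w)) (f w).
Proof.
move=> Ww dX; have Ox := fO Ww.
have dXw : derivable X w u by exact: ndiff_derivable dX Ww.
have dG c : differentiable (Gam G c) (f w) by exact: ndiff_differentiable (ndiff_Gam hG c) Ox.
have dGf c : derivable (Gam G c \o f) w u.
  by apply: diff_derivable; apply: differentiable_comp => //; exact: f_diff.
have dG1 c : ndiff 1 W (Gam G c \o f) by apply: ndiff_along => //; exact: ndiff_Gam.
have nd : ndiff 1 W (fun y => Gam G (X y) (f y)).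
  apply: ndiff_mx => // i j.
  apply: (@eq_ndiff _ _ _ _ _ (fun y => (X y *m (Gam G (delta_mx 0 i) \o f) y) 0 j)) => //.
    by move=> y Wy /=; rewrite -(GamC hG _ _ (fO Wy)) -rowE mxE.
  exact: (ndiff_entry 0 j oW (ndiff_mulmx oW dX (dG1 _))).
have dGX : derivable (fun y => Gam G (X y) (f y)) w u by exact: ndiff_derivable nd Ww.
split=> //; apply/row_matrixP => i; rewrite !rowE; set c := delta_mx 0 i.
rewrite -(dd_mulmxl _ dGX) mulmxDr.
have -> : dd u (fun y => c *m Gam G (X y) (f y)) w = dd u (fun y => X y *m (Gam G c \o f) y) w.
  by apply: eq_open_dd oW _ Ww => y Wy /=; exact: (GamC hG _ _ (fO Wy)).
rewrite (dd_mulmx dXw (@dGf c)) dd_along //= (GamC hG _ c Ox); congr (_ + _).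
by apply/esym; exact: (dd_GamC hG).
Qed.

Lemma gauss u v w : W w ->
  S w *m Rm G (u *m S w) (v *m S w) (f w) *m G (f w) *m (S w)^T =
  Rm h u v w *m h w - sff v w *m G (f w) *m (sff u w)^T + sff u w *m G (f w) *m (sff v w)^T.
Proof.
move=> Ww; have Ox := fO Ww.
have dSu a : derivable S w a by exact: ndiff_derivable dS Ww.
have dXS (a : 'rV[R]_k) : ndiff 2 W (fun y => a *m S y).
  by apply: ndiff_mulmx => //; [exact: ndiff_cst | exact: ndiffS dS].
have GA (a b : 'rV[R]_k) := dd_Gam_along b Ww (ndiffS (dXS a)).
have dGA (a b : 'rV[R]_k) : derivable (fun y => Gam G (a *m S y) (f y)) w b by case: (GA a b).
have ddGA (a b : 'rV[R]_k) : dd b (fun y => Gam G (a *m S y) (f y)) w =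
    Gam G (a *m dd b S w) (f w) + dd (b *m S w) (Gam G (a *m S w)) (f w).
  by case: (GA a b) => _ ->; rewrite (dd_mulmxl _ (@dSu b)).
have dga a b : derivable (Gam h a) w b by exact: (derivable_Gam hh).
have dddS a b : derivable (dd a S) w b by exact: ndiff_derivable (ndiff_dd a dS) Ww.
have dSG (a b : 'rV[R]_k) : derivable (fun y => S y *m Gam G (a *m S y) (f y)) w b by exact: derivable_mulmx.
have dgS a b : derivable (fun y => Gam h a y *m S y) w b by exact: derivable_mulmx.
have dsff a b : derivable (sff a) w b by apply: derivableB => //; exact: derivableD.
have ddsff (a b : 'rV[R]_k) : dd b (sff a) w =
   dd b (dd a S) w + (dd b S w *m Gam G (a *m S w) (f w)
     + S w *m (Gam G (a *m dd b S w) (f w) + dd (b *m S w) (Gam G (a *m S w)) (f w)))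
   - (dd b (Gam h a) w *m S w + Gam h a w *m dd b S w).
  rewrite (ddB (derivableD (@dddS a b) (@dSG a b)) (@dgS a b)) (ddD (@dddS a b) (@dSG a b)).
  by rewrite (dd_mulmx (@dSu b) (@dGA a b)) ddGA (dd_mulmx (@dga a b) (@dSu b)).
have sffE (a : 'rV[R]_k) : dd a S w = Gam h a w *m S w + sff a w - S w *m Gam G (a *m S w) (f w).
  by rewrite /sff; mxlin.
have dGf b : derivable (G \o f) w b.
  apply: diff_derivable; apply: differentiable_comp; first exact: f_diff.
  exact: ndiff_differentiable (regular_diff hG) Ox.
have norm (a b : 'rV[R]_k) : dd b (sff a) w *m G (f w) *m (S w)^T
    + sff a w *m (Gam G (b *m S w) (f w) *m G (f w) + G (f w) *m (Gam G (b *m S w) (f w))^T) *m (S w)^T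
    + sff a w *m G (f w) *m (dd b S w)^T = 0.
  have dsG : derivable (fun y => sff a y *m (G \o f) y) w b by exact: derivable_mulmx.
  have dSt : derivable (fun y => (S y)^T) w b by apply: derivable_trmx; exact: dSu.
  have zero : dd b (fun y => sff a y *m (G \o f) y *m (S y)^T) w = 0.
    rewrite -[RHS](dd_cst (0 : 'M[R]_k) w b); apply: eq_open_dd oW _ Ww => y Wy.
    exact: sff_normal.
  have := etrans (esym (dd_mulmx dsG dSt)) zero.
  rewrite (dd_mulmx (@dsff a b) (@dGf b)) (dd_trmx (@dSu b)).
  rewrite dd_along //; last exact: ndiff_differentiable (regular_diff hG) Ox.
  by rewrite (metric_compat hG _ Ox) /= mulmxDl.
apply: (gauss_algebra (sffE u) (sffE v) _ (norm v u) (norm u v) (sff_normal u Ww) (sff_normal v Ww)).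
have sym := schwarz_mx u v oW dS Ww.
rewrite !ddsff sym (ddS_sym Ww u v).
move: (dd v (dd u S) w) (dd u S w) (dd v S w) (Gam G _ _) => *.
by mxlin.
Qed.

Lemma gauss_sectional u v w : W w ->
  ip (h w) (v *m Rm h u v w) u =
    ip (G (f w)) (v *m S w *m Rm G (u *m S w) (v *m S w) (f w)) (u *m S w)
    + ip (G (f w)) (v *m sff v w) (u *m sff u w)
    - ip (G (f w)) (v *m sff u w) (u *m sff v w).
Proof.
by move=> Ww; exact: gauss_contract (gauss u v Ww).
Qed.

End Immersion.

(** * The inequality at a point *)

Section Orthonormal.
Variables (R : realType) (m k : nat) (G : 'M[R]_m).
Hypotheses (Gs : G^T = G).

Lemma orthonormal_expand q (A : 'M[R]_(q, m)) (e : 'I_k -> 'rV[R]_m) v :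
  \rank A = k -> orthonormal_family G e -> (forall i, (e i <= A)%MS) -> (v <= A)%MS ->
  v = \sum_i ip G v (e i) *: e i.
Proof.
move=> rA eG eA vA; pose E : 'M[R]_(k, m) := \matrix_i e i.
have EG : E *m G *m E^T = 1%:M.
  apply/matrixP => i j; rewrite [RHS]mxE -eG ipE.
  rewrite -[e i](rowK e) -[e j](rowK e) -/E.
  by rewrite tr_row -row_mul -row_mul colE mulmxA -colE !mxE.
have Ef : row_free E.
  by apply/row_freeP; exists (G *m E^T); rewrite mulmxA.
have EA : (E <= A)%MS by apply/row_subP => i; rewrite rowK.
have AE : (A <= E)%MS.
  by rewrite -(geq_leqif (mxrank_leqif_sup EA)) rA (eqP Ef).
have /submxP[d dE] := submx_trans vA AE.
have di i : ip G v (e i) = d 0 i.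
  rewrite ipE dE -(mulmxA d) -(mulmxA d).
  have -> : E *m G *m (e i)^T = col i (1%:M : 'M[R]_k).
    by rewrite -EG -[e i](rowK e) -/E tr_row !colE !mulmxA.
  by rewrite colE mulmxA mulmx1 -colE mxE.
rewrite {1}dE mulmx_sum_row; apply: eq_bigr => i _.
by rewrite di rowK.
Qed.

(** Invariance of the trace of a bilinear form; it carries the mean curvature and the scalar
    curvature from the given frames to a slant one. *)
Lemma trace_change q (A : 'M[R]_(q, m)) (e f : 'I_k -> 'rV[R]_m)
    (b : 'rV[R]_m -> 'rV[R]_m -> R) :
  \rank A = k -> orthonormal_family G e -> orthonormal_family G f ->
  (forall i, (e i <= A)%MS) -> (forall i, (f i <= A)%MS) ->
  (forall a u v w, b (a *: u + v) w = a * b u w + b v w) ->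
  (forall a u v w, b w (a *: u + v) = a * b w u + b w v) ->
  \sum_i b (f i) (f i) = \sum_i b (e i) (e i).
Proof.
move=> rA eG fG eA fA bl br.
have b0l w : b 0 w = 0 by have := bl (-1) 0 0 w; rewrite scaler0 addr0 => H; lra.
have b0r w : b w 0 = 0 by have := br (-1) 0 0 w; rewrite scaler0 addr0 => H; lra.
have bsl (c : 'I_k -> R) g w : b (\sum_i c i *: g i) w = \sum_i c i * b (g i) w.
  by elim/big_rec2: _ => [|i y1 y2 _ <-]; rewrite ?b0l ?bl.
have bsr (c : 'I_k -> R) g w : b w (\sum_i c i *: g i) = \sum_i c i * b w (g i).
  by elim/big_rec2: _ => [|i y1 y2 _ <-]; rewrite ?b0r ?br.
under eq_bigr => i _ do rewrite {1}(orthonormal_expand rA eG eA (fA i)) bsl.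
rewrite exchange_big /=; apply: eq_bigr => j _.
transitivity (b (e j) (\sum_i ip G (e j) (f i) *: f i)).
  by rewrite bsr; apply: eq_bigr => i _; rewrite (ipC _ _ Gs).
by rewrite -(orthonormal_expand rA fG fA (eA j)).
Qed.

End Orthonormal.

Lemma orthonormal3 (R : realType) m (G : 'M[R]_m) (e1 e2 e3 : 'rV[R]_m) : G^T = G ->
  ip G e1 e1 = 1 -> ip G e2 e2 = 1 -> ip G e3 e3 = 1 ->
  ip G e1 e2 = 0 -> ip G e1 e3 = 0 -> ip G e2 e3 = 0 ->
  orthonormal_family G (tnth [tuple e1; e2; e3]).
Proof.
move=> Gs e11 e22 e33 e12 e13 e23.
have e21 := e12; have e31 := e13; have e32 := e23.
rewrite (ipC _ _ Gs) in e21; rewrite (ipC _ _ Gs) in e31; rewrite (ipC _ _ Gs) in e32.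
by move=> [[|[|[|//]]] ?] [[|[|[|//]]] ?]; rewrite !(tnth_nth 0).
Qed.

Lemma orthonormal5 (R : realType) m (G : 'M[R]_m) (e1 e2 e3 e4 e5 : 'rV[R]_m) :
  G^T = G -> orthonormal_family G (tnth [tuple e1; e2; e3]) ->
  ip G e4 e4 = 1 -> ip G e5 e5 = 1 -> ip G e4 e5 = 0 ->
  ip G e4 e1 = 0 -> ip G e4 e2 = 0 -> ip G e4 e3 = 0 ->
  ip G e5 e1 = 0 -> ip G e5 e2 = 0 -> ip G e5 e3 = 0 ->
  orthonormal_family G (tnth [tuple e1; e2; e3; e4; e5]).
Proof.
move=> Gs o3 e44 e55 e45 e41 e42 e43 e51 e52 e53.
have o (i j : 'I_3) := o3 i j.
pose i1 : 'I_3 := ord0; pose i2 : 'I_3 := Ordinal (isT : 1 < 3)%N; pose i3 : 'I_3 := Ordinal (isT : 2 < 3)%N.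
have e11 := o i1 i1; have e12 := o i1 i2; have e13 := o i1 i3; have e21 := o i2 i1.
have e22 := o i2 i2; have e23 := o i2 i3; have e31 := o i3 i1; have e32 := o i3 i2; have e33 := o i3 i3.
rewrite !(tnth_nth 0) /= in e11 e12 e13 e21 e22 e23 e31 e32 e33.
have e14 : ip G e1 e4 = 0 by rewrite (ipC _ _ Gs).
have e24 : ip G e2 e4 = 0 by rewrite (ipC _ _ Gs).
have e34 : ip G e3 e4 = 0 by rewrite (ipC _ _ Gs).
have e15 : ip G e1 e5 = 0 by rewrite (ipC _ _ Gs).
have e25 : ip G e2 e5 = 0 by rewrite (ipC _ _ Gs).
have e35 : ip G e3 e5 = 0 by rewrite (ipC _ _ Gs).
have e54 : ip G e5 e4 = 0 by rewrite (ipC _ _ Gs).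
by move=> [[|[|[|[|[|//]]]]] ?] [[|[|[|[|[|//]]]]] ?]; rewrite !(tnth_nth 0).
Qed.

(** Linear algebra in one tangent space: [c0] and [s0] are the cosine and sine of the slant angle,
    and [K] and [T] are known through their symmetries alone. *)
Section SlantPointwise.
Variables (R : realType) (G P VP HP : 'M[R]_5) (J : 'M[R]_(5, 2)) (Z : 'rV[R]_5).
Variables (T : 'rV[R]_5 -> 'rV[R]_5 -> 'rV[R]_5).
Variables (K : 'rV[R]_5 -> 'rV[R]_5 -> 'rV[R]_5 -> 'rV[R]_5 -> R) (c0 s0 c : R).
Implicit Types u v w : 'rV[R]_5.
Hypotheses (Gs : G^T = G) (Gp : posdef G) (rJ : \rank J = 2)
  (split : forall v, v *m VP + v *m HP = v) (VPJ : forall v, v *m VP *m J = 0)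
  (HPhor : forall v w, w *m J = 0 -> ip G (v *m HP) w = 0)
  (VPid : forall v, v *m J = 0 -> v *m VP = v)
  (skewP : forall u v, ip G (u *m P) v = - ip G u (v *m P))
  (ZP : Z *m P = 0) (ZZ : ip G Z Z = 1) (ZJ : Z *m J = 0)
  (PP : forall u v, ip G (u *m P) (v *m P) = ip G u v - ip G u Z * ip G v Z)
  (c_gt0 : 0 < c0) (s_gt0 : 0 < s0) (cs : c0 ^+ 2 + s0 ^+ 2 = 1)
  (slantP : forall u v, u *m J = 0 -> v *m J = 0 ->
     ip G (u *m P *m VP) (v *m P *m VP) = c0 ^+ 2 * (ip G u v - ip G u Z * ip G v Z))
  (TC : forall u v, T u v = T v u)
  (Tr : forall a u v w, T w (a *: u + v) = a *: T w u + T w v)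
  (Thor : forall u v w, w *m J = 0 -> ip G (T u v) w = 0)
  (TZ : forall u, T u Z = 0)
  (Tslant : forall u v, u *m J = 0 -> v *m J = 0 ->
     ip G (T u (v *m P *m VP)) (v *m P *m HP) = ip G (T u v) (v *m P *m VP *m P *m HP))
  (Kl : forall a u u' v w z, K (a *: u + u') v w z = a * K u v w z + K u' v w z)
  (Kr : forall a u v w z z', K u v w (a *: z + z') = a * K u v w z + K u v w z')
  (K12 : forall u v w z, K u v w z = - K v u w z)
  (K34 : forall u v w z, K u v w z = - K u v z w)
  (KZ : forall u v z, K u v Z z = 0)
  (Ksec : forall u v, ip G u Z = 0 -> ip G v Z = 0 ->
     K u v v u = c / 4 * (ip G u u * ip G v v - ip G u v ^+ 2 + 3 * ip G u (v *m P) ^+ 2)).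

Let gC u v : ip G u v = ip G v u. Proof. exact: ipC. Qed.
Let psi u := u *m P *m VP.
Let omega u := u *m P *m HP.

Definition slant_frame (e1 e2 e3 e4 e5 : 'rV[R]_5) :=
  [/\ orthonormal_family G (tnth [tuple e1; e2; e3; e4; e5]), e1 *m J = 0,
      e2 = c0^-1 *: psi e1, e3 = Z & e4 = s0^-1 *: omega e1 /\ e5 = s0^-1 *: omega e2].

(* The Gauss term: the curvature of the fibre in terms of [K] and [T]. *)
Let A u v w z := K u v w z + ip G (T v w) (T u z) - ip G (T u w) (T v z).

Let Tl a u v w : T (a *: u + v) w = a *: T u w + T v w.
Proof. by rewrite TC Tr !(TC w). Qed.

Let cn0 : c0 != 0. Proof. by rewrite gt_eqF. Qed.
Let sn0 : s0 != 0. Proof. by rewrite gt_eqF. Qed.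

Lemma psi_omega u v : ip G (psi u) (omega v) = 0.
Proof. by rewrite gC; apply: HPhor; exact: VPJ. Qed.

(** phi u splits orthogonally into psi u and omega u, so the slant identity for psi leaves the
    factor 1 - cos^2 for omega. *)
Lemma omega_omega u v : u *m J = 0 -> v *m J = 0 ->
  ip G (omega u) (omega v) = s0 ^+ 2 * (ip G u v - ip G u Z * ip G v Z).
Proof.
move=> uJ vJ; have := PP u v; rewrite -{1}(split (u *m P)) -{1}(split (v *m P)).
rewrite -/(psi u) -/(psi v) -/(omega u) -/(omega v) ipDl !ipDr psi_omega.
rewrite [ip G (omega u) (psi v)]gC psi_omega slantP // addr0 add0r => H.
have -> : s0 ^+ 2 = 1 - c0 ^+ 2 by rewrite -cs; ring.
lra.
Qed.

Lemma slant_frame_exists e1 : e1 *m J = 0 -> ip G e1 e1 = 1 -> ip G e1 Z = 0 ->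
  slant_frame e1 (c0^-1 *: psi e1) Z (s0^-1 *: omega e1) (s0^-1 *: omega (c0^-1 *: psi e1)).
Proof.
move=> e1J e11 e1Z; set e2 := _ *: psi e1; set e4 := _ *: omega e1; set e5 := _ *: omega e2.
have e2J : e2 *m J = 0 by rewrite -scalemxAl VPJ scaler0.
have psiv u v : v *m J = 0 -> ip G (psi u) v = ip G (u *m P) v.
  by move=> vJ; rewrite -[u *m P in RHS]split ipDl HPhor ?addr0.
have e22 : ip G e2 e2 = 1.
  by rewrite ipZl ipZr slantP // e11 e1Z; field.
have e12 : ip G e1 e2 = 0.
  rewrite ipZr gC psiv //; have := skewP e1 e1; rewrite (gC e1 (e1 *m P)) => H.
  have -> : ip G (e1 *m P) e1 = 0 by lra.
  exact: mulr0.
have e2Z : ip G e2 Z = 0 by rewrite ipZl psiv // skewP ZP ip0r oppr0 mulr0.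
have hv u v : v *m J = 0 -> ip G (s0^-1 *: omega u) v = 0.
  by move=> vJ; rewrite ipZl HPhor ?mulr0.
split=> //; apply: orthonormal5 => //; try exact: hv.
- by apply: orthonormal3.
- by rewrite ipZl ipZr omega_omega // e11 e1Z; field.
- by rewrite ipZl ipZr omega_omega // e22 e2Z; field.
- by rewrite ipZl ipZr omega_omega // e12 e1Z; field.
Qed.

Section Frame.
Variables e1 e2 e3 e4 e5 : 'rV[R]_5.
Hypothesis he : slant_frame e1 e2 e3 e4 e5.

Let i1 : 'I_5 := ord0.
Let i2 : 'I_5 := Ordinal (isT : 1 < 5)%N.
Let i3 : 'I_5 := Ordinal (isT : 2 < 5)%N.
Let i4 : 'I_5 := Ordinal (isT : 3 < 5)%N.
Let i5 : 'I_5 := Ordinal (isT : 4 < 5)%N.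
Let ee : orthonormal_family G (tnth [tuple e1; e2; e3; e4; e5]). Proof. by case: he. Qed.
Let e11 : ip G e1 e1 = 1. Proof. by have := ee i1 i1; rewrite !(tnth_nth 0). Qed.
Let e22 : ip G e2 e2 = 1. Proof. by have := ee i2 i2; rewrite !(tnth_nth 0). Qed.
Let e44 : ip G e4 e4 = 1. Proof. by have := ee i4 i4; rewrite !(tnth_nth 0). Qed.
Let e55 : ip G e5 e5 = 1. Proof. by have := ee i5 i5; rewrite !(tnth_nth 0). Qed.
Let e12 : ip G e1 e2 = 0. Proof. by have := ee i1 i2; rewrite !(tnth_nth 0). Qed.
Let e13 : ip G e1 e3 = 0. Proof. by have := ee i1 i3; rewrite !(tnth_nth 0). Qed.
Let e23 : ip G e2 e3 = 0. Proof. by have := ee i2 i3; rewrite !(tnth_nth 0). Qed.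
Let e45 : ip G e4 e5 = 0. Proof. by have := ee i4 i5; rewrite !(tnth_nth 0). Qed.
Let e1J : e1 *m J = 0. Proof. by case: he. Qed.
Let e3Z : e3 = Z. Proof. by case: he. Qed.
Let psi1 : psi e1 = c0 *: e2.
Proof. by case: he => _ _ -> _ _; rewrite scalerA mulfV // scale1r. Qed.
Let e2J : e2 *m J = 0.
Proof. by case: he => _ _ -> _ _; rewrite -scalemxAl VPJ scaler0. Qed.
Let om1 : omega e1 = s0 *: e4.
Proof. by case: he => _ _ _ _ [-> _]; rewrite scalerA mulfV // scale1r. Qed.
Let om2 : omega e2 = s0 *: e5.
Proof. by case: he => _ _ _ _ [_ ->]; rewrite scalerA mulfV // scale1r. Qed.

Lemma hor_expand v w : (forall z, z *m J = 0 -> ip G v z = 0) ->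
  ip G v w = ip G v e4 * ip G w e4 + ip G v e5 * ip G w e5.
Proof.
move=> vh.
have r1 : \rank (1%:M : 'M[R]_5) = 5 by rewrite mxrank1.
have s1 (z : 'rV[R]_5) : (z <= (1%:M : 'M[R]_5))%MS by exact: submx1.
rewrite {1}(orthonormal_expand r1 ee (fun=> s1 _) (s1 w)) ip_sumr.
rewrite !big_ord_recl big_ord0 !ipZr !(tnth_nth 0) /=.
rewrite !(vh e1) // !(vh e2) // !(vh e3) ?e3Z //; ring.
Qed.

Let TT u v u' v' : ip G (T u v) (T u' v') =
  ip G (T u v) e4 * ip G (T u' v') e4 + ip G (T u v) e5 * ip G (T u' v') e5.
Proof. by apply: hor_expand => z; exact: Thor. Qed.

(** [Tslant] at [e1]: both sides carry the factor [c0 * s0], cancelled because the slant is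
    proper. *)
Lemma T_frame_sym u : u *m J = 0 -> ip G (T u e2) e4 = ip G (T u e1) e5.
Proof.
move=> uJ; have := Tslant uJ e1J; rewrite -/(psi e1) -/(omega e1) -/(omega (psi e1)) psi1.
have -> : omega (c0 *: e2) = c0 *: omega e2 by rewrite /omega -!scalemxAl.
rewrite om1 om2.
have T0 : T u 0 = 0 by have := Tr (-1) 0 0 u; rewrite scaler0 addr0 scaleN1r addNr.
have -> : T u (c0 *: e2) = c0 *: T u e2 by have := Tr c0 e2 0 u; rewrite T0 !addr0.
rewrite ipZl !ipZr => H.
apply: (mulfI sn0); apply: (mulfI cn0); rewrite -H; ring.
Qed.

Let vv : forall i, (tnth [tuple e1; e2; e3] i <= kermx J)%MS.
Proof. by move=> [[|[|[|//]]] ?]; rewrite (tnth_nth 0); apply/sub_kermxP; rewrite //= e3Z. Qed.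

Let rK : \rank (kermx J) = 3. Proof. by rewrite mxrank_ker rJ. Qed.

Let o3 : orthonormal_family G (tnth [tuple e1; e2; e3]).
Proof. by apply: orthonormal3; rewrite // e3Z. Qed.

(** The independent components of [T]: those involving xi vanish and [T_frame_sym] identifies T^5_11
    with [ga] and T^5_12 with [be]. *)
Let al := ip G (T e1 e1) e4.
Let be := ip G (T e2 e2) e4.
Let ga := ip G (T e1 e2) e4.
Let de := ip G (T e2 e2) e5.

Let ga5 : ip G (T e1 e1) e5 = ga. Proof. by rewrite -T_frame_sym. Qed.
Let be5 : ip G (T e1 e2) e5 = be. Proof. by rewrite /be T_frame_sym // TC. Qed.

Lemma mean_curvature_frame (U : 'I_3 -> 'rV[R]_5) w :
  orthonormal_family G U -> (forall i, (U i <= kermx J)%MS) ->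
  ip G (3%:R^-1 *: \sum_(j < 3) T (U j) (U j)) w
  = 3^-1 * (ip G (T e1 e1) w + ip G (T e2 e2) w).
Proof.
move=> oU vU; rewrite ipZl ip_suml; congr (_ * _).
rewrite (trace_change Gs (b := fun u v => ip G (T u v) w) rK o3 oU vv vU); last 2 first.
- by move=> *; rewrite Tl ipDl ipZl.
- by move=> *; rewrite Tr ipDl ipZl.
rewrite !big_ord_recl big_ord0 !(tnth_nth 0) /= e3Z TZ ip0l; ring.
Qed.

Lemma norm_mean_curvature_frame (U : 'I_3 -> 'rV[R]_5) :
  orthonormal_family G U -> (forall i, (U i <= kermx J)%MS) ->
  let H := 3%:R^-1 *: \sum_(j < 3) T (U j) (U j) in
  9 * ip G H H = (al + be) ^+ 2 + (ga + de) ^+ 2.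
Proof.
move=> oU vU H; have HE := mean_curvature_frame _ oU vU.
rewrite HE !(gC (T _ _) H) !HE.
rewrite !TT.
by rewrite -/al -/be ga5 -/de; field.
Qed.

Lemma fibre_curvature_frame (f : 'I_3 -> 'rV[R]_5) :
  orthonormal_family G f -> (forall i, (f i <= kermx J)%MS) ->
  \sum_(i < 3) \sum_(j < 3 | (i < j)%N) A (f i) (f j) (f j) (f i)
  = c / 4 * (1 + 3 * c0 ^+ 2) + al * be + ga * de - ga ^+ 2 - be ^+ 2.
Proof.
move=> of_ vf.
have Asym u v : A u v v u = A v u u v.
  by rewrite /A (K12 v u u v) (K34 u v u v) opprK (gC (T v v)) (TC u v); lra.
have Aself u : A u u u u = 0.
  by rewrite /A; have := K12 u u u u; lra.
(* A sum over i < j is not a trace; its double is the full sum, as [A] is symmetric in the pair and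
   zero on the diagonal. *)
have D3 (g : 'I_3 -> 'rV[R]_5) : 2 * (\sum_(i < 3) \sum_(j < 3 | (i < j)%N) A (g i) (g j) (g j) (g i))
   = \sum_(i < 3) \sum_(j < 3) A (g i) (g j) (g j) (g i).
  under eq_bigr do rewrite big_mkcond.
  rewrite !big_ord_recl !big_ord0 /= !Aself.
  rewrite (Asym (g (lift ord0 ord0)) (g ord0)) (Asym (g (lift ord0 (lift ord0 ord0))) (g ord0)).
  rewrite (Asym (g (lift ord0 (lift ord0 ord0))) (g (lift ord0 ord0))); ring.
have K2l a u u' v w z : K v (a *: u + u') w z = a * K v u w z + K v u' w z.
  by rewrite K12 Kl (K12 v u) (K12 v u'); ring.
have K3l a u v w w' z : K u v (a *: w + w') z = a * K u v w z + K u v w' z.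
  by rewrite K34 Kr (K34 u v w z) (K34 u v w' z); ring.
(* The frame is changed in one index at a time, the vector of the other index being held fixed. *)
have inv : \sum_(i < 3) \sum_(j < 3) A (f i) (f j) (f j) (f i) =
    \sum_(i < 3) \sum_(j < 3) A (tnth [tuple e1; e2; e3] i) (tnth [tuple e1; e2; e3] j)
       (tnth [tuple e1; e2; e3] j) (tnth [tuple e1; e2; e3] i).
  rewrite exchange_big.
  under eq_bigr => j _.
    rewrite (trace_change Gs (b := fun u v => A u (f j) (f j) v) rK o3 of_ vv vf); last 2 first.
    - by move=> *; rewrite /A Kl !Tl !ipDr !ipDl !ipZl !ipZr; ring.
    - by move=> *; rewrite /A Kr !Tr !ipDr !ipZr; ring.
    over.
  rewrite exchange_big; apply: eq_bigr => i _ /=.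
  set e := tnth _ i.
  rewrite (trace_change Gs (b := fun u v => A e u v e) rK o3 of_ vv vf) //.
  - by move=> *; rewrite /A K2l !Tl !ipDr !ipDl !ipZl !ipZr; ring.
  - by move=> *; rewrite /A K3l !Tr !ipDl !ipZl; ring.
have AZ u : A u Z Z u = 0 by rewrite /A KZ !TZ !ip0l; ring.
have two0 : (2 : R) != 0 by rewrite pnatr_eq0.
apply: (mulfI two0); rewrite D3 inv -D3; congr (_ * _).
under eq_bigr do rewrite big_mkcond.
rewrite !big_ord_recl !big_ord0 /= !(tnth_nth 0) /= e3Z !AZ.
have e1P2 : ip G e1 (e2 *m P) = - c0.
  have -> : ip G e1 (e2 *m P) = - ip G (e1 *m P) e2 by rewrite skewP opprK.
  by rewrite -(split (e1 *m P)) ipDl HPhor // addr0 -/(psi e1) psi1 ipZl e22 mulr1.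
rewrite /A Ksec -?e3Z // e11 e22 e12 e1P2.
rewrite (TC e2 e1) !TT.
by rewrite -/al -/be -/ga ga5 be5 -/de; field.
Qed.

End Frame.

(** Some frame vector has a nonzero component orthogonal to [Z], since two orthonormal vectors
    cannot both lie on one line; that component is normalized. *)
Lemma vertical_unit_exists (U : 'I_3 -> 'rV[R]_5) :
  orthonormal_family G U -> (forall i, (U i <= kermx J)%MS) ->
  exists e1, [/\ e1 *m J = 0, ip G e1 e1 = 1 & ip G e1 Z = 0].
Proof.
move=> oU vU; pose X i := U i - ip G (U i) Z *: Z.
have UJ i : U i *m J = 0 by apply/sub_kermxP.
have XJ i : X i *m J = 0 by rewrite mulmxBl -scalemxAl ZJ UJ scaler0 subr0.
have XZ i : ip G (X i) Z = 0 by rewrite ipDl ipNl ipZl ZZ mulr1 subrr.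
have [i Xi] : exists i, X i != 0.
  apply/existsP/contraT; rewrite negb_exists => /forallP X0.
  have UE i : U i = ip G (U i) Z *: Z by have := X0 i; rewrite negbK subr_eq0 => /eqP.
  have UU i j : ip G (U i) Z * ip G (U j) Z = (i == j)%:R.
    by rewrite -oU [in RHS](UE i) [in RHS](UE j) ipZl ipZr ZZ mulr1.
  pose j : 'I_3 := Ordinal (isT : 1 < 3)%N.
  have /eqP := UU ord0 j; rewrite mulf_eq0 => /orP[] /eqP z0.
  - by have /eqP := UU ord0 ord0; rewrite z0 mul0r eq_sym oner_eq0.
  - by have /eqP := UU j j; rewrite z0 mul0r eq_sym oner_eq0.
have q0 := Gp Xi; pose r := Num.sqrt (ip G (X i) (X i)).
have r2 : r * r = ip G (X i) (X i) by rewrite -expr2 sqr_sqrtr // ltW.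
have r0 : r != 0 by rewrite gt_eqF // sqrtr_gt0.
exists (r^-1 *: X i); split.
- by rewrite -scalemxAl XJ scaler0.
- by rewrite ipZl ipZr -r2; field.
- by rewrite ipZl XZ mulr0.
Qed.

(** As omega is linear, the unit vector [x1 *: e1 + x2 *: e2] generates a slant frame whose fourth
    vector is [x1 *: e4 + x2 *: e5]; the coefficients are taken from H divided by its norm. *)
Lemma slant_frame_along H (U : 'I_3 -> 'rV[R]_5) :
  orthonormal_family G U -> (forall i, (U i <= kermx J)%MS) ->
  (forall z, z *m J = 0 -> ip G H z = 0) ->
  exists e1 e2 e3 e4 e5, slant_frame e1 e2 e3 e4 e5 /\ exists k, H = k *: e4.
Proof.
move=> oU vU Hhor; have [e1 [e1J e11 e1Z]] := vertical_unit_exists oU vU.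
have [e2 [e3 [e4 [e5 F]]]] : exists e2 e3 e4 e5, slant_frame e1 e2 e3 e4 e5.
  by do 4 eexists; exact: slant_frame_exists.
have [H0|H0] := eqVneq H 0.
  by exists e1, e2, e3, e4, e5; split=> //; exists 0; rewrite scale0r.
have [oe _ e2E e3Z [e4E e5E]] := F.
pose i1 : 'I_5 := ord0; pose i2 : 'I_5 := Ordinal (isT : 1 < 5)%N.
have e22 : ip G e2 e2 = 1 by have := oe i2 i2; rewrite !(tnth_nth 0).
have e12 : ip G e1 e2 = 0 by have := oe i1 i2; rewrite !(tnth_nth 0).
have e2Z : ip G e2 Z = 0.
  by have := oe i2 (Ordinal (isT : 2 < 5)%N); rewrite !(tnth_nth 0) /= e3Z.
have e2J : e2 *m J = 0 by rewrite e2E -scalemxAl VPJ scaler0.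
have HE : H = ip G H e4 *: e4 + ip G H e5 *: e5.
  apply: (ip_inj Gp) => w; rewrite ipDl !ipZl (hor_expand F w Hhor).
  by rewrite (gC e4 w) (gC e5 w).
pose r := Num.sqrt (ip G H H).
have rr : r * r = ip G H H by rewrite -expr2 sqr_sqrtr // ip_ge0.
have r0 : r != 0 by rewrite gt_eqF // sqrtr_gt0 Gp.
pose x1 := ip G H e4 / r; pose x2 := ip G H e5 / r.
have x12 : x1 ^+ 2 + x2 ^+ 2 = 1.
  rewrite /x1 /x2 !expr_div_n -mulrDl expr2 (expr2 (ip G H e5)) -(hor_expand F H Hhor).
  by rewrite -rr -expr2 divff // expf_neq0.
pose e1' := x1 *: e1 + x2 *: e2.
have e1J' : e1' *m J = 0 by rewrite mulmxDl -!scalemxAl e1J e2J !scaler0 addr0.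
have e11' : ip G e1' e1' = 1.
  rewrite ipDl !ipDr !ipZl !ipZr e11 e22 e12 (gC e2 e1) e12 -[RHS]x12; ring.
have e1Z' : ip G e1' Z = 0 by rewrite ipDl !ipZl e1Z e2Z !mulr0 addr0.
do 5 eexists; split; first exact: slant_frame_exists e1J' e11' e1Z'.
have om1 : omega e1 = s0 *: e4 by rewrite e4E scalerA mulfV // scale1r.
have om2 : omega e2 = s0 *: e5 by rewrite e5E scalerA mulfV // scale1r.
exists r; rewrite {1}HE /omega !mulmxDl -!scalemxAl -/(omega e1) -/(omega e2) om1 om2.
rewrite !scalerDr !scalerA.
by congr (_ *: _ + _ *: _); rewrite /x1 /x2; field; rewrite r0 sn0.
Qed.

Lemma slant_inequality (U f : 'I_3 -> 'rV[R]_5) :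
  orthonormal_family G U -> (forall i, (U i <= kermx J)%MS) ->
  orthonormal_family G f -> (forall i, (f i <= kermx J)%MS) ->
  let H := 3%:R^-1 *: \sum_(j < 3) T (U j) (U j) in
  let tau := \sum_(i < 3) \sum_(j < 3 | (i < j)%N) A (f i) (f j) (f j) (f i) in
  let bound := 8 / 9 * (tau - c / 4 * (1 + 3 * c0 ^+ 2)) in
  bound <= ip G H H /\
  (ip G H H = bound <->
   exists e1 e2 e3 e4 e5, [/\ slant_frame e1 e2 e3 e4 e5 /\ exists k, H = k *: e4,
     ip G (T e1 e1) e4 = 3 * ip G (T e2 e2) e4, ip G (T e1 e2) e4 = 0 &
     ip G (T e1 e1) e5 = 0]).
Proof.
move=> oU vU of_ vf H tau bound.
have Hhor z : z *m J = 0 -> ip G H z = 0.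
  by move=> zJ; rewrite ipZl ip_suml big1 ?mulr0 // => i _; exact: Thor.
have key e1 e2 e3 e4 e5 : slant_frame e1 e2 e3 e4 e5 ->
  9 * (ip G H H - bound) = (ip G (T e1 e1) e4 - 3 * ip G (T e2 e2) e4) ^+ 2
     + (ip G (T e2 e2) e5 - 3 * ip G (T e1 e2) e4) ^+ 2.
  move=> F; rewrite mulrBr (norm_mean_curvature_frame F oU vU).
  by rewrite /bound /tau (fibre_curvature_frame F of_ vf); field.
(* H along [e4] has no component on [e5], and T^5_11 = T^4_12. *)
have sum5 e1 e2 e3 e4 e5 k : slant_frame e1 e2 e3 e4 e5 -> H = k *: e4 ->
    ip G (T e1 e2) e4 + ip G (T e2 e2) e5 = 0.
  move=> F Hk; have := mean_curvature_frame F e5 oU vU; rewrite -/H Hk ipZl.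
  have [oe e1J _ _ _] := F.
  have -> : ip G e4 e5 = 0.
    by have := oe (Ordinal (isT : 3 < 5)%N) (Ordinal (isT : 4 < 5)%N); rewrite !(tnth_nth 0).
  rewrite mulr0 -(T_frame_sym F e1J); lra.
have [e1 [e2 [e3 [e4 [e5 [F [k Hk]]]]]]] := slant_frame_along oU vU Hhor.
split.
  rewrite -subr_ge0 -(@pmulr_rge0 _ 9) ?ltr0n // (key _ _ _ _ _ F).
  by rewrite addr_ge0 // sqr_ge0.
split=> [Hb|[f1 [f2 [f3 [f4 [f5 [[F' [k' Hk']] T1 T2 T3]]]]]]].
  exists e1, e2, e3, e4, e5.
  have /eqP := key _ _ _ _ _ F; rewrite Hb subrr mulr0 eq_sym paddr_eq0 ?sqr_ge0 //.
  rewrite !sqrf_eq0 !subr_eq0 => /andP[/eqP T1 /eqP T2].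
  have s5 := sum5 _ _ _ _ _ _ F Hk; have [_ e1J _ _ _] := F.
  (* T^5_22 equals 3 T^4_12 by the vanishing of the second square and - T^4_12 by the choice of
     frame. *)
  have T3 : ip G (T e1 e2) e4 = 0 by lra.
  by split=> //; [split=> //; exists k | rewrite -(T_frame_sym F e1J)].
have s5 := sum5 _ _ _ _ _ _ F' Hk'.
have := key _ _ _ _ _ F'; rewrite T1 T2 subrr.
have -> : ip G (T f2 f2) f5 = 0 by lra.
by rewrite mulr0 subrr expr0n /= addr0 => H9; lra.
Qed.

End SlantPointwise.

(** * Coordinate domains *)

Section Charts.
Variables (R : realType) (n : nat) (M : manifold R n).

Lemma atlas_chart (a : chart R n M) : atlas a -> is_chart a.
Proof. by case: M a => c at_ h1 h2 h3 h4 h5 a; exact: h3. Qed.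

Variables (g : metric M) (a : chart R n M) (U : set 'rV[R]_n).
Hypotheses (aM : atlas a) (oU : open U) (Ua : U `<=` fwd a @` dom a).

Lemma smooth_components_ndiff k l (t : components M k l) q :
  smooth_components t -> ndiff q U (t a).
Proof.
move=> ts; have [_ oa _ _ _] := atlas_chart aM.
by apply: (sub_ndiff Ua); apply: smooth_ndiff => //; exact: ts.
Qed.

Lemma metric_regular : regular_metric U (g a).
Proof.
have [ms mt mC mp] : [/\ smooth_components g,
   transforms (fun D G G' => G = D *m G' *m D^T) g,
   forall p a, chart_at p a -> (g a (fwd a p))^T = g a (fwd a p) &
   forall p a, chart_at p a -> forall v, v != 0 -> 0 < ip (g a (fwd a p)) v v].
  by case: (g).
split=> //; first exact: smooth_components_ndiff.
- by move=> x /Ua[p ap <-]; apply: mC.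
- by move=> x /Ua[p ap <-]; apply: mp.
Qed.

End Charts.

Lemma chart_preimage_open (R : realType) m n (M : manifold R m) (N : manifold R n)
    (F : M -> N) (a : chart R m M) (b : chart R n N) :
  atlas a -> atlas b -> continuous F -> open (fwd a @` (dom a `&` F @^-1` dom b)).
Proof.
move=> aM bN cF; have [oa oaf bf cf cb] := atlas_chart aM.
have [ob _ _ _ _] := atlas_chart bN.
rewrite openE => _ [p [ap Fp] <-].
have n1 : \forall z \near fwd a p, (fwd a @` dom a) z.
  by apply: open_nbhs_nbhs; split=> //; exists p.
have n2 : \forall z \near fwd a p, dom b (F (bwd a z)).
  have c : {for fwd a p, continuous (F \o bwd a)}.
    by apply: continuous_comp; [exact: cb|exact: cF].
  by apply: c; rewrite /= bf //; apply: open_nbhs_nbhs.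
apply: filterS2 n1 n2 => z [q aq <-] bq; exists q => //; split=> //.
by rewrite bf in bq.
Qed.

Section AlmostContact.
Variables (R : realType) (n : nat) (M : manifold R n) (S : acm_structure M).
Variables (a : chart R n M) (U : set 'rV[R]_n).
Hypotheses (aM : atlas a) (oU : open U) (Ua : U `<=` fwd a @` dom a).

Lemma acm_regular : cosymplectic S ->
  regular_acm U (acm_metric S a) (acm_phi S a) (acm_xi S a) (acm_eta S a).
Proof.
move=> [nS dS dPhi].
have [sphi sxi seta ax] : [/\ smooth_components (acm_phi S), smooth_components (acm_xi S),
  smooth_components (acm_eta S) & forall p a, chart_at p a ->
      let x := fwd a p in
      let g := acm_metric S a x in
      let phi := acm_phi S a x in
      let xi := acm_xi S a x in
      let eta := acm_eta S a x in
      [/\ phi *m phi = - 1%:M + eta *m xi, xi *m phi = 0, phi *m eta = 0,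
          xi *m eta = 1%:M &
          forall X Y : 'rV[R]_n,
            ip g (X *m phi) (Y *m phi) = ip g X Y - (X *m eta) 0 0 * (Y *m eta) 0 0
            /\ (X *m eta) 0 0 = ip g X xi]].
  by case: (S).
have hG : regular_metric U (acm_metric S a) by exact: metric_regular.
have chU x : U x -> exists2 p, chart_at p a & fwd a p = x.
  by move=> /Ua[p ap <-]; exists p.
split=> //; do ?exact: smooth_components_ndiff.
- by move=> x /chU[p pa <-]; have [] := ax p a pa.
- by move=> x /chU[p pa <-]; have [] := ax p a pa.
- move=> x /chU[p pa <-]; have [_ _ _ xe gX] := ax p a pa.
  by have [_ <-] := gX (acm_xi S a (fwd a p)) 0; rewrite xe mxE.
- move=> x /chU[p pa <-]; have [_ _ _ xe gX] := ax p a pa.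
  apply/row_matrixP => i; rewrite !rowE; apply/rowP => j; rewrite ord1.
  by have [_ ->] := gX (delta_mx 0 i) 0; rewrite ipE mulmxA.
- move=> x Ux; have [p pa px] := chU x Ux.
  have [pp xp pe xe gX] := ax p a pa; rewrite {}px in pp xp pe xe gX.
  move: (acm_metric S a x) (acm_phi S a x) (acm_xi S a x) (acm_eta S a x) pp xp pe xe gX.
  move=> G P Z E pp xp pe xe gX.
  (* The isometry relation at X and phi Y: phi^2 Y is -Y up to a multiple of xi, and phi X is
     orthogonal to xi. *)
  have sk X Y : ip G (X *m P) Y = - ip G X (Y *m P).
    have [h1 _] := gX X (Y *m P); have [_ h2] := gX (X *m P) 0.
    rewrite -!(mulmxA _ P E) pe !mulmx0 mx0E in h1 h2.
    rewrite -(mulmxA Y) pp mulmxDr mulmxN mulmx1 mulmxA ipDr ipNr in h1.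
    rewrite [Y *m E]mx11_scalar mul_scalar_mx ipZr -h2 mulr0 in h1; lra.
  apply/row_matrixP => i; rewrite !rowE; apply/rowP => j.
  have e (r : 'rV[R]_n) : (r *m (delta_mx 0 j : 'rV[R]_n)^T) 0 0 = r 0 j.
    by rewrite trmx_delta -colE mxE.
  have := sk (delta_mx 0 i) (delta_mx 0 j); rewrite !ipE trmx_mul.
  by rewrite -!mulmxA !(mulmxA P) !(mulmxA _ P^T) !mulmxA !e => ->; rewrite mulmxN mxNE mulmxA.
- by move=> x u v /chU[p pa <-]; exact: nS.
- by move=> x u v /chU[p pa <-]; exact: dS.
- by move=> x u v w /chU[p pa <-]; exact: dPhi.
Qed.

End AlmostContact.

Lemma norm_of_sqr (R : realType) n (G : 'M[R]_n) u : posdef G -> norm_of G u ^+ 2 = ip G u u.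
Proof. by move=> Gp; rewrite sqr_sqrtr // ip_ge0. Qed.

(** * The angle with the vertical space *)

Section AngleVert.
Variables (R : realType) (m n : nat) (G : 'M[R]_m) (J : 'M[R]_(m, n)).
Hypotheses (Gs : G^T = G) (Gp : posdef G).

Lemma ip_vert_hor w :
  ip G w w = ip G (w *m vert_proj G J) (w *m vert_proj G J)
           + ip G (w *m hor_proj G J) (w *m hor_proj G J).
Proof.
have vh : ip G (w *m hor_proj G J) (w *m vert_proj G J) = 0.
  by apply: hor_proj_hor; exact: vert_projJ.
have := proj_split J Gp w; move: (w *m vert_proj G J) (w *m hor_proj G J) vh => v h vh <-.
by rewrite ipDl !ipDr vh (ipC v h Gs) vh addr0 add0r.
Qed.

Let r w := norm_of G (w *m vert_proj G J) / norm_of G w.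

Lemma angle_vert_ratio w : 0 <= r w <= 1.
Proof.
rewrite /r divr_ge0 ?sqrtr_ge0 //=.
have [->|n0] := eqVneq (norm_of G w) 0; first by rewrite invr0 mulr0 ler01.
rewrite ler_pdivrMr ?mul1r; last by rewrite lt_def n0 sqrtr_ge0.
by rewrite ler_sqrt ?ip_ge0 // [leRHS]ip_vert_hor lerDl ip_ge0.
Qed.

(** The ratio lies in [0, 1], where [cos] inverts [acos]. Multiplying out the denominator includes
    the vector 0. *)
Lemma cos_angle_vert w :
  cos (angle_vert G J w) * norm_of G w = norm_of G (w *m vert_proj G J).
Proof.
have /andP[r0 r1] := angle_vert_ratio w.
rewrite acosK; last by rewrite in_itv /= r1 (le_trans _ r0) // lerN10.
have [n0|n0] := eqVneq (norm_of G w) 0; last by rewrite divfK.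
rewrite n0 mulr0; have /eqP := n0; rewrite sqrtr_eq0 => w0.
have {}w0 : ip G w w = 0 by apply/le_anti; rewrite w0 ip_ge0.
have -> : w = 0 by apply/eqP; rewrite -(ip_eq0 w Gp) w0.
by rewrite mul0mx /norm_of ip0l sqrtr0.
Qed.

(** The angle is the [acos] of a number in [0, 1], hence lies in [0, pi / 2]; the excluded values
    are the two endpoints. *)
Lemma angle_vert_proper w : angle_vert G J w <> 0 -> angle_vert G J w <> pi / 2 ->
  0 < cos (angle_vert G J w) /\ 0 < sin (angle_vert G J w).
Proof.
have /andP[r0 r1] := angle_vert_ratio w; rewrite /angle_vert -/(r w) => t0 t1.
have rn1 : -1 <= r w <= 1 by rewrite r1 (le_trans _ r0) // lerN10.
have rne0 : r w != 0 by apply/eqP => re; apply: t1; rewrite re acos0.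
have rne1 : r w != 1 by apply/eqP => re; apply: t0; rewrite re acos1.
rewrite acosK // sin_acos //; split; first by rewrite lt_def rne0.
by rewrite sqrtr_gt0 subr_gt0 expr_lt1 // lt_def eq_sym rne1.
Qed.

End AngleVert.

(** * The pointwise hypotheses verified in a pair of charts *)

Section SlantBridge.
Variables (R : realType) (M : manifold R 5) (N : manifold R 2) (S : acm_structure M).
Variables (gN : metric N) (c theta : R) (F : M -> N).
Hypotheses (hM : cosymplectic_space_form S c)
  (hF : riemannian_submersion (acm_metric S) gN F) (hslant : proper_slant S F theta)
  (hxi : xi_vertical S F).
Variables (a : chart R 5 M) (b : chart R 2 N).
Hypotheses (aM : atlas a) (bN : atlas b).

Let O := fwd a @` (dom a `&` F @^-1` dom b).
Let G := acm_metric S a.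
Let P := acm_phi S a.
Let Z := acm_xi S a.
Let E := acm_eta S a.
Let L := local_rep F a b.

Let Oa : O `<=` fwd a @` dom a.
Proof. by move=> _ [p [ap _] <-]; exists p. Qed.

Let oO : open O.
Proof. by have [[cF _] _ _] := hF; exact: chart_preimage_open. Qed.

Let chO x : O x -> exists p, [/\ chart_at p a, chart_at (F p) b & fwd a p = x].
Proof. by move=> [p [ap Fp] <-]; exists p. Qed.

Let hS : regular_acm O G P Z E.
Proof. by apply: acm_regular => //; case: hM. Qed.

Let hG : regular_metric O G := racm_metric hS.

Lemma submersion_regular : regular_submersion O G L.
Proof.
have [[_ sF] _ rF] := hF; split=> // [|x Ox].
  by apply: smooth_ndiff => //; exact: sF.
by have [p [pa pb <-]] := chO Ox; have [] := rF p a b pa pb.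
Qed.

Let hL := submersion_regular.

Lemma xi_vert x : O x -> Z x *m 'J L x = 0.
Proof. by move=> Ox; have [p [pa pb <-]] := chO Ox; apply/verticalP; exact: hxi. Qed.

Lemma slant_norm x v : O x -> v *m 'J L x = 0 ->
  ip (G x) (v *m P x *m vproj G L x) (v *m P x *m vproj G L x) =
  cos theta ^+ 2 * (ip (G x) v v - ip (G x) v (Z x) ^+ 2).
Proof.
move=> Ox vJ; have [p [pa pb px]] := chO Ox; have Gp := regular_pos hG Ox.
have Gs := regular_sym hG Ox; rewrite -vprojE.
have [sl _ _] := hslant.
have PP : ip (G x) (v *m P x) (v *m P x) = ip (G x) v v - ip (G x) v (Z x) ^+ 2.
  by rewrite (acm_isometry hS Ox) expr2.
(* The slant condition is silent on multiples of xi; for these phi v = 0 and both sides vanish. *)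
have [[k ->]|nk] := pselect (exists k, v = k *: Z x).
  rewrite -scalemxAl (racm_phixi hS Ox) scaler0 mul0mx ip0l.
  by rewrite !ipZl ipZr (racm_unit hS Ox); ring.
have v0 : v != 0 by apply/eqP => v0; apply: nk; exists 0; rewrite scale0r.
rewrite -PP -!norm_of_sqr // -exprMn -(cos_angle_vert ('J L x) Gs Gp (v *m P x)).
congr ((_ * _) ^+ 2); congr cos; rewrite -px.
by apply: sl => //; rewrite px; [exact/verticalP|].
Qed.

Let K x u v w z := ip (G x) (w *m Rm G u v x) z.

(** The space form condition concerns unit vectors; the curvature term is homogeneous of degree four
    in [u]. *)
Lemma phi_sectional x u : O x -> ip (G x) u (Z x) = 0 ->
  K x u (u *m P x) (u *m P x) u = c * ip (G x) u u ^+ 2.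
Proof.
move=> Ox uZ; have [p [pa _ px]] := chO Ox; have Gp := regular_pos hG Ox.
have [->|u0] := eqVneq u 0; first by rewrite /K mul0mx mul0mx !ip0l expr0n mulr0.
have [e [r [uE ee eZ rr]]] : exists e r,
    [/\ u = r *: e, ip (G x) e e = 1, ip (G x) e (Z x) = 0 & r * r = ip (G x) u u].
  pose r := norm_of (G x) u; exists (r^-1 *: u), r.
  have rr : r * r = ip (G x) u u by rewrite -expr2 norm_of_sqr.
  have r0 : r != 0 by rewrite gt_eqF // sqrtr_gt0 Gp.
  split=> //; first by rewrite scalerA mulfV // scale1r.
  - by rewrite ipZl ipZr -rr; field.
  - by rewrite ipZl uZ mulr0.
have := hM.2 p a pa; rewrite px => /(_ e ee eZ) /=.
rewrite (curvatureE hG _ _ _ Ox) -/(P x) -/(G x) => He.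
have Rl a' b' u' v' : Rm G (a' *: u') (b' *: v') x = (a' * b') *: Rm G u' v' x.
  have l0 d z y : Rm G (d *: z) y x = d *: Rm G z y x.
    have R0 : Rm G 0 y x = 0.
      by have := Rm_linear hG (-1) 0 0 y Ox; rewrite scaler0 addr0 scaleN1r addNr.
    by have := Rm_linear hG d z 0 y Ox; rewrite R0 !addr0.
  by rewrite l0 RmC l0 -scalerN -RmC scalerA.
rewrite {1 2 3 4}uE /K -!scalemxAl Rl -scalemxAr ipZl ipZl ipZr He -rr.
by ring.
Qed.

Lemma sectional_slant x u v : O x -> ip (G x) u (Z x) = 0 -> ip (G x) v (Z x) = 0 ->
  K x u v v u = c / 4 * (ip (G x) u u * ip (G x) v v - ip (G x) u v ^+ 2
                        + 3 * ip (G x) u (v *m P x) ^+ 2).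
Proof.
move=> Ox; have gs u' v' := metric_sym hG u' v' Ox.
have R1 u' v' w' : Rm G (u' + v') w' x = Rm G u' w' x + Rm G v' w' x.
  by have := Rm_linear hG 1 u' v' w' Ox; rewrite !scale1r.
have R0 w' : Rm G 0 w' x = 0.
  by have := Rm_linear hG (-1) 0 0 w' Ox; rewrite scaler0 addr0 scaleN1r addNr.
have RN u' w' : Rm G (- u') w' x = - Rm G u' w' x.
  by have := Rm_linear hG (-1) u' 0 w' Ox; rewrite R0 !addr0 !scaleN1r.
apply: (@space_form_sectional _ _ (ip (G x)) (K x) (fun v : 'rV[R]_5 => v *m P x)
  (fun v => ip (G x) v (Z x) = 0)) => //.
- by move=> *; exact: ipDl.
- by move=> *; exact: ipNl.
- by move=> *; rewrite /K R1 mulmxDr ipDl.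
- by move=> *; rewrite /K RN mulmxN ipNl.
- by move=> *; rewrite /K mulmxDl ipDl.
- by move=> *; rewrite /K mulNmx ipNl.
- by move=> *; rewrite /K RmC mulmxN ipNl.
- by move=> *; rewrite /K (Rm_skew hG) // gs.
- by move=> u' v' w' z; rewrite /K -!ipDl (bianchi hG) // ip0l.
- by move=> u' v' w' z; rewrite /K -mulmxA -(Rm_phi hS) // mulmxA (acm_skew hS).
- by move=> *; rewrite mulmxDl.
- by move=> *; rewrite mulNmx.
- by move=> u' v' h1 h2; rewrite ipDl h1 h2 addr0.
- by move=> u' h1; rewrite ipNl h1 oppr0.
- by move=> u'; rewrite (acm_skew hS) // (racm_phixi hS) // ip0r oppr0.
- by move=> u' h1; rewrite (acm_phiphi hS) // h1 scale0r addr0.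
- by move=> u' v' h1 h2; rewrite (acm_isometry hS) // h1 mul0r subr0.
- by move=> u' h1; exact: phi_sectional.
Qed.

(** [theta] is a bare real number until the slant condition is evaluated on a vertical unit vector
    orthogonal to xi, which the frame provides. *)
Lemma slant_angle_pos x (U : 'I_3 -> 'rV[R]_5) : O x ->
  orthonormal_family (G x) U -> (forall i, (U i <= kermx ('J L x))%MS) ->
  0 < cos theta /\ 0 < sin theta.
Proof.
move=> Ox oU vU; have Gp := regular_pos hG Ox; have Gs := regular_sym hG Ox.
have [e [eJ e11 eZ]] := vertical_unit_exists Gs Gp (racm_unit hS Ox) (xi_vert Ox) oU vU.
have [sl t0 t1] := hslant; have [p [pa pb px]] := chO Ox.
have e0 : e != 0 by apply/eqP => e0; move/eqP: e11; rewrite e0 ip0l eq_sym oner_eq0.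
have nk : ~ exists k, e = k *: Z x.
  move=> [k ek]; move: eZ; rewrite ek ipZl (racm_unit hS Ox) mulr1 => k0.
  by move/eqP: e0; rewrite ek k0 scale0r.
have th : angle_vert (G x) ('J L x) (e *m P x) = theta.
  by rewrite -px; apply: sl => //; rewrite px //; exact/verticalP.
by rewrite -th; apply: angle_vert_proper; rewrite ?th.
Qed.

Lemma pointwise_inequality x (U f : 'I_3 -> 'rV[R]_5) : O x ->
  orthonormal_family (G x) U -> (forall i, (U i <= kermx ('J L x))%MS) ->
  orthonormal_family (G x) f -> (forall i, (f i <= kermx ('J L x))%MS) ->
  let T := Tvert G L x in
  let H := 3%:R^-1 *: \sum_(j < 3) T (U j) (U j) in
  let tau := \sum_(i < 3) \sum_(j < 3 | (i < j)%N)
    (K x (f i) (f j) (f j) (f i) + ip (G x) (T (f j) (f j)) (T (f i) (f i))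
       - ip (G x) (T (f i) (f j)) (T (f j) (f i))) in
  let bound := 8 / 9 * (tau - c / 4 * (1 + 3 * cos theta ^+ 2)) in
  bound <= ip (G x) H H /\
  (ip (G x) H H = bound <->
   exists e1 e2 e3 e4 e5,
    [/\ slant_frame (G x) (P x) (vproj G L x) (hproj G L x) ('J L x) (Z x)
          (cos theta) (sin theta) e1 e2 e3 e4 e5 /\ exists k, H = k *: e4,
     ip (G x) (T e1 e1) e4 = 3 * ip (G x) (T e2 e2) e4, ip (G x) (T e1 e2) e4 = 0 &
     ip (G x) (T e1 e1) e5 = 0]).
Proof.
move=> Ox oU vU of_ vf T; have Gp := regular_pos hG Ox; have Gs := regular_sym hG Ox.
have [c0 s0] := slant_angle_pos Ox oU vU.
have TC u v : T u v = T v u by rewrite /T /Tvert (Timage_sym hL Ox).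
have Tr a' u v w : T w (a' *: u + v) = a' *: T w u + T w v.
  by rewrite /T /Tvert Timage_linear mulmxDl -scalemxAl.
apply: (@slant_inequality R (G x) (P x) (vproj G L x) (hproj G L x) ('J L x) (Z x) T
   (K x) (cos theta) (sin theta) c) => //.
- exact: rsub_rank hL _ Ox.
- exact: vproj_hproj hL _ Ox.
- exact: vprojJ.
- exact: hproj_hor.
- exact: acm_skew hS _ Ox.
- exact: racm_phixi hS _ Ox.
- exact: racm_unit hS _ Ox.
- exact: xi_vert.
- exact: acm_isometry hS _ Ox.
- exact: cos2Dsin2.
- by move=> u v; exact: (slant_polar hL slant_norm Ox).
- by move=> u v w; exact: (Tvert_hor hL Ox).
- by move=> u; exact: (Tvert_xi hS hL xi_vert Ox).
- by move=> u v; exact: (slant_Tvert hS hL xi_vert slant_norm Ox).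
- by move=> *; rewrite /K (Rm_linear hG) // mulmxDr -scalemxAr ipDl ipZl.
- by move=> *; rewrite /K ipDr ipZr.
- by move=> *; rewrite /K RmC mulmxN ipNl.
- by move=> *; rewrite /K (Rm_skew hG) // (metric_sym hG).
- by move=> *; rewrite /K (xi_Rm hS) // ip0l.
- by move=> u v; exact: sectional_slant.
Qed.

End SlantBridge.

Theorem theorem8 (R : realType) (M : manifold R 5) (N : manifold R 2)
    (S : acm_structure M) (gN : metric N) (c theta : R) (F : M -> N)
    (hM : cosymplectic_space_form S c)
    (hF : riemannian_submersion (acm_metric S) gN F)
    (hslant : proper_slant S F theta)
    (hxi : xi_vertical S F)
    (p : M) (a : chart R 5 M) (b : chart R 2 N)
    (ha : chart_at p a) (hb : chart_at (F p) b)
    (U : 'I_3 -> 'rV[R]_5)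
    (hUvert : forall i, (U i <= vert_space (dF F a b (fwd a p)))%MS)
    (hU : orthonormal_family (acm_metric S a (fwd a p)) U)
    (s : 'rV[R]_3 -> M) (w0 : 'rV[R]_3)
    (hs : fibre_parametrization F p s w0)
    (u : 'I_3 -> 'rV[R]_3)
    (hu : orthonormal_family (induced_metric (acm_metric S) a s w0) u) :
  let x := fwd a p in
  let G := acm_metric S a in
  let H := mean_curvature G (dF F a b) x U in
  let tau := scalar_curvature (induced_metric (acm_metric S) a s) w0 u in
  let bound := 8 / 9 * (tau - c / 4 * (1 + 3 * cos theta ^+ 2)) in
  let T (ei ej ealpha : 'rV[R]_5) : R :=
    ip (G x) (oneillT_at G (dF F a b) x ei ej) ealpha in
  norm_of (G x) H ^+ 2 >= bound
  /\ (norm_of (G x) H ^+ 2 = bound <->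
      exists e1 e2 e3 e4 e5 : 'rV[R]_5,
        [/\ suitable_slant_basis S F theta a b x H e1 e2 e3 e4 e5,
            T e1 e1 e4 = 3 * T e2 e2 e4,
            T e1 e2 e4 = 0 &
            T e1 e1 e5 = 0]).
Proof.
move=> x G H tau bound T.
have [aM ap] := ha; have [bN Fp] := hb.
pose L := local_rep F a b.
pose O := fwd a @` (dom a `&` F @^-1` dom b).
have [[cF _] _ _] := hF.
have oO : open O by exact: chart_preimage_open.
have Ox : O x by exists p.
have hL : regular_submersion O G L by exact: (submersion_regular hM hF aM bN).
have hG := rsub_metric hL.
have Gp := regular_pos hG Ox.
have [kn [W [[oW Ww0] sw0 sF cs sm]]] := hs.
pose f := fwd a \o s.
(* The parameters are restricted to those landing in the chart [a]; the chart [b] is automatic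
   because [F] is constant along [s]. *)
pose W' := W `&` s @^-1` dom a.
have [oa _ bf _ _] := atlas_chart aM.
have oW' : open W'.
  rewrite openE => w [Ww aw]; apply: filterI; first exact: open_nbhs_nbhs.
  by apply: (cs w Ww); exact: open_nbhs_nbhs.
have W'w0 : W' w0 by split=> //; rewrite /= sw0.
have [sf rf] := sm a aM.
have df : ndiff 4 W' f by exact: smooth_ndiff.
have fO w : W' w -> O (f w).
  by move=> [Ww aw]; exists (s w) => //; split=> //=; rewrite sF.
have fS w : W' w -> row_free ('J f w) by move=> [Ww aw]; exact: rf.
have fib w w' : W' w -> W' w' -> L (f w) = L (f w').
  by move=> [Ww aw] [Ww' aw']; rewrite /L /local_rep /f /= !bf // !sF.
have fw0 : f w0 = x by rewrite /f /= sw0.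
pose h := induced_metric (acm_metric S) a s.
have hh : regular_metric W' h by exact: (regular_induced hL oW' df fO fS).
have vU i : (U i <= kermx ('J L x))%MS by exact: hUvert.
(* The frame of the fibre pushed forward to the vertical space at [x]; it is orthonormal there
   because the induced metric is the pullback. *)
pose f3 i := u i *m 'J f w0.
have oneillE v w : v *m 'J L x = 0 -> w *m 'J L x = 0 ->
  oneillT_at G (dF F a b) x v w = Tvert G L x v w by exact: (oneillT_vertical hL Ox).
have of3 : orthonormal_family (G x) f3.
  by move=> i j; rewrite -hu ipE /f3 ipE trmx_mul /induced_metric -fw0 !mulmxA.
have vf3 i : (f3 i <= kermx ('J L x))%MS.
  by apply/sub_kermxP; rewrite -fw0; exact: (immersionJ hL oW' df fO fib W'w0).
have HE : H = 3%:R^-1 *: \sum_(j < 3) Tvert G L x (U j) (U j).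
  congr (_ *: _); apply: eq_bigr => j _.
  by rewrite oneillE //; apply/sub_kermxP.
have tauE : tau = \sum_(i < 3) \sum_(j < 3 | (i < j)%N)
    (ip (G x) (f3 j *m Rm G (f3 i) (f3 j) x) (f3 i)
       + ip (G x) (Tvert G L x (f3 j) (f3 j)) (Tvert G L x (f3 i) (f3 i))
       - ip (G x) (Tvert G L x (f3 i) (f3 j)) (Tvert G L x (f3 j) (f3 i))).
  apply: eq_bigr => i _; apply: eq_bigr => j ij.
  (* For distinct orthonormal vectors the denominator of the sectional curvature is 1. *)
  have ne : (i == j) = false by apply: negbTE; rewrite neq_ltn ij.
  have sT v w : v *m sff G f w w0 = Tvert G L x (w *m 'J f w0) (v *m 'J f w0).
    by rewrite (sff_Tvert hL oW' df fO fS kn fib w v W'w0) fw0.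
  rewrite /sectional !hu !eqxx ne mulr1 expr0n subr0 divr1 (curvatureE hh _ _ _ W'w0).
  rewrite /f3 -!sT -fw0.
  exact: (gauss_sectional hL oW' df fO fS (u i) (u j) W'w0).
have [ineq eq] := pointwise_inequality hM hF hslant hxi aM bN Ox hU vU of3 vf3.
rewrite (norm_of_sqr _ Gp) /bound HE tauE; split=> //.
have frameP e1 e2 e3 e4 e5 : slant_frame (G x) (acm_phi S a x) (vproj G L x) (hproj G L x)
    ('J L x) (acm_xi S a x) (cos theta) (sin theta) e1 e2 e3 e4 e5 <->
    slant_basis S F theta a b x e1 e2 e3 e4 e5.
  rewrite /slant_frame /slant_basis /psi /omega -vprojE -hprojE.
  by split; case=> o v1 v2 v3 v45; split=> //; exact/verticalP.
(* [oneillT_at] and [Tvert] agree on vertical vectors only, so the translation is restricted to [e1]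
   and [e2]. *)
have frameT e1 e2 e3 e4 e5 i j k : slant_basis S F theta a b x e1 e2 e3 e4 e5 ->
    i \in [:: e1; e2] -> j \in [:: e1; e2] -> T i j k = ip (G x) (Tvert G L x i j) k.
  move=> B; have [_ v1 _ _ _] := (frameP _ _ _ _ _).2 B; have [_ _ v2 _ _] := (frameP _ _ _ _ _).2 B.
  have v2J : e2 *m 'J L x = 0 by rewrite v2 -scalemxAl vprojJ scaler0.
  by rewrite !inE /T => /orP[]/eqP-> /orP[]/eqP->; rewrite oneillE.
apply: (iff_trans eq).
split; move=> [e1 [e2 [e3 [e4 [e5 [[B Hk] T1 T2 T3]]]]]]; exists e1, e2, e3, e4, e5.
  have {}B := (frameP _ _ _ _ _).1 B.
  by split; [split|..]; rewrite ?(frameT _ _ _ _ _ _ _ _ B) ?inE ?eqxx ?orbT.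
split; first by split=> //; exact/frameP.
all: by rewrite -?(frameT _ _ _ _ _ _ _ _ B) ?inE ?eqxx ?orbT.
Qed.
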